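(* Let $p\in(1,\infty]$, $\xi\in L^p(\mathcal F_T)^d$ and $F:\mathbb S^p\times\mathbb M^p_0\to\mathbb S^p_0$. Let $c_2=\frac15$, $c_\infty=\frac14$ and $c_p=\frac{p-1}{4p-1}$ for $p\in(1,\infty)\setminus\{2\}$. If there exist a number $k\in\mathbb N$ and a constant $C<c_p$ such that $$\|F^{(k)}(Y,M)-F^{(k)}(Y',M')\|_{\mathbb S^p}\le C\left(\|Y-Y'\|_{\mathbb S^p}+\|M-M'\|_{\mathbb S^p}\right)\quad\text{for all }Y,Y'\in\mathbb S^p\text{ and }M,M'\in\mathbb M^p_0,$$ then the BSE $$Y_t+F_t(Y,M)+M_t=\xi+F_T(Y,M)+M_T,\qquad t\in[0,T],$$ has a unique solution $(Y,M)$ in $\mathbb S^p\times\mathbb M^p_0$.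
   Context: Fix a finite time horizon $T\in[0,\infty)$, a dimension $d\in\mathbb N$ and a filtered probability space $(\Omega,\mathcal F,\mathbb F,\mathbb P)$ whose filtration $\mathbb F=(\mathcal F_t)_{t\in[0,T]}$ satisfies the usual conditions; all martingales are taken in their RCLL (right-continuous with left limits) modification. $|\cdot|$ is the Euclidean norm. For a $d$-dimensional random vector $X$, $\|X\|_p:=(\mathbb E|X|^p)^{1/p}$ if $p<\infty$ and $\|X\|_\infty:=\operatorname{ess\,sup}_{\omega\in\Omega}|X|$. For $p\in(1,\infty]$: $L^p(\mathcal F_t)^d$ is the set of $d$-dimensional $\mathcal F_t$-measurable random vectors $X$ with $\|X\|_p<\infty$; $\mathbb S^p$ is the set of $\mathbb R^d$-valued RCLL adapted processes $(Y_t)_{0\le t\le T}$ with $\|Y\|_{\mathbb S^p}:=\|\sup_{0\le t\le T}|Y_t|\|_p<\infty$; $\mathbb S^p_0:=\{Y\in\mathbb S^p:Y_0=0\}$; $\mathbb M^p_0$ is the set of all martingales in $\mathbb S^p_0$. $F_t(Y,M)$ denotes the value at time $t$ of the process $F(Y,M)$. For $(Y,M)\in\mathbb S^p\times\mathbb M^p_0$ and $k\in\mathbb N=\{1,2,\dots\}$, define $F^{(k)}_t(Y,M):=F_t(Y^{(k,M)},M)$, where $Y^{(k,M)}$ is recursively given by $Y^{(1,M)}:=Y$ and $Y^{(k,M)}_t:=Y_0-F_t(Y^{(k-1,M)},M)-M_t$ for $k\ge2$. A solution of the BSE is a pair $(Y,M)\in\mathbb S^p\times\mathbb M^p_0$ satisfying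 the equation for all $t\in[0,T]$. *)

(* Defs.v *)
From HB Require Import structures.
From mathcomp Require Import all_boot all_order all_algebra.
From mathcomp Require Import all_classical all_reals all_analysis.

Set Implicit Arguments.
Unset Strict Implicit.
Unset Printing Implicit Defensive.

Import Order.TTheory GRing.Theory Num.Theory.
Import numFieldNormedType.Exports.

Local Open Scope classical_set_scope.
Local Open Scope ring_scope.

(* The norm `|v| of MathComp-Analysis on row vectors is the sup norm. *)
Definition enorm (R : realType) (n : nat) (v : 'rV[R]_n) : R :=
  Num.sqrt (\sum_(i < n) v ord0 i ^+ 2).

(* Processes are indexed by R, but every notion below only looks at the times
   in [0, T]. They are genuine functions of (t, w); the identification of
   indistinguishable processes is made explicit by [indist]. *)
Definition process (R : realType) (d : measure_display)
    (Omega : measurableType d) (n : nat) : Type :=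
  R -> Omega -> 'rV[R]_n.

Section Processes.
Context (R : realType) (d : measure_display) (Omega : measurableType d).
Context (P : probability Omega R) (T : R) (FF : R -> set (set Omega)).
Context (n : nat).

Local Notation process := (process R Omega n).

Record is_filtration : Prop := {
  filtration_sigma : forall t : R, t \in `[0, T] -> sigma_algebra setT (FF t);
  filtration_sub : forall t : R, t \in `[0, T] -> FF t `<=` measurable;
  filtration_mono : forall s t : R, s \in `[0, T] -> t \in `[0, T] ->
    s <= t -> FF s `<=` FF t }.

(* [P.-negligible N] means that N is contained in a measurable P-null set, so
   the second clause includes the completeness of the probability space. *)
Definition usual_conditions : Prop :=
  (forall t : R, t \in `[0, T[ -> \bigcap_(s in `]t, T]) FF s `<=` FF t) /\
  (forall N : set Omega, P.-negligible N -> FF 0 N).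

Definition measurable_wrt (G : set (set Omega)) (X : Omega -> R) : Prop :=
  forall B : set R, measurable B -> G (X @^-1` B).

Definition vmeasurable_wrt (G : set (set Omega)) (X : Omega -> 'rV[R]_n) :
    Prop :=
  forall i, measurable_wrt G (fun w => X w ord0 i).

Definition vLnorm (p : \bar R) (X : Omega -> 'rV[R]_n) : \bar R :=
  Lnorm P p (fun w => (enorm (X w))%:E).

Definition Lp_wrt (p : \bar R) (G : set (set Omega)) (X : Omega -> 'rV[R]_n) :
    Prop :=
  vmeasurable_wrt G X /\ (vLnorm p X < +oo)%E.

Definition adapted (Y : process) : Prop :=
  forall t : R, t \in `[0, T] -> vmeasurable_wrt (FF t) (Y t).

Definition rcll (Y : process) : Prop :=
  forall w,
    (forall t : R, t \in `[0, T[ -> Y s w @[s --> t^'+] --> Y t w) /\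
    (forall t : R, t \in `]0, T] -> cvg (Y s w @[s --> t^'-])).

Definition sup_norm (Y : process) (w : Omega) : \bar R :=
  ereal_sup [set (enorm (Y t w))%:E | t in `[0, T]].

Definition Sp_norm (p : \bar R) (Y : process) : \bar R :=
  Lnorm P p (sup_norm Y).

Definition Sp (p : \bar R) (Y : process) : Prop :=
  [/\ rcll Y, adapted Y & (Sp_norm p Y < +oo)%E].

Definition Sp0 (p : \bar R) (Y : process) : Prop :=
  Sp p Y /\ {ae P, forall w, Y 0 w = 0}.

(* Z is a version of E[X | G], for an integrable X *)
Definition is_cond_exp (G : set (set Omega)) (X Z : Omega -> R) : Prop :=
  [/\ measurable_wrt G Z, P.-integrable setT (EFin \o Z) &
      forall A, G A ->
        (\int[P]_(w in A) (Z w)%:E = \int[P]_(w in A) (X w)%:E)%E].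

Definition martingale (M : process) : Prop :=
  [/\ adapted M,
      (forall (t : R) i, t \in `[0, T] ->
        P.-integrable setT (fun w => (M t w ord0 i)%:E)) &
      forall (s t : R) i, s \in `[0, T] -> t \in `[0, T] -> s <= t ->
        is_cond_exp (FF s) (fun w => M t w ord0 i) (fun w => M s w ord0 i)].

Definition Mp0 (p : \bar R) (M : process) : Prop :=
  Sp0 p M /\ martingale M.

Definition indist (X Y : process) : Prop :=
  {ae P, forall w, forall t : R, t \in `[0, T] -> X t w = Y t w}.

(* F is a map S^p x M^p_0 -> S^p_0, where the elements of these spaces are
   processes up to indistinguishability. *)
Definition is_Sp_map (p : \bar R) (F : process -> process -> process) : Prop :=
  (forall Y M, Sp p Y -> Mp0 p M -> Sp0 p (F Y M)) /\
  (forall Y Y' M M', Sp p Y -> Sp p Y' -> Mp0 p M -> Mp0 p M' ->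
    indist Y Y' -> indist M M' -> indist (F Y M) (F Y' M')).

(* [iterY F Y M j] is Y^(j+1, M): the recursion starts at Y^(1, M) = Y. *)
Fixpoint iterY (F : process -> process -> process) (Y M : process) (j : nat) :
    process :=
  if j is j'.+1 then fun t w => Y 0 w - F (iterY F Y M j') M t w - M t w
  else Y.

(* F^(k), meaningful for k >= 1 *)
Definition iterF (F : process -> process -> process) (k : nat)
    (Y M : process) : process :=
  F (iterY F Y M k.-1) M.

Definition BSE_solution (p : \bar R) (F : process -> process -> process)
    (xi : Omega -> 'rV[R]_n) (Y M : process) : Prop :=
  [/\ Sp p Y, Mp0 p M &
      {ae P, forall w, forall t : R, t \in `[0, T] ->
        Y t w + F Y M t w + M t w = xi w + F Y M T w + M T w}].

Definition psub (X Y : process) : process := fun t w => X t w - Y t w.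

End Processes.

Definition cp (R : realType) (p : \bar R) : R :=
  match p with
  | r%:E => if r == 2 then 1 / 5 else (r - 1) / (4 * r - 1)
  | +oo%E => 1 / 4
  | -oo%E => 0 (* unused: p > 1 *)
  end.

(* Main.v *)
Require Import Defs.
From HB Require Import structures.
From mathcomp Require Import all_boot all_order all_algebra.
From mathcomp Require Import all_classical all_reals all_analysis.
From mathcomp Require Import measurable_realfun ess_sup_inf hoelder exp.
From mathcomp Require Import ring lra zify.

(** At time 0 the equation reads [Y_0 = xi + F_T(Y, M) + M_T], so a solution
satisfies [Y = Y_0 - F(Y, M) - M]. Hence [Y^(j, M) = Y] for every [j] and
[F^(k)(Y, M) = F(Y, M)]. Put [G = F^(k)(Y, M)] and let [N] be the
right-continuous martingale with [N_T = xi + G_T]. Then [Y = N - G] and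
[M = N_0 - N]: a solution is a fixed point of the Picard map which sends
[(Y, M)] to [(N - G, N_0 - N)] ([solution_picard]).

Take two arguments of this map, and let [dG] and [dN] be the differences of
the two processes [G] and [N]. As [dN] is a martingale with terminal value
[dG_T], Doob's inequality with [q = p / (p - 1)] (and [q = 1] for [p = +oo])
gives [|dN| <= q |dG|] in [S^p]. The images then differ by at most
[(1 + q) |dG|] in the first component and by [2 q |dG|] in the second, and
[1 + 3 q = 1 / c_p]. For [p = 2] the second bound improves: [dN_0 - dN] is a
martingale, and by orthogonality of increments its terminal value is at most
[|dG_T|] in [L^2], which gives [1 + 2 + 2 = 5] in total
([picard_estimate]). So the Picard map is a contraction with ratio [C / c_p].
Since [S^p] is complete and limits of martingales in [S^p] are martingales,
it has a fixed point ([picard_fixed_point]), unique up to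
indistinguishability.

A fixed point only satisfies [Y = Y_0 - F^(k)(Y, M) - M], that is
[Y = Y^(k+1, M)]. Put [Z = Y^(2, M) = Y_0 - F(Y, M) - M]. Shifting the
recursion by one step, [F^(k)(Z, M) = F(Y^(k+1, M), M) = F(Y, M)], hence
[Y - Z = F^(k)(Z, M) - F^(k)(Y, M)]. The Lipschitz bound with [C < 1] then
gives [Y = Z], and the equation follows ([fixed_point_solution]).

The stochastic analysis rests on three facts. Conditional expectations exist by
the Radon-Nikodym theorem ([cond_exp_exists]). Doob's inequality ([doob])
follows, along dyadic times, from an inequality between real sequences
([doob_pathwise]) and from the submartingale property of the Euclidean norm
([enorm_submartingale]). The expected number of upcrossings of an interval
along dyadic times is bounded ([upcrossing_expectation]), so almost every path
of a martingale has one-sided limits along these times; under the usual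
conditions the right limits form an adapted right-continuous version
([rcll_martingale_exists]). *)

Set Implicit Arguments.
Unset Strict Implicit.
Unset Printing Implicit Defensive.

Import Order.TTheory GRing.Theory Num.Theory.
Import numFieldNormedType.Exports.

Local Open Scope classical_set_scope.
Local Open Scope ring_scope.

(** * Lp norms of nonnegative functions *)

Lemma ereal_nondecreasing_limn_ge (R : realType) (u : (\bar R)^nat) n :
  nondecreasing_seq u -> (u n <= limn u)%E.
Proof.
move=> ndu; rewrite (cvg_lim _ (ereal_nondecreasing_cvgn ndu))//.
by apply: ereal_sup_ubound; exists n.
Qed.

Lemma lee_poweR (R : realType) (s : R) (x y : \bar R) :
  0 <= s -> (0 <= x)%E -> (x <= y)%E -> (x `^ s <= y `^ s)%E.
Proof.
move=> s0 x0 xy; apply: gt0_ler_poweR => //; rewrite in_itv/= leey andbT//.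
exact: le_trans xy.
Qed.

Section Lnorm_nonneg.
Context (R : realType) (d : measure_display) (Omega : measurableType d).
Context (P : probability Omega R) (p : \bar R).
Hypothesis p_gt1 : (1 < p)%E.
Local Open Scope ereal_scope.
Implicit Types f g : Omega -> \bar R.

Lemma integral_probability_cst (c : \bar R) : \int[P]_w c = c.
Proof. by rewrite integral_cst//= -[RHS]mule1; congr (_ * _); exact: probability_setT. Qed.

Lemma Lnorm_lee r f (c : \bar R) : (0 < r)%R -> (forall w, 0 <= f w) -> 0 <= c ->
  (Lnorm P r%:E f <= c) = (\int[P]_w (f w `^ r) <= c `^ r).
Proof.
move=> r0 f0 c0; rewrite unlock.
have -> : \int[P]_x `|f x| `^ r = \int[P]_x f x `^ r.
  by apply: eq_integral => x _; rewrite gee0_abs.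
set I := \int[P]_x _.
have I0 : 0 <= I by apply: integral_ge0 => x _; exact: poweR_ge0.
apply/idP/idP => h.
  have -> : I = (I `^ r^-1) `^ r.
    by rewrite -poweRrM mulVf ?gt_eqF// poweRe1.
  by apply: lee_poweR => //; rewrite ?poweR_ge0// ltW.
have -> : c = (c `^ r) `^ r^-1.
  by rewrite -poweRrM mulfV ?gt_eqF// poweRe1.
by apply: lee_poweR => //; rewrite ?invr_ge0 ?(ltW r0)// poweR_ge0.
Qed.

Lemma Lnormy f : (forall w, 0 <= f w) -> Lnorm P +oo f = ess_sup P f.
Proof.
move=> f0; rewrite unlock ifT; last by have := @lte01 R; rewrite -(probability_setT P).
by congr ess_sup; apply/funext => w /=; rewrite gee0_abs.
Qed.

(** An exponent [p > 1] is a real number or [+oo]; most facts on [Lnorm] need a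
separate argument for the essential supremum. *)
Lemma exponent_cases (S : Prop) : (forall r, p = r%:E -> (1 < r)%R -> S) ->
  (p = +oo -> S) -> S.
Proof.
move: p_gt1; case: p => [r||] //.
  by rewrite lte_fin => r1 h _; exact: (h r).
by move=> _ _; apply.
Qed.

Lemma Lnorm_le_ae f g : measurable_fun setT f -> measurable_fun setT g ->
  (forall w, 0 <= f w) -> (forall w, 0 <= g w) ->
  {ae P, forall w, f w <= g w} -> Lnorm P p f <= Lnorm P p g.
Proof.
move=> mf mg f0 g0 fg; apply: exponent_cases => [r -> r1|->].
  have r0 : (0 < r)%R by lra.
  rewrite Lnorm_lee ?Lnorm_ge0// poweR_Lnorm ?gt_eqF//.
  apply: ae_ge0_le_integral => //.
  - by move=> x _; exact: poweR_ge0.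
  - exact: (measurableT_comp (measurable_poweR r)).
  - by move=> x _; exact: poweR_ge0.
  - apply: (measurableT_comp (measurable_poweR r)).
    exact: measurableT_comp.
  - apply: filterS fg => w fg _; rewrite gee0_abs//.
    by apply: lee_poweR => //; exact: ltW.
by rewrite !Lnormy//; exact: le_ess_sup.
Qed.

Lemma Lnorm_lty_ae f : measurable_fun setT f -> (forall w, 0 <= f w) ->
  Lnorm P p f < +oo -> {ae P, forall w, f w < +oo}.
Proof.
move=> mf f0; apply: exponent_cases => [r -> r1|->].
  have r0 : (0 < r)%R by lra.
  move=> /(@poweR_lty _ _ r); rewrite poweR_Lnorm ?gt_eqF// => h.
  have : P.-integrable setT (fun w => `|f w| `^ r).
    apply/integrableP; split.
      by apply: (measurableT_comp (measurable_poweR r)); exact: measurableT_comp.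
    by under eq_integral do rewrite (gee0_abs (poweR_ge0 _ _)).
  move=> /integrable_ae -/(_ measurableT); apply: filterS => w /(_ I).
  rewrite gee0_abs// ge0_fin_numE ?poweR_ge0// => /lty_poweRy; apply.
  by rewrite gt_eqF.
rewrite Lnormy// => h; apply: filterS (ess_sup_ge P f) => w fw.
exact: le_lt_trans fw h.
Qed.

Lemma Lnorm_eq0_ae f : measurable_fun setT f -> (forall w, 0 <= f w) ->
  Lnorm P p f = 0 -> {ae P, forall w, f w = 0}.
Proof.
move=> mf f0 /Lnorm_eq0_eq0 => /(_ mf).
have p0 : 0 < p by apply: lt_trans p_gt1; rewrite lte01.
by move=> /(_ p0); apply: filterS => w /(_ I).
Qed.

(** Minkowski's inequality is available for real-valued functions. It extends to
extended-real ones, since functions of finite norm are finite almost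
everywhere. *)
Lemma LnormD_nonneg f g : measurable_fun setT f -> measurable_fun setT g ->
  (forall w, 0 <= f w) -> (forall w, 0 <= g w) ->
  Lnorm P p (f \+ g) <= Lnorm P p f + Lnorm P p g.
Proof.
move=> mf mg f0 g0.
have Nf := Lnorm_ge0 P p f; have Ng := Lnorm_ge0 P p g.
have [->|Nfoo] := eqVneq (Lnorm P p f) +oo.
  by rewrite addye ?leey// -ltNye (lt_le_trans _ Ng).
have [->|Ngoo] := eqVneq (Lnorm P p g) +oo.
  by rewrite addey ?leey// -ltNye (lt_le_trans _ Nf).
have fy : {ae P, forall w, f w < +oo} by apply: Lnorm_lty_ae => //; rewrite ltey.
have gy : {ae P, forall w, g w < +oo} by apply: Lnorm_lty_ae => //; rewrite ltey.
have mff : measurable_fun setT (fine \o f) by exact: measurableT_comp.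
have mfg : measurable_fun setT (fine \o g) by exact: measurableT_comp.
have finef h : (forall w, 0 <= h w) -> forall w, 0 <= (EFin \o (fine \o h)) w.
  by move=> h0 w; rewrite /= lee_fin fine_ge0.
apply: (@le_trans _ _ (Lnorm P p (EFin \o ((fine \o f) \+ (fine \o g))%R))).
  apply: Lnorm_le_ae => //.
  - exact: emeasurable_funD.
  - by apply/measurable_EFinP; exact: measurable_funD.
  - by move=> w; rewrite adde_ge0.
  - by move=> w /=; rewrite lee_fin addr_ge0 ?fine_ge0.
  - by apply: filterS2 fy gy => w ? ? /=; rewrite EFinD !fineK ?ge0_fin_numE.
apply: (le_trans (eminkowski _ _ _ _)) => //; first exact: ltW.
have aux h : measurable_fun setT h -> (forall w, 0 <= h w) ->
    Lnorm P p (EFin \o (fine \o h)) <= Lnorm P p h.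
  move=> mh h0; apply: Lnorm_le_ae => //; last 2 first.
  - exact: finef.
  - apply/nearW => w /=; case: (h w) (h0 w) => //= _; exact: leey.
  by apply/measurable_EFinP; exact: measurableT_comp.
by apply: leeD; exact: aux.
Qed.

(** Fatou property of the norm. For finite [p] the limit is exchanged with the
power by monotonicity alone: [u n <= L^(1/p)] for all [n] as soon as
[(u n)^p <= L] for all [n]. *)
Lemma Lnorm_limn (u : (Omega -> \bar R)^nat) (c : \bar R) :
  (forall n, measurable_fun setT (u n)) -> (forall n w, 0 <= u n w) ->
  (forall w, nondecreasing_seq (u ^~ w)) ->
  (forall n, Lnorm P p (u n) <= c) -> Lnorm P p (fun w => limn (u ^~ w)) <= c.
Proof.
move=> mu u0 ndu uc.
have c0 : 0 <= c := le_trans (Lnorm_ge0 _ _ _) (uc 0%N).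
have lu w : cvgn (u ^~ w) by exact: ereal_nondecreasing_is_cvgn.
have l0 w : 0 <= limn (u ^~ w) by apply: lime_ge => //; exact: nearW.
have ul n w : u n w <= limn (u ^~ w) by exact: ereal_nondecreasing_limn_ge.
move: uc; apply: exponent_cases => [r -> r1|->] uc.
  have r0 : (0 < r)%R by lra.
  rewrite Lnorm_lee//.
  have monr x y : 0 <= x -> x <= y -> x `^ r <= y `^ r.
    by apply: lee_poweR; exact: ltW.
  have ndr w : nondecreasing_seq (fun n => u n w `^ r).
    by move=> m n mn; apply: monr => //; exact: ndu.
  have lr w : cvgn (fun n => u n w `^ r) by exact: ereal_nondecreasing_is_cvgn.
  have lr0 w : 0 <= limn (fun n => u n w `^ r).
    by apply: lime_ge => //; apply: nearW => n; exact: poweR_ge0.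
  have mr n : measurable_fun setT (fun w => u n w `^ r).
    exact: (measurableT_comp (measurable_poweR r)).
  apply: (@le_trans _ _ (\int[P]_w limn (fun n => u n w `^ r))).
    apply: ge0_le_integral => //.
    - by move=> w _; exact: poweR_ge0.
    - apply: (measurableT_comp (measurable_poweR r)).
      by apply: (emeasurable_fun_cvg u) => // w _; exact: lu.
    - by apply: (emeasurable_fun_cvg (fun n w => u n w `^ r)) => // w _; exact: lr.
    - move=> w _; set L := limn (fun n => u n w `^ r).
      have -> : L = (L `^ r^-1) `^ r.
        by rewrite -poweRrM mulVf ?gt_eqF// poweRe1//; exact: lr0.
      apply: monr => //.
      apply: lime_le => //; apply: nearW => n.
      have -> : u n w = (u n w `^ r) `^ r^-1.
        by rewrite -poweRrM mulfV ?gt_eqF// poweRe1.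
      apply: lee_poweR; rewrite ?invr_ge0 ?(ltW r0)//; first exact: poweR_ge0.
      exact: (@ereal_nondecreasing_limn_ge _ (fun n => u n w `^ r)).
  rewrite monotone_convergence//; last by move=> n w _; exact: poweR_ge0.
  apply: lime_le.
    apply: ereal_nondecreasing_is_cvgn => m n mn; apply: ge0_le_integral => //.
      by move=> w _; exact: poweR_ge0.
    by move=> w _; exact: ndr.
  by apply: nearW => n; rewrite -Lnorm_lee.
rewrite Lnormy//; apply/ess_supP.
have : {ae P, forall w n, u n w <= c}.
  apply/ae_foralln => n; apply/ess_supP; by rewrite -Lnormy.
by apply: filterS => w uwc; apply: lime_le => //; exact: nearW.
Qed.

Lemma Lnorm_sum_le (u : (Omega -> \bar R)^nat) n :
  (forall n, measurable_fun setT (u n)) -> (forall n w, 0 <= u n w) ->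
  Lnorm P p (fun w => \sum_(0 <= j < n) u j w) <=
    \sum_(0 <= j < n) Lnorm P p (u j).
Proof.
move=> mu u0; elim: n => [|n IH].
  rewrite big_nil; under eq_Lnorm do rewrite big_nil.
  by rewrite Lnorm0// gt_eqF// (lt_trans _ p_gt1)// lte01.
rewrite big_nat_recr//=; under eq_Lnorm do rewrite big_nat_recr//=.
apply: (le_trans (LnormD_nonneg _ _ _ _)) => //.
- exact: emeasurable_sum.
- by move=> w; exact: sume_ge0.
- by rewrite leeD2r.
Qed.

(** Countable triangle inequality, the source of completeness. *)
Lemma Lnorm_series (u : (Omega -> \bar R)^nat) :
  (forall n, measurable_fun setT (u n)) -> (forall n w, 0 <= u n w) ->
  Lnorm P p (fun w => \sum_(0 <= j <oo) u j w) <= \sum_(0 <= j <oo) Lnorm P p (u j).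
Proof.
move=> mu u0; apply: Lnorm_limn.
- by move=> n; exact: emeasurable_sum.
- by move=> n w; exact: sume_ge0.
- by move=> w; apply: ereal_nondecreasing_series.
- move=> n; apply: (le_trans (Lnorm_sum_le _ _ _)) => //.
  by apply: nneseries_lim_ge => j _ _; exact: Lnorm_ge0.
Qed.

Lemma Lnorm_integrable f : measurable_fun setT f -> (forall w, 0 <= f w) ->
  Lnorm P p f < +oo -> P.-integrable setT f.
Proof.
move=> mf f0 Nf; apply/integrableP; split => //.
under eq_integral do rewrite gee0_abs//.
move: Nf; apply: exponent_cases => [r -> r1|->].
  have r0 : (0 < r)%R by lra.
  move=> /(@poweR_lty _ _ r); rewrite poweR_Lnorm ?gt_eqF// => h.
  apply: (@le_lt_trans _ _ (\int[P]_w (1 + `|f w| `^ r))).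
    have mr : measurable_fun setT (fun w => `|f w| `^ r).
      by apply: (measurableT_comp (measurable_poweR r)); exact: measurableT_comp.
    apply: ge0_le_integral => //; first exact: emeasurable_funD.
    move=> w _; rewrite gee0_abs//; case: (f w) (f0 w) => [x||]//= x0; last first.
      by rewrite gt_eqF.
    rewrite lee_fin in x0; rewrite -EFinD lee_fin.
    have [x1|/ltW x1] := leP x 1%R; first by rewrite (le_trans x1)// lerDl powR_ge0.
    rewrite (@le_trans _ _ (x `^ r)%R) ?lerDr//.
    by rewrite -[leLHS]powRr1// ler_powR// ltW.
  rewrite ge0_integralD//; last 2 first.
  - by move=> w _; exact: poweR_ge0.
  - by apply: (measurableT_comp (measurable_poweR r)); exact: measurableT_comp.
  by rewrite integral_probability_cst lte_add_pinfty// ltry.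
rewrite Lnormy// => h; apply: (@le_lt_trans _ _ (\int[P]_w (ess_sup P f))).
  apply: ae_ge0_le_integral => //.
    by move=> w _; rewrite -Lnormy ?Lnorm_ge0.
  by apply: filterS (ess_sup_ge P f).
by rewrite integral_probability_cst.
Qed.

End Lnorm_nonneg.

(** * Integrals of limits and almost sure statements *)

Section fatou_bounds.
Local Open Scope ereal_scope.

Lemma limn_einf_le_cst (R : realType) (u : (\bar R)^nat) (c : \bar R) :
  (forall k, u k <= c) -> limn_einf u <= c.
Proof.
move=> uc; rewrite limn_einf_lim; apply: lime_le; first exact: is_cvg_einfs.
apply: nearW => k; apply: le_trans (uc k).
by apply: ereal_inf_lbound; exists k => //=.
Qed.

(** The form of Fatou's lemma used to pass bounds on integrals to a limit. *)
Lemma fatou_le (R : realType) (d : measure_display) (T : measurableType d)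
    (mu : {measure set T -> \bar R}) (f : (T -> \bar R)^nat) (g : T -> \bar R)
    (c : \bar R) :
  (forall k, measurable_fun setT (f k)) -> (forall k x, 0 <= f k x) ->
  (forall x, f k x @[k --> \oo] --> g x) ->
  (forall k, \int[mu]_x f k x <= c) -> \int[mu]_x g x <= c.
Proof.
move=> mf f0 fg fc.
have -> : g = fun x => limn_einf (f ^~ x).
  by apply/funext => x; rewrite (cvg_limn_einf_sup (fg x)).1.
by apply: (le_trans (fatou _ _ _ _)) => //; exact: limn_einf_le_cst.
Qed.

End fatou_bounds.

Section limn_einf_extra.
Context (R : realType) (d : measure_display) (T : measurableType d).

Lemma measurable_limn_einf (u : (T -> \bar R)^nat) :
  (forall k, measurable_fun setT (u k)) ->
  measurable_fun setT (fun x => limn_einf (u ^~ x)).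
Proof.
move=> mu; under eq_fun do rewrite limn_einf_lim.
apply: (emeasurable_fun_cvg (fun m x => einfs (u ^~ x) m)).
  by move=> m; exact: measurable_fun_einfs.
by move=> x _; exact: is_cvg_einfs.
Qed.

Lemma eq_ae_integrable (mu : {measure set T -> \bar R}) (f g : T -> \bar R) :
  measurable_fun setT g -> {ae mu, forall x, g x = f x} ->
  mu.-integrable setT f -> mu.-integrable setT g.
Proof.
move=> mg gf /integrableP[mf foo]; apply/integrableP; split => //.
rewrite (_ : integral _ _ _ = \int[mu]_x `|f x|)%E//.
apply: ge0_ae_eq_integral => //; try exact: measurableT_comp.
by apply: filterS gf => x gfx _ /=; rewrite gfx.
Qed.

Lemma limn_einf_ge0 (u : (\bar R)^nat) : (forall k, (0 <= u k)%E) ->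
  (0 <= limn_einf u)%E.
Proof.
move=> u0; rewrite limn_einf_lim; apply: lime_ge; first exact: is_cvg_einfs.
by apply: nearW => k; apply: le_ereal_inf_tmp => _ [m _ <-].
Qed.

Lemma ae_forall_countable (I : countType) (mu : {measure set T -> \bar R})
    (Q : I -> T -> Prop) :
  (forall i, {ae mu, forall x, Q i x}) -> {ae mu, forall x i, Q i x}.
Proof.
move=> h; have : {ae mu, forall x k, if unpickle k is Some i then Q i x else True}.
  apply/ae_foralln => k; case: (unpickle k) => [i|]; first exact: h.
  exact: nearW.
by apply: filterS => x hx i; have := hx (pickle i); rewrite pickleK.
Qed.

End limn_einf_extra.

Lemma leey_le_nat (R : realType) (y : \bar R) :
  (forall K : nat, (K%:R%:E <= y)%E) -> (+oo <= y)%E.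
Proof.
case: y => [r||]//; last by move=> /(_ 0%N).
move=> /(_ (Num.truncn `|r|).+1); rewrite lee_fin leNgt => /negP h; exfalso; apply: h.
have /andP[_ h] := truncn_itv (normr_ge0 r).
exact: le_lt_trans (ler_norm r) h.
Qed.

(** A finite lower limit of integers means that some bound is respected
infinitely often. *)
Lemma limn_einf_lty_bounded (R : realType) (u : nat -> nat) :
  (limn_einf (fun m => (u m)%:R%:E : \bar R) < +oo)%E ->
  exists K, forall m0, exists2 m, (m0 <= m)%N & (u m <= K)%N.
Proof.
move=> uoo; apply: contrapT => /forallNP h.
move: uoo; rewrite ltNge => /negP; apply; apply/leey_le_nat => K.
have := h K => /existsNP[m0 hm0].
rewrite limn_einf_lim.
apply: le_trans (ereal_nondecreasing_limn_ge m0 (nondecreasing_einfs _)).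
apply: le_ereal_inf_tmp => _ [m /= m0m <-]; rewrite lee_fin ler_nat leqNgt.
by apply/negP => um; apply: hm0; exists m => //; exact: ltnW.
Qed.

(** * Sub-sigma-algebras and conditional expectations *)

Section sub_sigma_algebra.
Context (R : realType) (d : measure_display) (Omega : measurableType d).
Implicit Types (G : set (set Omega)) (X Y : Omega -> R).

(** Measurability with respect to a sigma-algebra [G] is measurability on the
measurable type generated by [G], so the closure properties of measurable
functions carry over. *)
Lemma measurable_wrtP G X : sigma_algebra setT G ->
  measurable_wrt G X <->
  measurable_fun [set: g_sigma_algebraType G] (X : g_sigma_algebraType G -> R).
Proof.
move=> sG; split=> [GX _ B mB|mX B mB].
  by rewrite setTI measurable_g_measurableTypeE//; exact: GX.
rewrite -(measurable_g_measurableTypeE sG) -[_ @^-1` _]setTI.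
exact: mX.
Qed.

Lemma measurable_wrtS G H X : G `<=` H -> measurable_wrt G X ->
  measurable_wrt H X.
Proof. by move=> GH GX B mB; apply: GH; exact: GX. Qed.

Lemma measurable_wrt_fun G X : G `<=` measurable -> measurable_wrt G X ->
  measurable_fun setT X.
Proof. by move=> Gm GX _ B mB; rewrite setTI; apply: Gm; exact: GX. Qed.

Lemma measurable_wrt_comp G X (f : R -> R) : measurable_fun setT f ->
  measurable_wrt G X -> measurable_wrt G (f \o X).
Proof.
move=> mf GX B mB; rewrite comp_preimage; apply: GX.
by rewrite -[_ @^-1` _]setTI; exact: mf.
Qed.

Section closure.
Variable G : set (set Omega).
Hypothesis sG : sigma_algebra setT G.

Lemma measurable_wrt_cst (c : R) : measurable_wrt G (fun=> c).
Proof. by apply/measurable_wrtP => //; exact: measurable_cst. Qed.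

Lemma measurable_wrtD X Y : measurable_wrt G X -> measurable_wrt G Y ->
  measurable_wrt G (fun w => X w + Y w).
Proof.
move=> /(measurable_wrtP _ sG) mX /(measurable_wrtP _ sG) mY.
by apply/measurable_wrtP => //; exact: measurable_funD.
Qed.

Lemma measurable_wrtB X Y : measurable_wrt G X -> measurable_wrt G Y ->
  measurable_wrt G (fun w => X w - Y w).
Proof.
move=> /(measurable_wrtP _ sG) mX /(measurable_wrtP _ sG) mY.
by apply/measurable_wrtP => //; exact: measurable_funB.
Qed.

Lemma measurable_wrtM X Y : measurable_wrt G X -> measurable_wrt G Y ->
  measurable_wrt G (fun w => X w * Y w).
Proof.
move=> /(measurable_wrtP _ sG) mX /(measurable_wrtP _ sG) mY.
by apply/measurable_wrtP => //; exact: measurable_funM.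
Qed.

Lemma measurable_wrt_max X Y : measurable_wrt G X -> measurable_wrt G Y ->
  measurable_wrt G (fun w => Num.max (X w) (Y w)).
Proof.
move=> /(measurable_wrtP _ sG) mX /(measurable_wrtP _ sG) mY.
by apply/measurable_wrtP => //; exact: measurable_maxr.
Qed.

Lemma measurable_wrt_indic (A : set Omega) : G A -> measurable_wrt G (\1_A : Omega -> R).
Proof.
move=> GA; apply/measurable_wrtP => //.
by apply: measurable_indic; rewrite measurable_g_measurableTypeE.
Qed.

Lemma measurable_wrt_cvg (h : (Omega -> R)^nat) X :
  (forall m, measurable_wrt G (h m)) -> (forall w, h m w @[m --> \oo] --> X w) ->
  measurable_wrt G X.
Proof.
move=> Gh hX; apply/measurable_wrtP => //.
apply: (@measurable_realfun.measurable_fun_cvg _ (g_sigma_algebraType G) _ setT h).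
  by move=> m; apply/measurable_wrtP.
by move=> w _; exact: hX.
Qed.

End closure.
End sub_sigma_algebra.

Section conditional_expectation.
Context (R : realType) (d : measure_display) (Omega : measurableType d).
Context (P : probability Omega R).
Variable G : set (set Omega).
Hypothesis sG : sigma_algebra setT G.
Hypothesis Gm : G `<=` measurable.
Local Open Scope ereal_scope.

Local Notation S := (g_sigma_algebraType G).

(** The identity of [Omega], seen as a measurable map onto the coarser space; the
law of this map is the restriction of [P] to [G]. *)
Definition to_sub : Omega -> S := fun w => w.

Lemma measurable_to_sub : measurable_fun setT to_sub.
Proof.
move=> _ B; rewrite measurable_g_measurableTypeE// => GB.
by rewrite setTI; exact: Gm.
Qed.

HB.instance Definition _ := isMeasurableFun.Build _ _ _ _ to_sub measurable_to_sub.

Section existence.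
Definition sub_charge (X : Omega -> \bar R) (_ : P.-integrable setT X)
  (A : set S) : \bar R := \int[P]_(w in A) X w.

Variable X : Omega -> \bar R.
Hypothesis iX : P.-integrable setT X.

Let measurableS A : (measurable : set (set S)) A -> d.-measurable A.
Proof. by rewrite measurable_g_measurableTypeE//; exact: Gm. Qed.

Let sub_charge0 : (sub_charge iX) set0 = 0.
Proof. exact: integral_set0. Qed.

Let sub_charge_fin A : measurable A -> (sub_charge iX) A \is a fin_num.
Proof.
by move=> /measurableS mA; apply: (@fin_num_measure _ _ _ (induced_charge iX)).
Qed.

Let sub_charge_sigma : semi_sigma_additive (sub_charge iX).
Proof.
move=> F mF tF mUF.
apply: (@charge_semi_sigma_additive _ _ _ (induced_charge iX)) => //.
  by move=> i; exact: measurableS.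
exact: measurableS.
Qed.

HB.instance Definition _ := isCharge.Build _ S R (sub_charge iX)
  sub_charge0 sub_charge_fin sub_charge_sigma.

Lemma sub_charge_dominates : sub_charge iX `<< distribution P to_sub.
Proof.
apply/null_content_dominatesP => A mA PA0.
apply: null_set_integral => //; first exact: measurableS.
exact: measurable_funTS (measurable_int _ iX).
Qed.

End existence.

(** The Radon-Nikodym derivative, with respect to the restriction of [P] to [G],
of the charge [A |-> E(X; A)] on [G]. *)
Lemma cond_exp_exists (X : Omega -> R) : P.-integrable setT (EFin \o X) ->
  exists Z, is_cond_exp P G X Z.
Proof.
move=> iX.
pose nu : {charge set S -> \bar R} := sub_charge iX.
pose mu := distribution P to_sub.
pose f := Radon_Nikodym nu mu.
have numu : nu `<< mu by exact: sub_charge_dominates.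
have fin w : f w \is a fin_num by exact: Radon_Nikodym_fin_num.
have intf : mu.-integrable setT f by exact: Radon_Nikodym_integrable.
have mf : measurable_fun setT f by exact: measurable_int intf.
have ff : EFin \o (fun w => fine (f w)) = (f : Omega -> \bar R).
  by apply/funext => w /=; rewrite fineK.
have iff : P.-integrable setT (f : Omega -> \bar R).
  move/integrableP : intf => [_ intf].
  apply/integrableP; split.
    exact: (measurableT_comp mf measurable_to_sub).
  move: intf; rewrite ge0_integral_pushforward//.
  exact: measurableT_comp.
exists (fun w => fine (f w)); split.
- apply/measurable_wrtP => //.
  exact: measurableT_comp.
- by rewrite ff.
- move=> A GA.
  have mA : (measurable : set (set S)) A by rewrite measurable_g_measurableTypeE.
  transitivity (\int[mu]_(x in A) f x).
    under eq_integral do rewrite fineK//.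
    rewrite integral_pushforward//.
    by apply: integrableS iff => //; exact: Gm.
  by rewrite -Radon_Nikodym_integral.
Qed.

End conditional_expectation.

Section pullout.
Context (R : realType) (d : measure_display) (Omega : measurableType d).
Context (P : probability Omega R).
Local Open Scope ereal_scope.

Lemma integral_indic_mul (A : set Omega) (X : Omega -> R) :
  \int[P]_w (\1_A w * X w)%:E = \int[P]_(w in A) (X w)%:E.
Proof.
rewrite [RHS]integral_mkcond; apply: eq_integral => w _.
by rewrite patchE indicE; case: (w \in A); rewrite ?mul1r ?mul0r.
Qed.

Lemma integrable_indic_mul (A : set Omega) (X : Omega -> R) :
  measurable A -> P.-integrable setT (EFin \o X) ->
  P.-integrable setT (EFin \o (fun w => \1_A w * X w)%R).
Proof.
move=> mA iX; apply: (le_integrable measurableT _ _ iX).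
  apply/measurable_EFinP/measurable_funM; first exact: measurable_indic.
  by apply/measurable_EFinP; exact: measurable_int iX.
move=> w _ /=; rewrite lee_fin normrM indicE.
by case: (w \in A); rewrite ?normr1 ?normr0 ?mul1r ?mul0r.
Qed.

Lemma le_integrable_real (f g : Omega -> R) : measurable_fun setT f ->
  P.-integrable setT (EFin \o g) -> (forall w, `|f w| <= `|g w|)%R ->
  P.-integrable setT (EFin \o f).
Proof.
move=> mf ig fg; apply: (le_integrable measurableT _ _ ig).
  exact/measurable_EFinP.
by move=> w _ /=; rewrite lee_fin.
Qed.

Variable G : set (set Omega).
Hypothesis sG : sigma_algebra setT G.
Hypothesis Gm : G `<=` measurable.
Variables X m : Omega -> R.
Hypothesis iX : P.-integrable setT (EFin \o X).
Hypothesis Xm : is_cond_exp P G X m.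

Let im : P.-integrable setT (EFin \o m). Proof. by case: Xm. Qed.
Let mX : measurable_fun setT X.
Proof. by apply/measurable_EFinP; exact: measurable_int iX. Qed.
Let mm : measurable_fun setT m.
Proof. by apply/measurable_EFinP; exact: measurable_int im. Qed.

Import HBNNSimple.

Let pull_simple (f : {nnsfun (g_sigma_algebraType G) >-> R}) :
  \int[P]_w ((f : Omega -> R) w * X w)%:E = \int[P]_w ((f : Omega -> R) w * m w)%:E.
Proof.
pose s := finmap.enum_fset (fset_set (range f)).
have fE w : (f : Omega -> R) w = (\sum_(y <- s) y * \1_(f @^-1` [set y]) w)%R.
  by rewrite fimfunE fsbig_finite.
have Gf y : G (f @^-1` [set y]).
  have : (measurable : set (set (g_sigma_algebraType G))) (f @^-1` [set y]).
    exact: measurable_sfunP.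
  by rewrite measurable_g_measurableTypeE.
have aux (h : Omega -> R) : P.-integrable setT (EFin \o h) ->
    \int[P]_w ((f : Omega -> R) w * h w)%:E =
    \sum_(y <- s) (y%:E * \int[P]_(w in f @^-1` [set y]) (h w)%:E).
  move=> ih.
  have ihy y : P.-integrable setT (EFin \o (fun w => \1_(f @^-1` [set y]) w * h w)%R).
    by apply: integrable_indic_mul => //; apply: Gm; exact: Gf.
  transitivity (\int[P]_w \sum_(y <- s) (y%:E * (\1_(f @^-1` [set y]) w * h w)%:E)).
    apply: eq_integral => w _; rewrite fE mulr_suml -sumEFin.
    by apply: eq_bigr => y _; rewrite -EFinM mulrA.
  rewrite integral_sum//; last first.
    by move=> y; exact: (integrableZl measurableT y (ihy y)).
  apply: eq_bigr => y _; rewrite integralZl//; last exact: ihy.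
  by rewrite integral_indic_mul.
rewrite !aux//; apply: eq_bigr => y _; congr (_ * _).
by case: Xm => _ _ /(_ _ (Gf y)).
Qed.

Let pull_ge0 (Z : Omega -> R) : measurable_wrt G Z -> (forall w, 0 <= Z w)%R ->
  P.-integrable setT (EFin \o (fun w => Z w * X w)%R) ->
  P.-integrable setT (EFin \o (fun w => Z w * m w)%R) ->
  \int[P]_w (Z w * X w)%:E = \int[P]_w (Z w * m w)%:E.
Proof.
move=> GZ Z0 iZX iZm.
have mZ : measurable_fun [set: g_sigma_algebraType G] (EFin \o Z).
  by apply/measurable_EFinP; apply/measurable_wrtP.
pose f k : Omega -> R := nnsfun_approx measurableT mZ k.
have fZ w : (f k w)%:E @[k --> \oo] --> (Z w)%:E.
  by apply: cvg_nnsfun_approx => // x _; rewrite /= lee_fin.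
have f0 k w : (0 <= f k w)%R by exact: fun_ge0.
have fle k w : (f k w <= Z w)%R.
  have ndf : nondecreasing_seq (fun k => (f k w)%:E).
    move=> a b ab; rewrite lee_fin.
    by have /lefP := nd_nnsfun_approx measurableT mZ ab; exact.
  rewrite -lee_fin -(cvg_lim _ (fZ w))//.
  exact: (@ereal_nondecreasing_limn_ge _ (fun k => (f k w)%:E)).
have mf k : measurable_fun setT (f k).
  apply: (@measurable_wrt_fun _ _ _ G) => //; apply/measurable_wrtP => //.
have cvgI (h : Omega -> R) : measurable_fun setT h ->
    P.-integrable setT (EFin \o (fun w => Z w * h w)%R) ->
    \int[P]_w (f k w * h w)%:E @[k --> \oo] --> \int[P]_w (Z w * h w)%:E.
  move=> mh iZh.
  have [] := @dominated_convergence _ _ _ P setT measurableT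
    (fun k w => (f k w * h w)%:E) (fun w => (Z w * h w)%:E)
    (abse \o (EFin \o (fun w => Z w * h w)%R)).
  - by move=> k; apply/measurable_EFinP; exact: measurable_funM.
  - by apply/measurable_EFinP; apply: measurable_funM => //; exact: measurable_wrt_fun GZ.
  - apply: nearW => w _; rewrite EFinM.
    under eq_fun do rewrite EFinM.
    by apply: cvgeM => //; exact: cvg_cst.
  - exact: integrable_abse.
  - apply: nearW => w k _ /=; rewrite lee_fin !normrM ler_wpM2r//.
    by rewrite !ger0_norm.
  by [].
have := cvgI _ mX iZX.
under eq_fun do rewrite pull_simple.
move=> /cvg_unique; apply=> //; exact: cvgI.
Qed.

(** For [Z] simple this is the defining property of conditional expectations,
level set by level set. Nonnegative [Z] follow by dominated convergence, with
[|Z X|] and [|Z m|] as dominating functions, and signed [Z] by splitting. *)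
Lemma cond_exp_pullout (Z : Omega -> R) : measurable_wrt G Z ->
  P.-integrable setT (EFin \o (fun w => Z w * X w)%R) ->
  P.-integrable setT (EFin \o (fun w => Z w * m w)%R) ->
  \int[P]_w (Z w * X w)%:E = \int[P]_w (Z w * m w)%:E.
Proof.
move=> GZ iZX iZm.
pose Zp w := Num.max (Z w) 0%R; pose Zn w := Num.max (- Z w)%R 0%R.
have GZp : measurable_wrt G Zp.
  by apply: measurable_wrt_max => //; exact: measurable_wrt_cst.
have GZn : measurable_wrt G Zn.
  apply: measurable_wrt_max => //; last exact: measurable_wrt_cst.
  exact: (measurable_wrt_comp _ GZ).
have ZE w : Z w = (Zp w - Zn w)%R.
  by rewrite /Zp /Zn; case: (leP (Z w) 0%R); case: (leP (- Z w)%R 0%R); lra.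
have Zp1 w : (0 <= Zp w <= `|Z w|)%R.
  by rewrite /Zp le_max lexx orbT ge_max ler_norm normr_ge0.
have Zn1 w : (0 <= Zn w <= `|Z w|)%R.
  by rewrite /Zn le_max lexx orbT ge_max -normrN ler_norm normr_ge0.
have aux (h : Omega -> R) (Y : Omega -> R) : measurable_fun setT h ->
    measurable_wrt G Y -> (forall w, 0 <= Y w <= `|Z w|)%R ->
    P.-integrable setT (EFin \o (fun w => Z w * h w)%R) ->
    P.-integrable setT (EFin \o (fun w => Y w * h w)%R).
  move=> mh GY YZ iZh; apply: (le_integrable_real _ iZh).
    by apply: measurable_funM => //; exact: measurable_wrt_fun GY.
  move=> w; have /andP[Y0 YZw] := YZ w.
  by rewrite !normrM ler_wpM2r// ger0_norm.
have split (h : Omega -> R) : measurable_fun setT h ->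
    P.-integrable setT (EFin \o (fun w => Z w * h w)%R) ->
    \int[P]_w (Z w * h w)%:E = \int[P]_w (Zp w * h w)%:E - \int[P]_w (Zn w * h w)%:E.
  move=> mh iZh; rewrite -integralB//; [|exact: aux iZh..].
  by apply: eq_integral => w _; rewrite -EFinB -mulrBl -ZE.
rewrite !split//; congr (_ - _).
- apply: pull_ge0 => //; [|exact: aux iZX|exact: aux iZm].
  by move=> w; have /andP[] := Zp1 w.
- apply: pull_ge0 => //; [|exact: aux iZX|exact: aux iZm].
  by move=> w; have /andP[] := Zn1 w.
Qed.

End pullout.

(** * Euclidean norm and convergence of vectors *)

Section euclidean_norm.
Context (R : realType) (n : nat).
Implicit Types u v : 'rV[R]_n.

Lemma enorm_ge0 v : 0 <= enorm v. Proof. exact: sqrtr_ge0. Qed.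

Lemma enorm_sqr v : enorm v ^+ 2 = \sum_(i < n) v ord0 i ^+ 2.
Proof. by rewrite sqr_sqrtr// sumr_ge0// => i _; exact: sqr_ge0. Qed.

Lemma enorm_coord v i : `|v ord0 i| <= enorm v.
Proof.
rewrite -(@ler_pXn2r _ 2) ?nnegrE ?enorm_ge0// enorm_sqr real_normK ?num_real//.
by rewrite (bigD1 i)//= lerDl sumr_ge0// => j _; exact: sqr_ge0.
Qed.

Lemma enorm_eq0 v : enorm v = 0 -> v = 0.
Proof.
move=> v0; apply/rowP => i; rewrite mxE; apply/normr0_eq0/le_anti.
by rewrite normr_ge0 -{1}v0 enorm_coord.
Qed.

Lemma enorm0 : enorm (0 : 'rV[R]_n) = 0.
Proof.
by rewrite /enorm big1 ?sqrtr0// => i _; rewrite mxE expr0n.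
Qed.

Lemma enormN v : enorm (- v) = enorm v.
Proof. by congr Num.sqrt; apply: eq_bigr => i _; rewrite mxE sqrrN. Qed.

Lemma enorm_dot u v : \sum_(i < n) u ord0 i * v ord0 i <= enorm u * enorm v.
Proof.
have [->|u0] := eqVneq u 0.
  by rewrite big1 ?mulr_ge0 ?enorm_ge0// => i _; rewrite mxE mul0r.
have [->|v0] := eqVneq v 0.
  by rewrite big1 ?mulr_ge0 ?enorm_ge0// => i _; rewrite mxE mulr0.
have pos (w : 'rV[R]_n) : w != 0 -> 0 < enorm w.
  move=> w0; rewrite lt_neqAle enorm_ge0 andbT eq_sym.
  by apply: contra_neq w0 => /enorm_eq0.
have eu := pos _ u0; have ev := pos _ v0.
set a := enorm u in eu *; set b := enorm v in ev *.
(* 2 x y <= x^2 + y^2 for the coordinates of the normalized vectors *)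
have : \sum_(i < n) (a^-1 * u ord0 i) * (b^-1 * v ord0 i) <= 1.
  apply: (@le_trans _ _ (\sum_(i < n) (a^-2 * u ord0 i ^+ 2 + b^-2 * v ord0 i ^+ 2) / 2)).
    apply: ler_sum => i _; rewrite ler_pdivlMr//.
    have := sqr_ge0 (a^-1 * u ord0 i - b^-1 * v ord0 i).
    rewrite sqrrB !exprMn !exprVn; nra.
  rewrite -mulr_suml big_split/= -!mulr_sumr -!enorm_sqr -/a -/b.
  by rewrite !mulVf ?expf_neq0 ?gt_eqF//; lra.
rewrite (eq_bigr (fun i => (a^-1 * b^-1) * (u ord0 i * v ord0 i))); last first.
  by move=> i _; ring.
by rewrite -mulr_sumr -invfM mulrC ler_pdivrMr ?mul1r// mulr_gt0.
Qed.

Lemma enormD u v : enorm (u + v) <= enorm u + enorm v.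
Proof.
rewrite -(@ler_pXn2r _ 2) ?nnegrE ?addr_ge0 ?enorm_ge0//.
have -> : enorm (u + v) ^+ 2 =
    enorm u ^+ 2 + 2 * (\sum_(i < n) u ord0 i * v ord0 i) + enorm v ^+ 2.
  rewrite !enorm_sqr mulr_sumr -!big_split/=; apply: eq_bigr => i _.
  by rewrite mxE; ring.
have := enorm_dot u v; nra.
Qed.

Lemma enormB u v : enorm (u - v) <= enorm u + enorm v.
Proof. by rewrite (le_trans (enormD _ _))// enormN. Qed.

Lemma enorm_distC u v : enorm (u - v) = enorm (v - u).
Proof. by rewrite -enormN opprB. Qed.

Lemma enorm_le_sum v : enorm v <= \sum_(i < n) `|v ord0 i|.
Proof.
have s0 : 0 <= \sum_(i < n) `|v ord0 i| by exact: sumr_ge0.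
rewrite -(@ler_pXn2r _ 2) ?nnegrE ?enorm_ge0// enorm_sqr.
rewrite (eq_bigr (fun i => `|v ord0 i| ^+ 2)); last first.
  by move=> i _; rewrite real_normK ?num_real.
suff: \sum_(i < n) `|v ord0 i| ^+ 2 <= (\sum_(i < n) `|v ord0 i|) ^+ 2 /\
    0 <= \sum_(i < n) `|v ord0 i| by case.
elim/big_ind2: _ => [|x1 x2 y1 y2 [? ?] [? ?]|i _]; first by rewrite expr0n.
  by split; [nra|exact: addr_ge0].
by split.
Qed.

Lemma continuous_enorm : continuous (@enorm R n).
Proof.
move=> v; apply: (@continuous_comp _ _ _
  (fun v : 'rV[R]_n => \sum_(i < n) v ord0 i ^+ 2)); last exact: sqrt_continuous.
apply: cvg_big; [exact: add_continuous|exact: nbhs_filter|move=> i _].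
apply: (@continuous_comp _ _ _ (fun v : 'rV[R]_n => v ord0 i) (fun x => x ^+ 2)).
  exact: coord_continuous.
exact: exprn_continuous.
Qed.

Lemma measurable_enorm (d : measure_display) (T : measurableType d)
    (X : T -> 'rV[R]_n) : (forall i, measurable_fun setT (fun w => X w ord0 i)) ->
  measurable_fun setT (fun w => enorm (X w)).
Proof.
move=> mX; apply: (@measurableT_comp _ _ _ _ _ _ (@Num.sqrt R)).
  by apply: continuous_measurable_fun; exact: sqrt_continuous.
apply: measurable_sum => i; exact: measurable_funX.
Qed.

End euclidean_norm.

Section rV_convergence.
Context (R : realType) (n : nat).

Lemma cvg_rV (S : Type) (F : set_system S) (FF : Filter F) (f : S -> 'rV[R]_n)
    (l : 'rV[R]_n) :
  (forall i, f x ord0 i @[x --> F] --> l ord0 i) -> f x @[x --> F] --> l.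
Proof.
move=> h; apply/cvg_ballP => e e0.
near=> x; split => // i j; rewrite ord1.
move: j; near: x; apply: filter_forall => j.
by have /cvg_ballP /(_ _ e0) := h j.
Unshelve. all: by end_near. Qed.

Lemma cvg_rV_coord (S : Type) (F : set_system S) (f : S -> 'rV[R]_n)
    (l : 'rV[R]_n) i :
  f x @[x --> F] --> l -> f x ord0 i @[x --> F] --> l ord0 i.
Proof.
move=> h; exact: (cvg_comp _ _ h (@coord_continuous _ _ _ ord0 i l)).
Qed.

Lemma is_cvg_rV (S : Type) (F : set_system S) (FF : Filter F) (f : S -> 'rV[R]_n) :
  (forall i, cvg (f x ord0 i @[x --> F])) -> cvg (f x @[x --> F]).
Proof.
move=> h; apply/cvg_ex; exists (\row_i lim (f x ord0 i @[x --> F])).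
by apply: cvg_rV => i; rewrite mxE; exact: h.
Qed.

End rV_convergence.

Section uniform_limits.
Context (R : realType).

(** A function that is uniformly approximated by functions having a limit has a
limit. This is what makes left limits stable under uniform convergence. *)
Lemma cvg_approx (F : set_system R) (f : R -> R) : ProperFilter F ->
  (forall e, 0 < e -> exists2 g, cvg (g s @[s --> F]) &
     \forall s \near F, `|g s - f s| <= e) ->
  cvg (f s @[s --> F]).
Proof.
move=> PF H; apply: cauchy_cvg; apply: cauchy_exP => e e0.
have e2 : 0 < e / 2 / 2 by rewrite !divr_gt0.
have [g /cvg_ex[l gl] gf] := H _ e2; exists l.
have /cvgrPdist_le /(_ _ e2) gl' := gl.
rewrite /= /nbhs/=.
near=> s.
have h1 : `|l - g s| <= e / 2 / 2 by near: s.
have h2 : `|g s - f s| <= e / 2 / 2 by near: s.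
rewrite /ball/= (_ : l - f s = (l - g s) + (g s - f s)); last by ring.
rewrite (le_lt_trans (ler_normD _ _))//; lra.
Unshelve. all: by end_near. Qed.

End uniform_limits.

(** * Conditional Jensen inequality *)

(** Young's inequality with exponents [r] and [r / (r - 1)], in the form that both
Jensen's and Doob's inequalities use. *)
Lemma young_powR (R : realType) (x y r : R) : 0 <= x -> 0 <= y -> 1 < r ->
  x * y `^ (r - 1) <= x `^ r / r + (r - 1) / r * y `^ r.
Proof.
move=> x0 y0 r1; have r0 : 0 < r by lra.
have r10 : 0 < r - 1 by lra.
have := @conjugate_powR _ x (y `^ (r - 1)) r (r / (r - 1)) x0 (powR_ge0 _ _) r0.
have -> : (y `^ (r - 1)) `^ (r / (r - 1)) = y `^ r.
  by rewrite -powRrM mulrCA divff ?mulr1// gt_eqF.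
rewrite divr_gt0// => /(_ isT); rewrite invf_div [X in _ -> _ <= _ + X]mulrC.
apply; field; exact: lt0r_neq0.
Qed.

Section jensen.
Context (R : realType) (d : measure_display) (Omega : measurableType d).
Context (P : probability Omega R) (n : nat).
Variable G : set (set Omega).
Hypothesis sG : sigma_algebra setT G.
Hypothesis Gm : G `<=` measurable.
Variables X m : Omega -> 'rV[R]_n.
Hypothesis iX : forall i, P.-integrable setT (fun w => (X w ord0 i)%:E).
Hypothesis Xm : forall i, is_cond_exp P G (fun w => X w ord0 i) (fun w => m w ord0 i).
Local Open Scope ereal_scope.

Let im i : P.-integrable setT (fun w => (m w ord0 i)%:E).
Proof. by case: (Xm i). Qed.
Let Gmi i : measurable_wrt G (fun w => m w ord0 i).
Proof. by case: (Xm i). Qed.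
Let mX i : measurable_fun setT (fun w => X w ord0 i).
Proof. by apply/measurable_EFinP; exact: measurable_int (iX i). Qed.
Let mm i : measurable_fun setT (fun w => m w ord0 i).
Proof. by apply/measurable_EFinP; exact: measurable_int (im i). Qed.

Lemma measurable_wrt_enorm (H : set (set Omega)) (Y : Omega -> 'rV[R]_n) :
  sigma_algebra setT H -> vmeasurable_wrt H Y ->
  measurable_wrt H (fun w => enorm (Y w)).
Proof.
move=> sH HY; apply/measurable_wrtP => //.
apply: measurable_enorm => i; apply/measurable_wrtP => //; exact: HY.
Qed.

Lemma integrable_enorm (Y : Omega -> 'rV[R]_n) :
  (forall i, P.-integrable setT (fun w => (Y w ord0 i)%:E)) ->
  P.-integrable setT (fun w => (enorm (Y w))%:E).
Proof.
move=> iY.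
have iS : P.-integrable setT (fun w => \sum_(i < n) `|(Y w ord0 i)%:E|).
  apply: integrable_sum => //= i _; exact: (integrable_abse (iY i)).
apply: (le_integrable measurableT _ _ iS).
  apply/measurable_EFinP/measurable_enorm => i.
  by apply/measurable_EFinP; exact: measurable_int (iY i).
move=> w _ /=; rewrite sumEFin/= lee_fin ger0_norm ?enorm_ge0//.
by rewrite ger0_norm ?sumr_ge0//; exact: enorm_le_sum.
Qed.

(** Vector-valued conditional Jensen inequality. With [u = m / |m|], which is
bounded and [G]-measurable, [E(Z |m|) = E(Z u.m) = E(Z u.X) <= E(Z |X|)]: pull
out [Z u] coordinate by coordinate and use Cauchy-Schwarz. *)
Lemma enorm_submartingale (Z : Omega -> R) : measurable_wrt G Z ->
  (forall w, 0 <= Z w)%R ->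
  P.-integrable setT (EFin \o (fun w => Z w * enorm (X w))%R) ->
  P.-integrable setT (EFin \o (fun w => Z w * enorm (m w))%R) ->
  \int[P]_w (Z w * enorm (m w))%:E <= \int[P]_w (Z w * enorm (X w))%:E.
Proof.
move=> GZ Z0 iZX iZm.
pose u w i := (m w ord0 i / enorm (m w))%R.
have u1 w i : (`|u w i| <= 1)%R.
  rewrite /u normrM normfV (ger0_norm (enorm_ge0 _)).
  have [->|m0] := eqVneq (enorm (m w)) 0%R; first by rewrite invr0 mulr0.
  rewrite ler_pdivrMr ?mul1r ?enorm_coord//.
  by rewrite lt_neqAle eq_sym m0 enorm_ge0.
have um w : (\sum_(i < n) u w i * m w ord0 i = enorm (m w))%R.
  have [m0|m0] := eqVneq (enorm (m w)) 0%R.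
    by rewrite big1 ?m0// => i _; rewrite /u m0 invr0 mulr0 mul0r.
  transitivity ((enorm (m w))^-1 * \sum_(i < n) m w ord0 i ^+ 2)%R.
    by rewrite mulr_sumr; apply: eq_bigr => i _; rewrite /u; ring.
  by rewrite -enorm_sqr expr2 mulrA mulVf// mul1r.
have uX w : (\sum_(i < n) u w i * X w ord0 i <= enorm (X w))%R.
  have [m0|m0] := eqVneq (enorm (m w)) 0%R.
    by rewrite big1 ?enorm_ge0// => i _; rewrite /u m0 invr0 mulr0 mul0r.
  have m1 : (0 < enorm (m w))%R by rewrite lt_neqAle eq_sym m0 enorm_ge0.
  rewrite (eq_bigr (fun i => (enorm (m w))^-1 * (m w ord0 i * X w ord0 i))%R); last first.
    by move=> i _; rewrite /u; ring.
  by rewrite -mulr_sumr ler_pdivrMl// enorm_dot.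
have Ginv : measurable_wrt G (fun w => (enorm (m w))^-1%R).
  rewrite (_ : (fun w => _) = (@powR R ^~ (-1)%R) \o (fun w => enorm (m w))).
    by apply: measurable_wrt_comp => //; exact: measurable_wrt_enorm.
  by apply/funext => w /=; rewrite powR_inv1// enorm_ge0.
have GZu i : measurable_wrt G (fun w => Z w * u w i)%R.
  apply: (measurable_wrtM sG GZ).
  exact: (measurable_wrtM sG (Gmi i) Ginv).
have iu (Y : Omega -> 'rV[R]_n) i : (forall i, measurable_fun setT (fun w => Y w ord0 i)) ->
    P.-integrable setT (EFin \o (fun w => Z w * enorm (Y w))%R) ->
    P.-integrable setT (EFin \o (fun w => (Z w * u w i) * Y w ord0 i)%R).
  move=> mY iZY; apply: (le_integrable_real _ iZY).
    apply: measurable_funM => //; exact: measurable_wrt_fun (GZu i).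
  move=> w; rewrite -mulrA normrM [leRHS]normrM ler_wpM2l//.
  rewrite [leRHS]ger0_norm ?enorm_ge0// normrM.
  by apply: le_trans (enorm_coord (Y w) i); rewrite ler_piMl//; exact: u1.
have E (Y : Omega -> 'rV[R]_n) : (forall i, measurable_fun setT (fun w => Y w ord0 i)) ->
    P.-integrable setT (EFin \o (fun w => Z w * enorm (Y w))%R) ->
    \int[P]_w (Z w * \sum_(i < n) u w i * Y w ord0 i)%:E =
    \sum_(i < n) \int[P]_w ((Z w * u w i) * Y w ord0 i)%:E.
  move=> mY iZY; rewrite -integral_sum//; last by move=> i; exact: iu.
  apply: eq_integral => w _; rewrite sumEFin mulr_sumr; congr EFin.
  by apply: eq_bigr => i _; rewrite mulrA.
have -> : \int[P]_w (Z w * enorm (m w))%:E =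
    \int[P]_w (Z w * \sum_(i < n) u w i * m w ord0 i)%:E.
  by apply: eq_integral => w _; rewrite um.
rewrite E//.
rewrite (eq_bigr (fun i => \int[P]_w ((Z w * u w i) * X w ord0 i)%:E)); last first.
  move=> i _; apply/esym.
  exact: (cond_exp_pullout sG Gm (iX i) (Xm i) (GZu i) (iu _ i mX iZX) (iu _ i mm iZm)).
rewrite -E//; apply: le_integral => //.
- apply: (le_integrable_real _ iZX).
    apply: measurable_funM; first exact: measurable_wrt_fun GZ.
    apply: measurable_sum => i; apply: measurable_funM => //.
    have Gu : measurable_wrt G (fun w => u w i).
      exact: (measurable_wrtM sG (Gmi i) Ginv).
    exact: measurable_wrt_fun Gu.
  move=> w; rewrite !normrM ler_wpM2l// (ger0_norm (enorm_ge0 _)).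
  rewrite ler_norml uX andbT.
  (* the lower bound is the previous one for - X *)
  rewrite lerNl -sumrN.
  have [m0|m0] := eqVneq (enorm (m w)) 0%R.
    by rewrite big1 ?enorm_ge0// => i _; rewrite /u m0 invr0 mulr0 mul0r oppr0.
  have m1 : (0 < enorm (m w))%R by rewrite lt_neqAle eq_sym m0 enorm_ge0.
  rewrite (eq_bigr (fun i => (enorm (m w))^-1 * (m w ord0 i * (- X w) ord0 i))%R); last first.
    by move=> i _; rewrite /u mxE; ring.
  by rewrite -mulr_sumr ler_pdivrMl// -(enormN (X w)) enorm_dot.
- by move=> w _; rewrite lee_fin ler_wpM2l.
Qed.

(** [enorm_submartingale] with [Z = |m|^(r-1)] and Young's inequality give the
bound once [E |m|^r] is known to be finite. Replacing [|m|] by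
[|m| 1_{|m| <= k}] makes this finite, and [k] tends to infinity. *)
Lemma cond_exp_jensen (r : R) : (1 < r)%R ->
  \int[P]_w (enorm (m w) `^ r)%:E <= \int[P]_w (enorm (X w) `^ r)%:E.
Proof.
move=> r1; have r0 : (0 < r)%R by lra.
have mnX := measurable_enorm mX; have mnm := measurable_enorm mm.
have mp (Y : Omega -> R) (s : R) : measurable_fun setT Y ->
    measurable_fun setT (fun w => (Y w `^ s)%R).
  exact: (@measurableT_comp _ _ _ _ _ _ (@powR R ^~ s)).
set I := leRHS.
have I0 : 0 <= I by apply: integral_ge0 => w _; rewrite lee_fin powR_ge0.
have [Ioo|Ify] := eqVneq I +oo; first by rewrite Ioo leey.
have {}Ify : I < +oo by rewrite ltey.
have iI : P.-integrable setT (EFin \o (fun w => enorm (X w) `^ r)%R).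
  apply/integrableP; split; first by apply/measurable_EFinP; exact: mp.
  rewrite (eq_integral (fun w => (enorm (X w) `^ r)%:E))// => w _.
  by rewrite /= ger0_norm ?powR_ge0.
pose y (k : nat) w : R := if (enorm (m w) <= k%:R)%R then enorm (m w) else 0%R.
have y0 k w : (0 <= y k w)%R by rewrite /y; case: ifP => // _; exact: enorm_ge0.
have yk k w : (y k w <= k%:R)%R by rewrite /y; case: ifP.
have Gy k : measurable_wrt G (y k).
  apply/measurable_wrtP => //; apply: measurable_fun_if => //.
  - apply: measurable_fun_ler => //.
    by apply/measurable_wrtP => //; apply: measurable_wrt_enorm.
  - apply: (@measurable_funS _ _ _ _ setT) => //.
    by apply/measurable_wrtP => //; apply: measurable_wrt_enorm.
have myk k : measurable_fun setT (y k) by exact: measurable_wrt_fun (Gy k).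
have bound k : \int[P]_w (y k w `^ r)%:E <= I.
  have bnd (h : Omega -> R) (c : R) : measurable_fun setT h ->
      (forall w, `|h w| <= c)%R -> P.-integrable setT (EFin \o h).
    move=> mh hc; have c0 : (0 <= c)%R by rewrite (le_trans _ (hc point)).
    apply: (@le_integrable_real _ _ _ _ _ (fun=> c)) => //.
      exact: finite_measure_integrable_cst.
    by move=> w; rewrite (ger0_norm c0).
  have ps (s : R) w : (0 <= s -> 0 <= y k w `^ s <= k%:R `^ s)%R.
    by move=> s0; rewrite powR_ge0/= ge0_ler_powR// ?nnegrE// ler0n.
  have iyr : P.-integrable setT (EFin \o (fun w => y k w `^ r)%R).
    apply: (bnd _ (k%:R `^ r)%R); first exact: mp.
    by move=> w; rewrite ger0_norm ?powR_ge0//; have /andP[_ ->] := ps r w (ltW r0).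
  pose Z w := (y k w `^ (r - 1))%R.
  have ZE w : (Z w * enorm (m w) = y k w `^ r)%R.
    rewrite /Z /y; case: ifP => _.
      have [->|m0] := eqVneq (enorm (m w)) 0%R.
        by rewrite mulr0 powR0// gt_eqF.
      by rewrite mulrC mulr_powRB1// enorm_ge0.
    by rewrite !powR0 ?mul0r// gt_eqF//; lra.
  have iZX : P.-integrable setT (EFin \o (fun w => Z w * enorm (X w))%R).
    have iX1 := integrable_enorm iX.
    have : P.-integrable setT (fun w => (k%:R `^ (r - 1))%:E * (enorm (X w))%:E).
      exact: integrableZl.
    move=> iXk; apply: (le_integrable measurableT _ _ iXk).
      by apply/measurable_EFinP/measurable_funM => //; exact: mp.
    move=> w _ /=; rewrite lee_fin !ger0_norm ?mulr_ge0 ?powR_ge0 ?enorm_ge0//.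
    rewrite ler_wpM2r ?enorm_ge0//.
    by have /andP[_ ->] : (0 <= Z w <= k%:R `^ (r - 1))%R by apply: ps; lra.
  have := @enorm_submartingale Z _ _ iZX.
  have -> : EFin \o (fun w => Z w * enorm (m w))%R = EFin \o (fun w => y k w `^ r)%R.
    by apply/funext => w /=; rewrite ZE.
  under eq_integral do rewrite ZE.
  move=> /(_ _ _ iyr) h.
  have {}h : \int[P]_w (y k w `^ r)%:E <= \int[P]_w (Z w * enorm (X w))%:E.
    apply: h; last by move=> w; exact: powR_ge0.
    exact: (measurable_wrt_comp (f := fun x => (x `^ (r - 1))%R) _ (Gy k)).
  have : \int[P]_w (Z w * enorm (X w))%:E <=
      r^-1%:E * I + ((r - 1) / r)%:E * \int[P]_w (y k w `^ r)%:E.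
    rewrite -!integralZl// -integralD//; [|exact: integrableZl..].
    apply: le_integral => //; first by apply: integrableD => //; exact: integrableZl.
    move=> w _; rewrite -!EFinM -EFinD lee_fin mulrC [(r^-1 * _)%R]mulrC.
    by apply: young_powR => //; exact: enorm_ge0.
  move=> /(le_trans h).
  have := integrable_fin_num measurableT iI; rewrite -/I.
  have := integrable_fin_num measurableT iyr.
  case: (\int[P]_w (y k w `^ r)%:E) => // a _; move: (I) => [b||]// _.
  rewrite -!EFinM -EFinD !lee_fin => ab.
  rewrite -subr_ge0.
  have : (0 <= r^-1 * (b - a))%R.
    rewrite (_ : r^-1 * (b - a) = r^-1 * b + (r - 1) / r * a - a)%R ?subr_ge0//.
    by field; exact: lt0r_neq0.
  by rewrite pmulr_rge0// invr_gt0.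
have ly w : (y k w `^ r)%:E @[k --> \oo] --> (enorm (m w) `^ r)%:E.
  apply: cvg_near_cst; near=> k; rewrite /y ifT//.
  by near: k; exact: nbhs_infty_ger.
apply: (fatou_le _ _ ly) => //.
- by move=> k; apply/measurable_EFinP; exact: mp.
- by move=> k w; rewrite lee_fin powR_ge0.
Unshelve. all: by end_near. Qed.

End jensen.

(** * Doob's maximal inequality *)

Section running_maximum.
Context (R : realType).
Implicit Types s : nat -> R.

Fixpoint runmax s k : R :=
  if k is k'.+1 then Num.max (runmax s k') (s k) else s 0%N.

Lemma runmax_ge s k i : (i <= k)%N -> s i <= runmax s k.
Proof.
elim: k => [|k IH]; first by rewrite leqn0 => /eqP ->.
rewrite leq_eqVlt => /predU1P[->|]; first by rewrite /= le_max lexx orbT.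
by rewrite ltnS => /IH h; rewrite /= le_max h.
Qed.

Lemma runmax_le s k c : (forall i, (i <= k)%N -> s i <= c) -> runmax s k <= c.
Proof.
elim: k => [|k IH] h; first exact: h.
by rewrite /= ge_max h// andbT; apply: IH => i ik; apply: h; exact: leqW.
Qed.

(** Doob's inequality for one path; the sum is a discrete stochastic integral,
whose expectation is nonnegative for a submartingale. Let [S_i] be the running
maximum. Summation by parts bounds the sum by
[s_k S_k^(r-1) - (r-1)/r S_k^r]: where [S] increases, [s] equals [S], and
Young's inequality compares [S_(i+1) (S_(i+1)^(r-1) - S_i^(r-1))] with
[(r-1)/r (S_(i+1)^r - S_i^r)]. Young's inequality applied to
[r/(r-1) s_k] and [S_k] then removes the mixed term, with the sharp constant. *)
Lemma doob_pathwise s (r : R) k : 1 < r -> (forall i, 0 <= s i) ->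
  runmax s k `^ r <= (r / (r - 1)) `^ r * s k `^ r -
    r ^+ 2 / (r - 1) *
    \sum_(0 <= i < k) runmax s i `^ (r - 1) * (s i.+1 - s i).
Proof.
move=> r1 s0; have r0 : 0 < r by lra.
have r10 : 0 < r - 1 by lra.
have S0 i : 0 <= runmax s i by rewrite (le_trans (s0 i))// runmax_ge.
set D := \sum_(0 <= i < k) _.
have DS : D <= s k * runmax s k `^ (r - 1) - (r - 1) / r * runmax s k `^ r.
  rewrite /D {D}; elim: k => [|k IH].
    rewrite big_nil /= mulr_powRB1//.
    rewrite (_ : _ - _ = r^-1 * s 0%N `^ r); last by field; exact: lt0r_neq0.
    by rewrite mulr_ge0 ?powR_ge0 ?invr_ge0 ?ltW.
  rewrite big_nat_recr//=.
  apply: (@le_trans _ _ (s k.+1 * runmax s k `^ (r - 1) - (r - 1) / r * runmax s k `^ r)).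
    by move: IH; lra.
  case: (leP (s k.+1) (runmax s k)) => [//|/ltW yx].
  rewrite mulr_powRB1//.
  have := young_powR (s0 k.+1) (S0 k) r1.
  have -> : s k.+1 `^ r - (r - 1) / r * s k.+1 `^ r = s k.+1 `^ r / r.
    by field; exact: lt0r_neq0.
  lra.
have qs0 : 0 <= r / (r - 1) * s k by rewrite mulr_ge0// divr_ge0// ltW.
have := young_powR qs0 (S0 k) r1.
rewrite powRM//; last by rewrite divr_ge0// ltW.
move: DS; set S := runmax s k `^ r; set Sr := runmax s k `^ (r - 1).
set Q := _ `^ r * _ `^ r => DS SQ.
have {}SQ : s k * Sr <= (r - 1) / r * (Q / r + (r - 1) / r * S).
  rewrite -ler_pdivrMl ?divr_gt0// invf_div mulrA; exact: SQ.
have {DS SQ} : D <= (r - 1) / r * (Q / r + (r - 1) / r * S) - (r - 1) / r * S by lra.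
have -> : (r - 1) / r * (Q / r + (r - 1) / r * S) - (r - 1) / r * S =
    (r - 1) / r ^+ 2 * (Q - S) by field; exact: lt0r_neq0.
rewrite -ler_pdivrMl; last by rewrite divr_gt0// exprn_gt0.
rewrite invf_div; lra.
Qed.

End running_maximum.

Section doob_discrete.
Context (R : realType) (d : measure_display) (Omega : measurableType d).
Context (P : probability Omega R).
Variables (s : nat -> Omega -> R) (r : R) (N : nat).
Hypothesis r1 : 1 < r.
Hypothesis ms : forall i, measurable_fun setT (s i).
Hypothesis s0 : forall i w, 0 <= s i w.
Hypothesis isr : forall i, (i <= N)%N ->
  P.-integrable setT (EFin \o (fun w => s i w `^ r)).
Local Notation S i w := (runmax (s ^~ w) i).

Let r0 : 0 < r. Proof. by move: r1; lra. Qed.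

Let S0 i w : 0 <= S i w.
Proof. by rewrite (le_trans (s0 i w))// (@runmax_ge _ (s ^~ w)). Qed.

Lemma measurable_runmax i : measurable_fun setT (fun w => S i w).
Proof. by elim: i => [|i IH] /=; [exact: ms|exact: measurable_maxr]. Qed.

Let mpow (Y : Omega -> R) (a : R) : measurable_fun setT Y ->
  measurable_fun setT (fun w => Y w `^ a).
Proof. exact: (@measurableT_comp _ _ _ _ _ _ (@powR R ^~ a)). Qed.

Lemma integrable_runmax_powR i : (i <= N)%N ->
  P.-integrable setT (EFin \o (fun w => S i w `^ r)).
Proof.
elim: i => [|i IH] iN /=; first exact: isr.
have i1 := IH (ltnW iN); have i2 := isr iN.
apply: (@le_integrable_real _ _ _ _ _ (fun w => S i w `^ r + s i.+1 w `^ r)).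
- exact/mpow/(measurable_runmax i.+1).
- exact: (integrableD _ i1 i2).
- move=> w; rewrite !ger0_norm ?addr_ge0 ?powR_ge0//.
  by have [_|_] := leP (S i w) (s i.+1 w); rewrite ?lerDl ?lerDr powR_ge0.
Qed.

Lemma integrable_runmax_mul i j : (i <= N)%N -> (j <= N)%N ->
  P.-integrable setT (EFin \o (fun w => S i w `^ (r - 1) * s j w)).
Proof.
move=> iN jN; have iS := integrable_runmax_powR iN; have isj := isr jN.
apply: (@le_integrable_real _ _ _ _ _ (fun w => s j w `^ r + S i w `^ r)).
- by apply: measurable_funM => //; apply: mpow; exact: measurable_runmax.
- exact: (integrableD _ isj iS).
- move=> w; rewrite !ger0_norm ?addr_ge0 ?mulr_ge0 ?powR_ge0// mulrC.
  apply: (le_trans (young_powR (s0 j w) (S0 i w) r1)).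
  apply: lerD.
    by rewrite ler_pdivrMr// ler_peMr ?powR_ge0// ltW.
  rewrite ler_piMl ?powR_ge0// ler_pdivrMr//; lra.
Qed.

Hypothesis submart : forall i, (i < N)%N ->
  (\int[P]_w (S i w `^ (r - 1) * s i w)%:E <=
   \int[P]_w (S i w `^ (r - 1) * s i.+1 w)%:E)%E.

Local Open Scope ereal_scope.

(** Integrate [doob_pathwise]. The hypothesis [submart] is the submartingale
property, tested against the weights [S_i^(r-1)]. *)
Lemma doob_discrete : \int[P]_w (S N w `^ r)%:E <=
  ((r / (r - 1)) `^ r)%:E * \int[P]_w (s N w `^ r)%:E.
Proof.
pose D k (w : Omega) : R :=
  (\sum_(0 <= i < k) S i w `^ (r - 1) * (s i.+1 w - s i w))%R.
pose e i (w : Omega) : R := (S i w `^ (r - 1) * (s i.+1 w - s i w))%R.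
have ie i : (i < N)%N -> P.-integrable setT (EFin \o e i).
  move=> iN.
  have := integrableB measurableT (integrable_runmax_mul (ltnW iN) iN)
     (integrable_runmax_mul (ltnW iN) (ltnW iN)).
  apply: eq_integrable => // w _; rewrite /e /= -EFinB; congr EFin; ring.
have eI i : (i < N)%N -> 0 <= \int[P]_w (e i w)%:E.
  move=> iN.
  have -> : \int[P]_w (e i w)%:E = \int[P]_w (S i w `^ (r - 1) * s i.+1 w)%:E -
      \int[P]_w (S i w `^ (r - 1) * s i w)%:E.
    rewrite -integralB//; last 2 first.
    - by apply: integrable_runmax_mul => //; exact: ltnW.
    - by apply: integrable_runmax_mul => //; exact: ltnW.
    by apply: eq_integral => w _; rewrite /e -EFinB; congr EFin; ring.
  rewrite sube_ge0; first exact: submart.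
  by rewrite integrable_fin_num//; apply: integrable_runmax_mul => //; exact: ltnW.
have iDk k : (k <= N)%N ->
    P.-integrable setT (EFin \o D k) /\ 0 <= \int[P]_w (D k w)%:E.
  rewrite /D; elim: k => [|k IH] kN.
    split.
      apply: (@eq_integrable _ _ _ P setT measurableT (cst 0)) => [w _|]; last exact: integrable0.
      by rewrite /= big_nil.
    by rewrite integral_ge0// => w _; rewrite big_nil.
  have [i1 i2] := IH (ltnW kN).
  split.
    apply: eq_integrable (integrableD measurableT i1 (ie k kN)) => // w _.
    by rewrite /= big_nat_recr.
  under eq_integral do rewrite big_nat_recr//= EFinD.
  rewrite integralD//; last exact: ie.
  by rewrite adde_ge0// eI.
have [iD ID] := iDk _ (leqnn N).
have iN := isr (leqnn N).
have q1 : (0 < r ^+ 2 / (r - 1))%R by rewrite divr_gt0 ?exprn_gt0// subr_gt0.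
apply: (@le_trans _ _ (\int[P]_w (((r / (r - 1)) `^ r)%:E * (s N w `^ r)%:E -
    (r ^+ 2 / (r - 1))%:E * (D N w)%:E))).
  apply: le_integral => //.
  - exact: integrable_runmax_powR.
  - by apply: integrableB => //; exact: integrableZl.
  - by move=> w _; rewrite -!EFinM -EFinB lee_fin; exact: doob_pathwise.
rewrite integralB//; [|exact: integrableZl..].
rewrite !integralZl//.
rewrite leeBlDr; last by rewrite fin_numM// integrable_fin_num.
by rewrite leeDl// mule_ge0// lee_fin ltW.
Qed.

End doob_discrete.

Section dyadic_times.
Context (R : realType).
Variable T : R.
Hypothesis T_ge0 : 0 <= T.

(** The index is capped at [2 ^ m], so that the times stay in [0, T] for every [i]. *)
Definition dya (m i : nat) : R := T * (minn i (2 ^ m))%:R / (2 ^ m)%:R.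

Lemma dya_itv m i : dya m i \in `[0, T].
Proof.
have h : (0 : R) < (2 ^ m)%:R by rewrite ltr0n expn_gt0.
rewrite in_itv/= /dya divr_ge0 ?mulr_ge0//=.
by rewrite ler_pdivrMr// ler_wpM2l// ler_nat geq_minr.
Qed.

Lemma dya_le m i j : (i <= j)%N -> dya m i <= dya m j.
Proof.
move=> ij; rewrite /dya ler_wpM2r ?invr_ge0// ler_wpM2l// ler_nat leq_min geq_minr.
by rewrite (leq_trans (geq_minl _ _)).
Qed.

Lemma dya0 m : dya m 0 = 0.
Proof. by rewrite /dya min0n mulr0 mul0r. Qed.

Lemma dya_end m : dya m (2 ^ m) = T.
Proof. by rewrite /dya minnn mulfK// pnatr_eq0 expn_eq0. Qed.

Lemma dya_double m i : dya m.+1 (2 * i) = dya m i.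
Proof.
have h : (2 ^ m)%:R != 0 :> R by rewrite pnatr_eq0 expn_eq0.
by rewrite /dya expnS -minnMr !natrM; field.
Qed.

End dyadic_times.

Section dyadic_maximum.
Context (R : realType) (d : measure_display) (Omega : measurableType d).
Context (T : R) (n : nat).
Hypothesis T_ge0 : 0 <= T.
Implicit Types X : process R Omega n.

Definition dmax X m w : R := runmax (fun i => enorm (X (dya T m i) w)) (2 ^ m).

(** The maximum over all dyadic times. It is defined for arbitrary paths, so that
Doob's inequality can be applied before a right-continuous version is known. *)
Definition dsup X w : \bar R := limn (fun m => (dmax X m w)%:E).

Lemma dmax_ge0 X m w : 0 <= dmax X m w.
Proof.
rewrite (le_trans (enorm_ge0 (X (dya T m 0) w)))//.
exact: (@runmax_ge _ (fun i => enorm (X (dya T m i) w))).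
Qed.

Lemma dmax_nd X w : nondecreasing_seq (fun m => (dmax X m w)%:E).
Proof.
apply/nondecreasing_seqP => m; rewrite lee_fin; apply: runmax_le => i im.
rewrite -dya_double//.
by apply: (@runmax_ge _ (fun i => enorm (X (dya T m.+1 i) w))); rewrite expnS leq_mul2l.
Qed.

Lemma dsup_ge X w m i : ((enorm (X (dya T m i) w))%:E <= dsup X w)%E.
Proof.
apply: (le_trans _ (ereal_nondecreasing_limn_ge m (dmax_nd X w))).
rewrite lee_fin.
have -> : dya T m i = dya T m (minn i (2 ^ m)) by rewrite /dya -minnA minnn.
by apply: (@runmax_ge _ (fun i => enorm (X (dya T m i) w))); exact: geq_minr.
Qed.

Lemma dsup_ge0 X w : (0 <= dsup X w)%E.
Proof.
by apply: le_trans (dsup_ge X w 0 0); rewrite lee_fin enorm_ge0.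
Qed.

Lemma dsup_le X w c :
  (forall m i, ((enorm (X (dya T m i) w))%:E <= c)%E) -> (dsup X w <= c)%E.
Proof.
move=> h; apply: lime_le; first exact/ereal_nondecreasing_is_cvgn/dmax_nd.
apply: nearW => m; case: c h => [c||]; [|by rewrite leey|].
  by move=> h; rewrite lee_fin; apply: runmax_le => i _; rewrite -lee_fin.
by move=> /(_ 0%N 0%N).
Qed.

Lemma measurable_dmax X m :
  (forall t i, t \in `[0, T] -> measurable_fun setT (fun w => X t w ord0 i)) ->
  measurable_fun setT (dmax X m).
Proof.
move=> mX; apply: (measurable_runmax (s := fun i w => enorm (X (dya T m i) w))).
by move=> i; apply: measurable_enorm => j; apply: mX; exact: dya_itv.
Qed.

Lemma measurable_dsup X :
  (forall t i, t \in `[0, T] -> measurable_fun setT (fun w => X t w ord0 i)) ->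
  measurable_fun setT (dsup X).
Proof.
move=> mX; apply: (emeasurable_fun_cvg (fun m w => (dmax X m w)%:E)).
  by move=> m; apply/measurable_EFinP; exact: measurable_dmax.
by move=> w _; exact/ereal_nondecreasing_is_cvgn/dmax_nd.
Qed.

End dyadic_maximum.

(** For [p = +oo] a martingale is bounded by its terminal value. *)
Definition doob_cst (R : realType) (p : \bar R) : R :=
  if p is r%:E then r / (r - 1) else 1.

Section martingale_doob.
Context (R : realType) (d : measure_display) (Omega : measurableType d).
Context (P : probability Omega R) (T : R) (FF : R -> set (set Omega)) (n : nat).
Hypothesis T_ge0 : 0 <= T.
Hypothesis FF_filtration : is_filtration T FF.
Variable X : process R Omega n.
Hypothesis X_mart : martingale P T FF X.

Let sFF t : t \in `[0, T] -> sigma_algebra setT (FF t).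
Proof. by case: FF_filtration => + _ _; apply. Qed.
Let FFm t : t \in `[0, T] -> FF t `<=` measurable.
Proof. by case: FF_filtration => _ + _; apply. Qed.

Let iX t i : t \in `[0, T] -> P.-integrable setT (fun w => (X t w ord0 i)%:E).
Proof. by case: X_mart => _ + _; apply. Qed.

Lemma martingale_measurable t i : t \in `[0, T] ->
  measurable_fun setT (fun w => X t w ord0 i).
Proof. by move=> tT; apply/measurable_EFinP; exact: measurable_int (iX i tT). Qed.

Let mX := martingale_measurable.

Let menorm t : t \in `[0, T] -> measurable_fun setT (fun w => enorm (X t w)).
Proof. by move=> tT; apply: measurable_enorm => i; exact: mX. Qed.

Let T_itv : T \in `[0, T]. Proof. by rewrite in_itv/= T_ge0 lexx. Qed.

Local Open Scope ereal_scope.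

Lemma doob_finite (r : R) : (1 < r)%R ->
  Lnorm P r%:E (dsup T X) <= (r / (r - 1))%:E * vLnorm P r%:E (X T).
Proof.
move=> r1; have r0 : (0 < r)%R by lra.
have q0 : (0 < r / (r - 1))%R by rewrite divr_gt0// subr_gt0.
have r1E : 1 < r%:E by rewrite lte_fin.
have [XToo|XTfin] := eqVneq (vLnorm P r%:E (X T)) +oo.
  by rewrite XToo gt0_muley ?lte_fin// leey.
have mp (Y : Omega -> R) (s : R) : measurable_fun setT Y ->
    measurable_fun setT (fun w => (Y w `^ s)%R).
  exact: (@measurableT_comp _ _ _ _ _ _ (@powR R ^~ s)).
have XTE : vLnorm P r%:E (X T) `^ r = \int[P]_w (enorm (X T w) `^ r)%:E.
  rewrite poweR_Lnorm ?gt_eqF//; apply: eq_integral => w _.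
  by rewrite /= ger0_norm ?enorm_ge0.
have XTlt : \int[P]_w (enorm (X T w) `^ r)%:E < +oo.
  by rewrite -XTE poweR_lty// ltey.
have Xlt t : t \in `[0%R, T] ->
    P.-integrable setT (EFin \o (fun w => enorm (X t w) `^ r)%R).
  move=> tT; apply/integrableP; split; first exact/measurable_EFinP/mp/menorm.
  rewrite (eq_integral (fun w => (enorm (X t w) `^ r)%:E)); last first.
    by move=> w _; rewrite /= ger0_norm ?powR_ge0.
  apply: le_lt_trans XTlt.
  apply: (@cond_exp_jensen _ _ _ _ _ (FF t)) => //; [exact: sFF|exact: FFm|..].
  - by move=> i; exact: iX.
  - move=> i; case: X_mart => _ _; apply => //.
    by move: tT; rewrite in_itv/= => /andP[].
apply: Lnorm_limn => //.
- move=> m; apply/measurable_EFinP/measurable_dmax => // t i; exact: mX.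
- by move=> m w; rewrite lee_fin dmax_ge0.
- by move=> w; exact: dmax_nd.
move=> m.
have c0 : 0 <= (r / (r - 1))%:E * vLnorm P r%:E (X T).
  by rewrite mule_ge0 ?Lnorm_ge0// lee_fin ltW.
rewrite Lnorm_lee//; last by move=> w; rewrite lee_fin dmax_ge0.
rewrite poweRM ?Lnorm_ge0 ?lee_fin ?(ltW q0)// XTE poweR_EFin.
under eq_integral do rewrite poweR_EFin.
pose s i w := enorm (X (dya T m i) w).
have := @doob_discrete _ _ _ P s r (2 ^ m) r1.
rewrite /s dya_end; apply.
- by move=> i; apply: menorm; exact: dya_itv.
- by move=> i w; exact: enorm_ge0.
- by move=> i _; apply: Xlt; exact: dya_itv.
move=> i im.
have ti := dya_itv T_ge0 m i; have ti1 := dya_itv T_ge0 m i.+1.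
have iprod j : (j <= 2 ^ m)%N -> P.-integrable setT
  (EFin \o (fun w => runmax (s ^~ w) i `^ (r - 1) * enorm (X (dya T m j) w))%R).
  move=> jm; apply: (@integrable_runmax_mul _ _ _ _ s r (2 ^ m)) => //.
  - by move=> k; apply: menorm; exact: dya_itv.
  - by move=> k w; exact: enorm_ge0.
  - by move=> k _; apply: Xlt; exact: dya_itv.
  - exact: ltnW.
apply: (@enorm_submartingale _ _ _ _ _ (FF (dya T m i))) => //.
- exact: sFF.
- exact: FFm.
- by move=> j; exact: iX.
- by move=> j; case: X_mart => _ _; apply => //; exact: dya_le.
- have Fk k : (k <= i)%N -> measurable_wrt (FF (dya T m i)) (s k).
    move=> ki; apply: measurable_wrt_enorm; first exact: sFF.
    move=> j; apply: (@measurable_wrtS _ _ _ (FF (dya T m k))).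
      case: FF_filtration => _ _; apply => //; [exact: dya_itv|exact: dya_le].
    by case: X_mart => + _ _; apply; exact: dya_itv.
  have Fs k : (k <= i)%N -> measurable_wrt (FF (dya T m i)) (fun w => runmax (s ^~ w) k).
    elim: k => [|k IH] ki /=; first exact: Fk.
    by apply: measurable_wrt_max; [exact: sFF|exact/IH/ltnW|exact: Fk].
  exact: (measurable_wrt_comp (f := fun x => (x `^ (r - 1))%R) _ (Fs i (leqnn i))).
- by move=> w; exact: powR_ge0.
- exact: iprod.
- by apply: iprod; exact: ltnW.
Qed.

(** If [|X_T| <= c] almost surely, the submartingale inequality on the event
[|X_t| > c] makes the nonnegative variable [(|X_t| - c)^+] have nonpositive
expectation. *)
Lemma doob_infinite : Lnorm P +oo (dsup T X) <= vLnorm P +oo (X T).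
Proof.
rewrite /vLnorm !Lnormy//; [|by move=> w; rewrite lee_fin enorm_ge0
  |by move=> w; exact: dsup_ge0].
set c := ess_sup P (fun w => (enorm (X T w))%:E).
have XTc : {ae P, forall w, (enorm (X T w))%:E <= c} by exact: ess_sup_ge.
have c0 : 0 <= c.
  rewrite /c -Lnormy ?Lnorm_ge0// => w; rewrite lee_fin enorm_ge0//.
have [coo|cfin] := eqVneq c +oo; first by rewrite coo leey.
have : c \is a fin_num by rewrite ge0_fin_numE// ltey.
move: XTc c0; case: c cfin => // c _ XTc c0 _.
apply/ess_supP.
suff : {ae P, forall w m i, (enorm (X (dya T m i) w))%:E <= c%:E}.
  by apply: filterS => w h; exact: dsup_le.
apply/ae_foralln => m; apply/ae_foralln => i.
set t := dya T m i; have tT : t \in `[0%R, T] by exact: dya_itv.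
pose A := [set w | (c < enorm (X t w))%R].
have FA : FF t A.
  have := @measurable_wrt_enorm _ _ _ _ (FF t) (X t) (sFF tT).
  have aX : vmeasurable_wrt (FF t) (X t) by case: X_mart => + _ _; apply.
  move=> /(_ aX) /(_ `]c, +oo[%classic (measurable_itv _)).
  by congr (FF t _); apply/seteqP; split => w; rewrite /A /= in_itv/= andbT.
have mA : measurable A by exact: FFm FA.
have ienorm u : u \in `[0%R, T] -> P.-integrable setT (EFin \o (fun w => enorm (X u w))).
  by move=> uT; apply: integrable_enorm => j; exact: iX.
have h : \int[P]_w (\1_A w * enorm (X t w))%:E <= \int[P]_w (\1_A w * enorm (X T w))%:E.
  apply: (@enorm_submartingale _ _ _ _ _ (FF t)) => //.
  - exact: sFF.
  - exact: FFm.
  - by move=> j; exact: iX.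
  - move=> j; case: X_mart => _ _; apply => //.
    by move: tT; rewrite in_itv/= => /andP[].
  - by apply: measurable_wrt_indic => //; exact: sFF.
  - by apply: integrable_indic_mul => //; exact: ienorm.
  - by apply: integrable_indic_mul => //; exact: ienorm.
have i0 : P.-integrable setT (EFin \o (fun w => \1_A w * (enorm (X t w) - c))%R).
  apply: integrable_indic_mul => //.
  have ic : P.-integrable setT (EFin \o cst c) by exact: finite_measure_integrable_cst.
  exact: (integrableB measurableT (ienorm t tT) ic).
have : \int[P]_w (\1_A w * (enorm (X t w) - c))%:E <= 0.
  have ic : P.-integrable setT (EFin \o (fun w => \1_A w * c)%R).
    apply: integrable_indic_mul => //; exact: finite_measure_integrable_cst.
  have -> : \int[P]_w (\1_A w * (enorm (X t w) - c))%:E =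
      \int[P]_w (\1_A w * enorm (X t w))%:E - \int[P]_w (\1_A w * c)%:E.
    rewrite -integralB//; last first.
      by apply: integrable_indic_mul => //; exact: ienorm.
    by apply: eq_integral => w _; rewrite -EFinB mulrBr.
  rewrite sube_le0; apply: (le_trans h).
  apply: ae_ge0_le_integral => //.
  - by move=> w _; rewrite lee_fin mulr_ge0 ?enorm_ge0.
  - apply/measurable_EFinP/measurable_funM; [exact: measurable_indic|exact: menorm].
  - by move=> w _; rewrite lee_fin mulr_ge0.
  - apply/measurable_EFinP/measurable_funM; [exact: measurable_indic|exact: measurable_cst].
  - by apply: filterS XTc => w XTw _; rewrite lee_fin ler_wpM2l.
have pos w : (0 <= \1_A w * (enorm (X t w) - c))%R.
  rewrite indicE; case: (boolP (w \in A)); last by rewrite mul0r.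
  by rewrite inE mul1r subr_ge0 => /ltW.
move=> le0; have /eqP : \int[P]_w (\1_A w * (enorm (X t w) - c))%:E = 0.
  by apply/eqP; rewrite eq_le le0/= integral_ge0// => w _; rewrite lee_fin.
move/eqP => int0.
have : ae_eq P setT (EFin \o (fun w => \1_A w * (enorm (X t w) - c))%R) (cst 0).
  apply/(ae_eq_integral_abs P measurableT); first exact: measurable_int i0.
  rewrite -[RHS]int0; apply: eq_integral => w _ /=.
  by rewrite ger0_norm.
apply: filterS => w /(_ I) /= e0.
have {}e0 := EFin_inj e0.
rewrite lee_fin leNgt; apply/negP => cX.
move: e0; rewrite indicE mem_set// mul1r => /eqP; rewrite subr_eq0 => /eqP e0.
by move: cX; rewrite e0 ltxx.
Qed.

Lemma doob p : 1 < p ->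
  Lnorm P p (dsup T X) <= (doob_cst p)%:E * vLnorm P p (X T).
Proof.
case: p => [r||] //; first by rewrite lte_fin; exact: doob_finite.
by move=> _; rewrite /= mul1e; exact: doob_infinite.
Qed.

End martingale_doob.

(** * Upcrossings and limits of paths along the dyadic times *)

Section upcrossings.
Context (R : realType) (a b : R).
Implicit Types s : nat -> R.

(** True while an upcrossing is under way: the path has been below [a] and has not
yet come back above [b]. *)
Fixpoint up_in s i : bool :=
  if i is i'.+1 then if up_in s i' then ~~ (b <= s i) else s i <= a
  else s 0%N <= a.

Definition up_cnt s i : nat := \sum_(0 <= j < i) (up_in s j && (b <= s j.+1)%R).

Hypothesis ab : a < b.

Lemma up_cnt_le s i j : (i <= j)%N -> (up_cnt s i <= up_cnt s j)%N.
Proof. by move=> ij; rewrite /up_cnt [X in (_ <= X)%N](big_cat_nat (n := i))//= leq_addr. Qed.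

(** Buying when the path is below [a] and selling when it is above [b] earns at
least [b - a] per completed upcrossing; the last term pays for a position still
open at the end. *)
Lemma up_cnt_gain s k : (b - a) * (up_cnt s k)%:R <=
  \sum_(0 <= j < k) (up_in s j)%:R * (s j.+1 - s j) + `|s k - a|.
Proof.
suff : (b - a) * (up_cnt s k)%:R + (up_in s k)%:R * (s k - a) <=
    \sum_(0 <= j < k) (up_in s j)%:R * (s j.+1 - s j).
  have := ler_norm (- (s k - a)); have := normr_ge0 (s k - a); rewrite normrN.
  by case: (up_in s k); rewrite ?mul1r ?mul0r; lra.
elim: k => [|k IH].
  rewrite /up_cnt !big_nil mulr0 add0r /=.
  by case: (leP (s 0%N) a) => h; rewrite ?mul1r ?mul0r ?subr_le0.
rewrite /up_cnt !big_nat_recr//= -/(up_cnt s k) natrD.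
move: IH; case: (up_in s k) => /=.
  rewrite !mul1r; case: (leP b (s k.+1)) => /= h; rewrite ?mul0r ?mul1r; nra.
rewrite !mul0r; case: (leP (s k.+1) a) => /= h; rewrite ?mul0r ?mul1r; lra.
Qed.

Lemma up_in_lt s i : s i < a -> up_in s i.
Proof.
case: i => [|i] /= h; first exact: ltW.
case: (up_in s i); last exact: ltW.
by rewrite -ltNge (lt_trans h).
Qed.

Lemma up_cnt_lt s i l : (i < l)%N -> s i < a -> b < s l ->
  (up_cnt s i < up_cnt s l)%N.
Proof.
move=> il sia bsl.
have inv k : (i <= k)%N -> up_in s k \/ (up_cnt s i < up_cnt s k)%N.
  elim: k => [|k IH].
    by rewrite leqn0 => /eqP i0; left; apply: up_in_lt; rewrite -i0.
  rewrite leq_eqVlt => /predU1P[ik|]; first by left; rewrite -ik; exact: up_in_lt.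
  rewrite ltnS => ik; case: (IH ik) => [uk|h]; last first.
    by right; apply: (leq_trans h); exact: up_cnt_le.
  case: (leP b (s k.+1)) => h; last by left; rewrite /= uk -ltNge.
  right; rewrite [X in (_ < X)%N]/up_cnt big_nat_recr//= uk h addn1 ltnS.
  exact: up_cnt_le.
case: l il bsl => // l; rewrite ltnS => il bsl.
case: (inv l il) => [ul|h]; last by apply: (leq_trans h); exact: up_cnt_le.
rewrite [X in (_ < X)%N]/up_cnt big_nat_recr//= ul (ltW bsl) addn1 ltnS.
exact: up_cnt_le.
Qed.
End upcrossings.

Section dyadic_density.
Context (R : realType) (T : R).
Hypothesis T_ge0 : 0 <= T.

Definition dyadic : set R := [set t | exists m i, t = dya T m i].

(** The first time of the grid of step [T / 2 ^ m] strictly after [t]. *)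
Definition after (t : R) (m : nat) : R :=
  dya T m (Num.truncn (t * (2 ^ m)%:R / T)).+1.

Lemma after_itv t m : 0 <= t -> t < T -> t < after t m <= t + T / (2 ^ m)%:R.
Proof.
move=> t0 tT; have T0 : 0 < T by exact: le_lt_trans tT.
have h : (0 : R) < (2 ^ m)%:R by rewrite ltr0n expn_gt0.
set x := t * (2 ^ m)%:R / T.
have x0 : 0 <= x by rewrite /x !mulr_ge0// ltW// invr_gt0.
have /andP[x1 x2] := truncn_itv x0.
have tE : t = T * x / (2 ^ m)%:R by rewrite /x; field; rewrite !gt_eqF.
have im : ((Num.truncn x).+1 <= 2 ^ m)%N.
  rewrite -(ltr_nat R) (le_lt_trans x1)// /x ltr_pdivrMr// mulrC ltr_pM2l//.
rewrite /after -/x /dya (minn_idPl im) {1 2}tE; apply/andP; split.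
  by rewrite ltr_pM2r ?invr_gt0// ltr_pM2l.
by rewrite -mulrDl ler_pM2r ?invr_gt0// -[in leRHS](mulr1 T) -mulrA mul1r -mulrDr ler_pM2l// -natr1 lerD2r.
Qed.

Lemma dyadic_after t m : dyadic (after t m).
Proof. by exists m, (Num.truncn (t * (2 ^ m)%:R / T)).+1. Qed.

Lemma dyadic_refl t : dyadic t -> dyadic (T - t).
Proof.
move=> [m [i ->]]; exists m, (2 ^ m - minn i (2 ^ m))%N.
have h : (2 ^ m)%:R != 0 :> R by rewrite pnatr_eq0 expn_eq0.
rewrite /dya (minn_idPl (leq_subr _ _)) natrB ?geq_minr//.
by field.
Qed.

Lemma dyadic_level t : dyadic t -> exists m0, forall m, (m0 <= m)%N ->
  exists2 i, (i <= 2 ^ m)%N & t = dya T m i.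
Proof.
move=> [m0 [i ->]]; exists m0 => m /subnK <-.
elim: (m - m0)%N => [|k [j jk E]].
  exists (minn i (2 ^ m0)); first exact: geq_minr.
  by rewrite /dya -minnA minnn.
exists (2 * j)%N; first by rewrite addSn expnS leq_mul2l jk orbT.
by rewrite addSn dya_double.
Qed.

Lemma dyadic_itv t : dyadic t -> t \in `[0, T].
Proof. by move=> [m [i ->]]; exact: dya_itv. Qed.

Lemma inv_pow2_lt (e : R) : 0 < e -> exists m0, forall m, (m0 <= m)%N ->
  T / (2 ^ m)%:R < e.
Proof.
move=> e0; exists (Num.truncn (T / e)).+1 => m m0.
have h : (0 : R) < (2 ^ m)%:R by rewrite ltr0n expn_gt0.
rewrite ltr_pdivrMr// mulrC -ltr_pdivrMr//.
have Te : 0 <= T / e by rewrite divr_ge0// ltW.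
have /andP[_ /lt_le_trans] := truncn_itv Te; apply.
by rewrite ler_nat (leq_trans m0)// ltnW// ltn_expl.
Qed.

Lemma dyadic_right_ex t (B : set R) : 0 <= t -> t < T -> (t^'+) B ->
  exists2 q, dyadic q & t < q /\ B q.
Proof.
move=> t0 tT /nbhs_ballP[e /= e0 eB].
have [m0 /(_ m0 (leqnn _)) me] := inv_pow2_lt e0.
exists (after t m0); first exact: dyadic_after.
have /andP[h1 h2] := after_itv m0 t0 tT; split => //.
apply: eB => //; rewrite /ball/= ltr_norml; lra.
Qed.

Lemma dyadic_left_ex t (B : set R) : 0 < t -> t <= T -> (t^'-) B ->
  exists2 q, dyadic q & q < t /\ B q.
Proof.
move=> t0 tT /nbhs_ballP[e /= e0 eB].
have [m0 /(_ m0 (leqnn _)) me] := inv_pow2_lt e0.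
have h0 : 0 <= T - t by lra.
have h1 : T - t < T by lra.
have /andP[h2 h3] := after_itv m0 h0 h1.
exists (T - after (T - t) m0); first exact/dyadic_refl/dyadic_after.
split; first lra.
apply: eB; last lra.
rewrite /ball/= ltr_norml; lra.
Qed.

Lemma dyadic_right_proper t : 0 <= t -> t < T -> ProperFilter (within dyadic (t^'+)).
Proof.
move=> t0 tT; apply: Build_ProperFilter_ex => B /dyadic_right_ex[]// q Dq [_ h].
by exists q; exact: h.
Qed.

Lemma dyadic_left_proper t : 0 < t -> t <= T -> ProperFilter (within dyadic (t^'-)).
Proof.
move=> t0 tT; apply: Build_ProperFilter_ex => B /dyadic_left_ex[]// q Dq [_ h].
by exists q; exact: h.
Qed.

End dyadic_density.

Section limit_criterion.
Context (R : realType).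

Lemma ratr_between (x y : R) : x < y -> exists a : rat, x < ratr a < y.
Proof. by move=> /rat_in_itvoo[a]; rewrite in_itv/=; exists a. Qed.

(** A bounded function that does not oscillate around any rational interval
converges, to the supremum of the rationals that it eventually exceeds. *)
Lemma cvg_no_oscillation (F : set_system R) (f : R -> R) (B : R) :
  ProperFilter F -> (\forall q \near F, `|f q| <= B) ->
  (forall a b : rat, a < b ->
    (\forall q \near F, ratr a <= f q) \/ (\forall q \near F, f q <= ratr b)) ->
  cvg (f q @[q --> F]).
Proof.
move=> FF fB osc.
pose S := [set x : R | exists2 a : rat, x = ratr a & \forall q \near F, ratr a <= f q].
have ubS : ubound S B.
  move=> _ [a -> Fa]; near F => q.
  rewrite (@le_trans _ _ (f q))//; first by near: q.
  by rewrite (le_trans (ler_norm _))//; near: q.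
have S0 : S !=set0.
  have [a /andP[a1 a2]] : exists a : rat, - B - 1 < ratr a < - B by apply: ratr_between; lra.
  exists (ratr a), a => //.
  apply: filterS fB => q; rewrite ler_norml => /andP[h _]; lra.
have supS : has_sup S by split => //; exists B.
apply/cvg_ex; exists (sup S); apply/cvgrPdist_le => e e0.
have [_ [a -> Fa] ae] := sup_adherent e0 supS.
have [b1 /andP[b1l b1r]] : exists a : rat, sup S < ratr a < sup S + e / 2 by apply: ratr_between; lra.
have [b2 /andP[b2l b2r]] : exists a : rat, sup S + e / 2 < ratr a < sup S + e by apply: ratr_between; lra.
have b12 : b1 < b2 by rewrite -(ltr_rat R); lra.
case: (osc b1 b2 b12) => [Fb|Fb].
  have : ratr b1 <= sup S by apply: sup_upper_bound => //; exists b1.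
  lra.
near=> q.
have h1 : ratr a <= f q by near: q.
have h2 : f q <= ratr b2 by near: q.
rewrite ler_norml; lra.
Unshelve. all: by end_near. Qed.

End limit_criterion.

Section crossing_chains.
Context (R : realType) (T : R).
Hypothesis T_ge0 : 0 <= T.
Implicit Types (f : R -> R) (a b x t : R).

(** [K] successive upcrossings at dyadic times after [x]. Unlike [up_cnt], this
refers to no particular grid, so chains can be built one link at a time. *)
Fixpoint chain f a b K x : Prop :=
  if K is K'.+1 then exists s q, [/\ dyadic T s, dyadic T q, x < s < q,
    f s < a < b /\ b < f q & chain f a b K' q]
  else True.

(** The times of a chain belong to all fine enough grids, and there each link
forces one more upcrossing to be counted. *)
Lemma chain_count f a b K x : a < b -> chain f a b K x ->
  exists m0, forall m, (m0 <= m)%N -> forall j, (j <= 2 ^ m)%N -> dya T m j <= x ->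
    (up_cnt a b (fun i => f (dya T m i)) j + K <=
     up_cnt a b (fun i => f (dya T m i)) (2 ^ m))%N.
Proof.
move=> ab; elim: K x => [|K IH] x /=.
  by move=> _; exists 0%N => m _ j jm _; rewrite addn0; exact: up_cnt_le.
move=> [s [q [Ds Dq /andP[xs sq] [/andP[fsa _] bfq] /IH[m1 h]]]].
have [m2 hs] := dyadic_level Ds; have [m3 hq] := dyadic_level Dq.
exists (maxn m1 (maxn m2 m3)) => m; rewrite !geq_max => /and3P[m1m m2m m3m] j jm jx.
have [i im sE] := hs m m2m; have [l lm qE] := hq m m3m.
have lt_dya i1 i2 : dya T m i1 < dya T m i2 -> (i1 < i2)%N.
  by apply: contraTltn => h21; rewrite -leNgt; exact: dya_le.
have ji : (j < i)%N by apply: lt_dya; rewrite -sE; exact: le_lt_trans xs.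
have il : (i < l)%N by apply: lt_dya; rewrite -sE -qE.
rewrite addnS -addSn; apply: leq_trans (h m m1m l lm _); last by rewrite qE.
rewrite leq_add2r; apply: (@leq_ltn_trans (up_cnt a b (fun i => f (dya T m i)) i)).
  by apply: up_cnt_le; exact: ltnW.
by apply: up_cnt_lt => //; rewrite -?sE -?qE.
Qed.

(** Each new link is put between [t] and the links already there. *)
Lemma chain_right f a b t : a < b -> 0 <= t -> t < T ->
  ~ (\forall q \near within (dyadic T) (t^'+), a <= f q) ->
  ~ (\forall q \near within (dyadic T) (t^'+), f q <= b) ->
  forall K, exists2 x, t < x & chain f a b K x.
Proof.
move=> ab t0 tT na nb.
have exn (Q : R -> bool) x : t < x ->
    ~ (\forall q \near within (dyadic T) (t^'+), Q q) ->
    exists2 q, dyadic T q & t < q < x /\ ~~ Q q.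
  move=> tx nQ; apply: contrapT => h; apply: nQ.
  suff : \forall q \near t^'+, dyadic T q -> Q q by [].
  near=> q => Dq; apply: contrapT => /negP nQq; apply: h; exists q => //; split => //.
  by apply/andP; split; near: q; [exact: nbhs_right_gt|exact: nbhs_right_lt].
elim=> [|K [x tx cx]].
  by exists (t + 1) => //; rewrite ltrDl.
have [q Dq [/andP[tq qx] fq]] := exn (fun q => f q <= b) x tx nb.
have [s Ds [/andP[ts sq] fs]] := exn (fun q => a <= f q) q tq na.
exists ((t + s) / 2); first lra.
exists s, q; split => //.
- apply/andP; split => //; lra.
- by rewrite -!ltNge in fs fq; rewrite fs ab.
- have mono K' y z : y < z -> chain f a b K' z -> chain f a b K' y.
    case: K' => //= K' yz [s' [q' [? ? /andP[zs sq'] ? ?]]].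
    by exists s', q'; split => //; rewrite (lt_trans yz zs).
  exact: mono cx.
Unshelve. all: by end_near. Qed.

(** After one link there is still room for the others before [t]. *)
Lemma chain_left f a b t : a < b -> 0 < t -> t <= T ->
  ~ (\forall q \near within (dyadic T) (t^'-), a <= f q) ->
  ~ (\forall q \near within (dyadic T) (t^'-), f q <= b) ->
  forall K x, x < t -> chain f a b K x.
Proof.
move=> ab t0 tT na nb.
have exn (Q : R -> bool) x : x < t ->
    ~ (\forall q \near within (dyadic T) (t^'-), Q q) ->
    exists2 q, dyadic T q & x < q < t /\ ~~ Q q.
  move=> tx nQ; apply: contrapT => h; apply: nQ.
  suff : \forall q \near t^'-, dyadic T q -> Q q by [].
  near=> q => Dq; apply: contrapT => /negP nQq; apply: h; exists q => //; split => //.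
  by apply/andP; split; near: q; [exact: nbhs_left_gt|exact: nbhs_left_lt].
elim=> [//|K IH] x xt.
have [s Ds [/andP[xs st] fs]] := exn (fun q => a <= f q) x xt na.
have [q Dq [/andP[sq qt] fq]] := exn (fun q => f q <= b) s st nb.
exists s, q; split => //.
- by rewrite xs sq.
- by rewrite -!ltNge in fs fq; rewrite fs ab.
- exact: IH.
Unshelve. all: by end_near. Qed.

(** Fatou's lemma only bounds the lower limit of the counts as the grid is
refined, so the bound [K] is required on infinitely many grids. *)
Definition tame f := forall a b : rat, a < b ->
  exists K, forall m0, exists2 m, (m0 <= m)%N &
    (up_cnt (ratr a) (ratr b) (fun i => f (dya T m i)) (2 ^ m) <= K)%N.

Lemma tame_chain f (a b : rat) : a < b -> tame f ->
  exists K, forall x, 0 <= x -> ~ chain f (ratr a) (ratr b) K x.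
Proof.
move=> ab /(_ a b ab)[K hK]; exists K.+1 => x x0 cx.
have rab : ratr a < ratr b :> R by rewrite ltr_rat.
have [m0 h] := chain_count rab cx.
have [m m0m] := hK m0; apply/negP; rewrite -ltnNge.
by have := h m m0m 0%N (leq0n _); rewrite dya0 => /(_ x0); rewrite /up_cnt big_nil.
Qed.

Lemma tame_cvg_right f (B : R) t : tame f -> (forall q, dyadic T q -> `|f q| <= B) ->
  0 <= t -> t < T -> cvg (f q @[q --> within (dyadic T) (t^'+)]).
Proof.
move=> tf fB t0 tT; have PF := dyadic_right_proper T_ge0 t0 tT.
apply: (@cvg_no_oscillation _ _ _ B) => //.
  suff : \forall q \near t^'+, dyadic T q -> `|f q| <= B by [].
  by apply: nearW => q Dq; exact: fB.
move=> a b ab; apply: contrapT => /not_orP[na nb].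
have [K hK] := tame_chain ab tf.
have rab : ratr a < ratr b :> R by rewrite ltr_rat.
have [x tx] := chain_right rab t0 tT na nb K.
by apply: hK; rewrite (le_trans t0)// ltW.
Qed.

Lemma tame_cvg_left f (B : R) t : tame f -> (forall q, dyadic T q -> `|f q| <= B) ->
  0 < t -> t <= T -> cvg (f q @[q --> within (dyadic T) (t^'-)]).
Proof.
move=> tf fB t0 tT; have PF := dyadic_left_proper T_ge0 t0 tT.
apply: (@cvg_no_oscillation _ _ _ B) => //.
  suff : \forall q \near t^'-, dyadic T q -> `|f q| <= B by [].
  by apply: nearW => q Dq; exact: fB.
move=> a b ab; apply: contrapT => /not_orP[na nb].
have [K hK] := tame_chain ab tf.
have rab : ratr a < ratr b :> R by rewrite ltr_rat.
exact: (hK 0 (lexx _)) (chain_left rab t0 tT na nb K t0).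
Qed.

End crossing_chains.

(** * Right-continuous versions of martingales *)

Section regularized_path.
Context (R : realType) (T : R).
Hypothesis T_ge0 : 0 <= T.
Variable f : R -> R.

(** The last time has no right neighbourhood in [0, T], so the value there is kept. *)
Definition rlim (t : R) : R :=
  if t < T then lim (f q @[q --> within (dyadic T) (t^'+)]) else f T.

Hypothesis cvg_right : forall t, 0 <= t -> t < T ->
  cvg (f q @[q --> within (dyadic T) (t^'+)]).
Hypothesis cvg_left : forall t, 0 < t -> t <= T ->
  cvg (f q @[q --> within (dyadic T) (t^'-)]).

Lemma rlim_cvg t : 0 <= t -> t < T ->
  f q @[q --> within (dyadic T) (t^'+)] --> rlim t.
Proof. by move=> t0 tT; rewrite /rlim tT; exact: cvg_right. Qed.

Let rlim_dist t c e : 0 <= t -> t < T ->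
  (\forall q \near t^'+, dyadic T q -> `|c - f q| <= e) -> `|c - rlim t| <= e.
Proof.
move=> t0 tT H; have PF := dyadic_right_proper T_ge0 t0 tT.
apply/ler_addgt0Pr => e' e'0.
have /cvgrPdist_le /(_ _ e'0) H' := rlim_cvg t0 tT.
have [q [h1 h2]] := filter_ex (filterI H' H : (within (dyadic T) (t^'+)) _).
rewrite (_ : c - rlim t = (c - f q) + - (rlim t - f q)); last by ring.
by rewrite (le_trans (ler_normD _ _))// normrN lerD.
Qed.

Lemma rlim_right_continuous t : t \in `[0, T[ -> rlim s @[s --> t^'+] --> rlim t.
Proof.
rewrite in_itv/= => /andP[t0 tT]; apply/cvgrPdist_le => e e0.
have /cvgrPdist_le /(_ _ e0) /nbhs_ballP[r /= r0 H] := rlim_cvg t0 tT.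
near=> s; have ts : t < s by near: s; exact: nbhs_right_gt.
have sT : s < T by near: s; exact: nbhs_right_lt.
have str : s < t + r by near: s; apply: nbhs_right_lt; rewrite ltrDl.
apply: rlim_dist => //; first by rewrite (le_trans t0)// ltW.
near=> q => Dq.
have sq : s < q by near: q; exact: nbhs_right_gt.
have qtr : q < t + r by near: q; exact: nbhs_right_lt.
apply: H => //; last exact: lt_trans sq.
rewrite /ball/= ltr_norml; lra.
Unshelve. all: by end_near. Qed.

Lemma rlim_left_limit t : t \in `]0, T] -> cvg (rlim s @[s --> t^'-]).
Proof.
rewrite in_itv/= => /andP[t0 tT].
have /cvg_ex[l fl] := cvg_left t0 tT; apply/cvg_ex; exists l.
apply/cvgrPdist_le => e e0.
have /cvgrPdist_le /(_ _ e0) /nbhs_ballP[r /= r0 H] := fl.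
near=> s; have st : s < t by near: s; exact: nbhs_left_lt.
have s0 : 0 < s by near: s; exact: nbhs_left_gt.
have str : t - r < s by near: s; apply: nbhs_left_gt; rewrite ltrBlDr ltrDl.
apply: rlim_dist; [exact: ltW|exact: lt_le_trans tT|].
near=> q => Dq.
have sq : s < q by near: q; exact: nbhs_right_gt.
have qt : q < t by near: q; exact: nbhs_right_lt.
apply: H => //.
rewrite /ball/= ltr_norml; lra.
Unshelve. all: by end_near. Qed.

Lemma after_cvg t : 0 <= t -> t < T ->
  after T t m @[m --> \oo] --> within (dyadic T) (t^'+).
Proof.
move=> t0 tT A /nbhs_ballP[r /= r0 H].
have [m0 hm0] := inv_pow2_lt T_ge0 r0.
exists m0 => // m /= m0m; have := hm0 m m0m => mr.
have /andP[h1 h2] := after_itv m t0 tT.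
apply: H => //; last exact: dyadic_after.
rewrite /ball/= ltr_norml; lra.
Qed.

Lemma rlim_after t : 0 <= t -> t < T -> f (after T t m) @[m --> \oo] --> rlim t.
Proof.
by move=> t0 tT; apply: cvg_comp (after_cvg t0 tT) (rlim_cvg t0 tT).
Qed.

End regularized_path.

Section upcrossing_expectation.
Context (R : realType) (d : measure_display) (Omega : measurableType d).
Context (P : probability Omega R) (T : R) (FF : R -> set (set Omega)) (n : nat).
Hypothesis T_ge0 : 0 <= T.
Hypothesis FF_filtration : is_filtration T FF.
Variable X : process R Omega n.
Hypothesis X_mart : martingale P T FF X.
Variables (i : 'I_n) (a b : R).
Hypothesis ab : a < b.

Let x t w : R := X t w ord0 i.

Let sFF t : t \in `[0, T] -> sigma_algebra setT (FF t).
Proof. by case: FF_filtration => + _ _; apply. Qed.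
Let FFm t : t \in `[0, T] -> FF t `<=` measurable.
Proof. by case: FF_filtration => _ + _; apply. Qed.
Let ix t : t \in `[0, T] -> P.-integrable setT (EFin \o x t).
Proof. by case: X_mart => _ + _; apply. Qed.

Let itv_dya m j := dya_itv T_ge0 m j.

Lemma up_in_adapted m j k : (j <= k)%N ->
  FF (dya T m k) [set w | up_in a b (fun j => x (dya T m j) w) j].
Proof.
move=> jk; set t := dya T m k; have tT : t \in `[0, T] := itv_dya m k.
have mx l : (l <= k)%N ->
    measurable_fun [set: g_sigma_algebraType (FF t)] (x (dya T m l)).
  move=> lk; apply/measurable_wrtP; first exact: sFF.
  apply: (@measurable_wrtS _ _ _ (FF (dya T m l))).
    by case: FF_filtration => _ _; apply => //; exact: dya_le.
  by case: X_mart => + _ _; apply.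
have : measurable_fun [set: g_sigma_algebraType (FF t)]
    (fun w => up_in a b (fun j => x (dya T m j) w) j).
  elim: j jk => [|j IH] jk /=; first by apply: measurable_fun_ler => //; exact: mx.
  apply: measurable_fun_if => //.
  - by apply: IH; exact: ltnW.
  - apply: (@measurable_funS _ _ _ _ setT) => //; apply: measurable_neg.
    by apply: measurable_fun_ler => //; exact: mx.
  - apply: (@measurable_funS _ _ _ _ setT) => //.
    by apply: measurable_fun_ler => //; exact: mx.
move=> /(_ measurableT [set true] I); rewrite setTI measurable_g_measurableTypeE; last exact: sFF.
by [].
Qed.

Local Open Scope ereal_scope.

Lemma measurable_up_cnt m k :
  measurable_fun setT (fun w => (up_cnt a b (fun j => x (dya T m j) w) k)%:R : R).
Proof.
have mx j : measurable_fun setT (x (dya T m j)).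
  by apply/measurable_EFinP; exact: measurable_int (ix (itv_dya m j)).
rewrite (_ : (fun _ => _) = fun w => (\sum_(0 <= j < k)
  ((up_in a b (fun j => x (dya T m j) w) j && (b <= x (dya T m j.+1) w))%:R : R))%R); last first.
  by apply/funext => w; rewrite /up_cnt natr_sum.
apply: measurable_sum => j.
have mA : measurable [set w | up_in a b (fun j => x (dya T m j) w) j].
  exact: (FFm (itv_dya m j) (up_in_adapted _ (leqnn j))).
have mB : measurable [set w | (b <= x (dya T m j.+1) w)%R].
  rewrite -[X in measurable X]setTI; exact: measurable_fun_ler.
rewrite (_ : (fun _ => _) = \1_([set w | up_in a b (fun j => x (dya T m j) w) j] `&`
    [set w | (b <= x (dya T m j.+1) w)%R])).
  by apply: measurable_indic; exact: measurableI.
apply/funext => w; rewrite indicE; congr (nat_of_bool _)%:R.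
by apply/idP/idP; rewrite inE/= => /andP.
Qed.

(** The stochastic integral in [up_cnt_gain] has mean zero, because its integrand
at time [t_j] is the indicator of an event known at [t_j]. *)
Lemma upcrossing_expectation m :
  (b - a)%:E * \int[P]_w (up_cnt a b (fun j => x (dya T m j) w) (2 ^ m))%:R%:E <=
  \int[P]_w `|x T w - a|%:E.
Proof.
set N := (2 ^ m)%N.
have iT : T \in `[0%R, T] by rewrite in_itv/= T_ge0 lexx.
pose e j w : R := ((up_in a b (fun j => x (dya T m j) w) j)%:R *
  (x (dya T m j.+1) w - x (dya T m j) w))%R.
have eE j w : e j w = (\1_[set w | up_in a b (fun j => x (dya T m j) w) j] w *
    x (dya T m j.+1) w - \1_[set w | up_in a b (fun j => x (dya T m j) w) j] w *
    x (dya T m j) w)%R.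
  rewrite -mulrBr /e indicE; congr ((nat_of_bool _)%:R * _)%R.
  by apply/idP/idP; rewrite inE.
have FA j := up_in_adapted m (leqnn j).
have mA j : measurable [set w | up_in a b (fun j => x (dya T m j) w) j].
  exact: (FFm (itv_dya m j) (FA j)).
have i1 j k : P.-integrable setT
    (EFin \o (fun w => \1_[set w | up_in a b (fun j => x (dya T m j) w) j] w * x (dya T m k) w)%R).
  by apply: integrable_indic_mul => //; exact: ix.
have ie j : P.-integrable setT (EFin \o e j).
  rewrite (_ : _ \o _ = (fun w => (\1_[set w | up_in a b (fun j => x (dya T m j) w) j] w *
    x (dya T m j.+1) w)%:E - (\1_[set w | up_in a b (fun j => x (dya T m j) w) j] w *
    x (dya T m j) w)%:E)); first exact: integrableB (i1 j j.+1) (i1 j j).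
  by apply/funext => w; rewrite /= eE EFinB.
have e0 j : \int[P]_w (e j w)%:E = 0.
  under eq_integral do rewrite eE EFinB.
  rewrite integralB//; [|exact: i1..].
  rewrite !integral_indic_mul.
  case: X_mart => _ _ /(_ (dya T m j) (dya T m j.+1) i (itv_dya m j) (itv_dya m j.+1)).
  move=> /(_ (dya_le T_ge0 _ (leqnSn j)))[_ _ /(_ _ (FA j)) ->].
  apply: subee; apply: integrable_fin_num => //.
  by apply: (integrableS measurableT) => //; exact: ix.
have iabs : P.-integrable setT (fun w => `|x T w - a|%:E).
  have ia : P.-integrable setT (EFin \o cst a) by exact: finite_measure_integrable_cst.
  exact: (integrable_abse (integrableB measurableT (ix iT) ia)).
have isum : P.-integrable setT (fun w => \sum_(0 <= j < N) (e j w)%:E).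
  by apply: integrable_sum => // j _; exact: ie.
rewrite -ge0_integralZl_EFin//; last 2 first.
- by apply/measurable_EFinP; exact: measurable_up_cnt.
- by rewrite subr_ge0 ltW.
apply: (@le_trans _ _ (\int[P]_w (\sum_(0 <= j < N) (e j w)%:E + `|x T w - a|%:E))).
  apply: ge0_le_integral => //.
  - by move=> w _; rewrite mule_ge0// lee_fin// subr_ge0 ltW.
  - by apply: measurable_funeM; apply/measurable_EFinP; exact: measurable_up_cnt.
  - by apply: emeasurable_funD; [exact: measurable_int isum|exact: measurable_int iabs].
  - move=> w _; rewrite sumEFin -EFinD -EFinM lee_fin.
    have := up_cnt_gain a b (fun j => x (dya T m j) w) N.
    by rewrite dya_end.
rewrite integralD// integral_sum//.
by rewrite big1 ?add0e// => j _; exact: e0.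
Qed.

End upcrossing_expectation.

Section regularization.
Context (R : realType) (d : measure_display) (Omega : measurableType d).
Context (P : probability Omega R) (T : R) (FF : R -> set (set Omega)) (n : nat).
Hypothesis T_ge0 : 0 <= T.
Hypothesis FF_filtration : is_filtration T FF.
Hypothesis FF_usual : usual_conditions P T FF.
Variables (X : process R Omega n) (p : \bar R).
Hypothesis p_gt1 : (1 < p)%E.
Hypothesis X_mart : martingale P T FF X.
Hypothesis XT_Lp : (vLnorm P p (X T) < +oo)%E.

Let sFF t : t \in `[0, T] -> sigma_algebra setT (FF t).
Proof. by case: FF_filtration => + _ _; apply. Qed.
Let FFm t : t \in `[0, T] -> FF t `<=` measurable.
Proof. by case: FF_filtration => _ + _; apply. Qed.
Let FFS s t : s \in `[0, T] -> t \in `[0, T] -> s <= t -> FF s `<=` FF t.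
Proof. by case: FF_filtration => _ _; apply. Qed.
Let iX t i : t \in `[0, T] -> P.-integrable setT (fun w => (X t w ord0 i)%:E).
Proof. by case: X_mart => _ + _; apply. Qed.
Let mX t i : t \in `[0, T] -> measurable_fun setT (fun w => X t w ord0 i).
Proof. by move=> tT; apply/measurable_EFinP; exact: measurable_int (iX i tT). Qed.
Let itv0 : 0 \in `[0, T]. Proof. by rewrite in_itv/= T_ge0 lexx. Qed.
Let itvT : T \in `[0, T]. Proof. by rewrite in_itv/= T_ge0 lexx. Qed.

Lemma dsup_Lnorm_lty : (Lnorm P p (dsup T X) < +oo)%E.
Proof.
apply: le_lt_trans (doob T_ge0 FF_filtration X_mart p_gt1) _.
by rewrite lte_mul_pinfty// lee_fin; case: (p) p_gt1 => //= r; rewrite lte_fin => r1;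
  rewrite divr_ge0//; lra.
Qed.

Let mdsup : measurable_fun setT (dsup T X).
Proof. by apply: measurable_dsup => // t i; exact: mX. Qed.

Let idsup : P.-integrable setT (dsup T X).
Proof.
apply: (Lnorm_integrable p_gt1) => //; last exact: dsup_Lnorm_lty.
by move=> w; exact: dsup_ge0.
Qed.

(** The conditions under which a path has one-sided limits along dyadic times. *)
Definition regular_at w : Prop :=
  (dsup T X w < +oo)%E /\ forall i, tame T (fun t => X t w ord0 i).

(** Doob's inequality bounds the paths; for each rational interval and coordinate,
Fatou's lemma and [upcrossing_expectation] give a finite lower limit of the
numbers of upcrossings as the grid is refined. *)
Lemma regular_ae : {ae P, forall w, regular_at w}.
Proof.
have ae1 : {ae P, forall w, (dsup T X w < +oo)%E}.
  by apply: (Lnorm_lty_ae p_gt1) dsup_Lnorm_lty => // w; exact: dsup_ge0.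
suff ae2 : {ae P, forall w i, tame T (fun t => X t w ord0 i)}.
  by apply: filterS2 ae1 ae2.
apply: filter_forall => i.
pose u (ab : rat * rat) m w : R := (up_cnt (ratr ab.1) (ratr ab.2)
  (fun j => X (dya T m j) w ord0 i) (2 ^ m))%:R.
have aeab ab : {ae P, forall w, ab.1 < ab.2 ->
    (limn_einf (fun m => (u ab m w)%:E) < +oo)%E}.
  have [ab12|] := boolP (ab.1 < ab.2); last by move=> _; exact: nearW.
  have rab : ratr ab.1 < ratr ab.2 :> R by rewrite ltr_rat.
  have mu m : measurable_fun setT (fun w => (u ab m w)%:E).
    by apply/measurable_EFinP; exact: (measurable_up_cnt T_ge0 FF_filtration X_mart).
  have u0 m w : (0 <= (u ab m w)%:E)%E by rewrite lee_fin.
  pose c := (((ratr ab.2 - ratr ab.1)^-1)%:E * \int[P]_w `|X T w ord0 i - ratr ab.1|%:E)%E.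
  have uc m : (\int[P]_w (u ab m w)%:E <= c)%E.
    rewrite /c lee_pdivlMl ?subr_gt0//.
    exact: (upcrossing_expectation T_ge0 FF_filtration X_mart i rab m).
  have ul0 w : (0 <= limn_einf (fun m => (u ab m w)%:E))%E by exact: limn_einf_ge0.
  have ilim : P.-integrable setT (fun w => limn_einf (fun m => (u ab m w)%:E)).
    apply/integrableP; split; first exact: measurable_limn_einf.
    under eq_integral do rewrite gee0_abs//.
    apply: (@le_lt_trans _ _ c).
      by apply: (le_trans (fatou _ _ _ _)) => //; exact: limn_einf_le_cst.
    have ia : P.-integrable setT (EFin \o cst (ratr ab.1)).
      exact: finite_measure_integrable_cst.
    have iabs := integrable_abse (integrableB measurableT (iX i itvT) ia).
    rewrite /c lte_mul_pinfty//; first by rewrite lee_fin invr_ge0 subr_ge0 ltW.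
    exact: (integrable_lty measurableT iabs).
  have := integrable_ae measurableT ilim; apply: filterS => w /(_ I).
  by rewrite fin_numE => /andP[_]; rewrite ltey.
apply: filterS (ae_forall_countable aeab) => w hw a b ab.
have [K hK] := limn_einf_lty_bounded (hw (a, b) ab).
by exists K.
Qed.

(** Setting the irregular paths to 0 makes every path RCLL. It preserves
adaptedness, as null events belong to the sigma-algebra at time 0. *)
Definition regularize : process R Omega n := fun t w =>
  if `[< regular_at w >] then \row_i rlim T (fun s => X s w ord0 i) t else 0.

Let N := regularize.

Let null_irregular t : t \in `[0, T] -> FF t [set w | ~ regular_at w].
Proof.
move=> tT; apply: (FFS itv0 tT).
  by move: tT; rewrite in_itv/= => /andP[].
case: FF_usual => _; apply; exact: regular_ae.
Qed.

Let FF_regular t : t \in `[0, T] -> FF t [set w | regular_at w].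
Proof.
move=> tT; have := null_irregular tT; rewrite -(measurable_g_measurableTypeE (sFF tT)).
by move=> /measurableC; congr (_ _); apply/seteqP; split => w /=; [move/contrapT|move=> ? ?].
Qed.

Let regular_cvg w i : regular_at w ->
  (forall t, 0 <= t -> t < T -> cvg (X q w ord0 i @[q --> within (dyadic T) (t^'+)])) /\
  (forall t, 0 < t -> t <= T -> cvg (X q w ord0 i @[q --> within (dyadic T) (t^'-)])).
Proof.
move=> [doo /(_ i) tamei].
have bnd q : dyadic T q -> `|X q w ord0 i| <= fine (dsup T X w).
  move=> [m [j ->]]; rewrite -lee_fin fineK; last first.
    by rewrite ge0_fin_numE// dsup_ge0.
  apply: le_trans (dsup_ge T X w m j); rewrite lee_fin; exact: enorm_coord.
by split => t t0 tT; [exact: tame_cvg_right bnd _ _|exact: tame_cvg_left bnd _ _].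
Qed.

Lemma regularize_rcll : rcll T N.
Proof.
move=> w; rewrite /N /regularize; have [rw|nrw] := pselect (regular_at w); last first.
  under eq_fun do rewrite asboolF//.
  split => t _; first by rewrite asboolF//; exact: cvg_cst.
  exact: is_cvg_cst.
under eq_fun do rewrite asboolT//.
split => t tT.
  rewrite asboolT//; apply: cvg_rV => i; rewrite mxE; under eq_fun do rewrite mxE.
  by apply: rlim_right_continuous => //; exact: (regular_cvg i rw).1.
apply: is_cvg_rV => i; under eq_fun do rewrite mxE.
apply: rlim_left_limit => //; first exact: (regular_cvg i rw).1.
exact: (regular_cvg i rw).2.
Qed.

Lemma regularize_end : {ae P, forall w, N T w = X T w}.
Proof.
apply: filterS regular_ae => w rw; rewrite /N /regularize asboolT//.
by apply/rowP => i; rewrite mxE /rlim ltxx.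
Qed.

(* values of X at dyadic times decreasing to t, set to 0 on irregular paths *)
Let h t i k w : R := \1_[set w | regular_at w] w * X (after T t k) w ord0 i.

Let h_cvg t i w : 0 <= t -> t < T -> h t i k w @[k --> \oo] --> N t w ord0 i.
Proof.
move=> t0 tT; rewrite /h /N /regularize indicE.
have [rw|nrw] := pselect (regular_at w).
  rewrite asboolT// mxE mem_set//; under eq_fun do rewrite mul1r.
  by apply: rlim_after => //; exact: (regular_cvg i rw).1.
rewrite asboolF// memNset// mxE; under eq_fun do rewrite mul0r.
exact: cvg_cst.
Qed.

Let h_dsup t i k w : `|h t i k w| <= \1_[set w | regular_at w] w * fine (dsup T X w).
Proof.
rewrite /h indicE normrM; have [rw|nrw] := pselect (regular_at w); last first.
  by rewrite memNset// normr0 !mul0r.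
rewrite mem_set// normr1 !mul1r.
have [m [j ->]] := dyadic_after T t k.
rewrite -lee_fin fineK; last by rewrite ge0_fin_numE ?dsup_ge0//; exact: rw.1.
apply: le_trans (dsup_ge T X w m j); rewrite lee_fin; exact: enorm_coord.
Qed.

Let after_itvT t k : after T t k \in `[0, T].
Proof. exact/dyadic_itv/dyadic_after. Qed.

(** At [t < T] the value is a limit of values of [X] at dyadic times decreasing to
[t]. It is thus measurable at every time [s > t], hence at [t] by
right-continuity of the filtration. *)
Lemma regularize_adapted : adapted T FF N.
Proof.
move=> t tT i; move: (tT); rewrite in_itv/= => /andP[t0].
have hm s k : s \in `[0, T] -> after T t k <= s -> measurable_wrt (FF s) (h t i k).
  move=> sT ts; apply: measurable_wrtM; first exact: sFF.
    by apply: measurable_wrt_indic; [exact: sFF|exact: FF_regular].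
  apply: (@measurable_wrtS _ _ _ (FF (after T t k))); first exact: FFS.
  by case: X_mart => + _ _; apply.
rewrite le_eqVlt => /predU1P[->|tT1].
  rewrite (_ : (fun _ => _) = fun w => \1_[set w | regular_at w] w * X T w ord0 i).
    apply: measurable_wrtM; first exact: sFF.
      by apply: measurable_wrt_indic; [exact: sFF|exact: FF_regular].
    by case: X_mart => + _ _; apply.
  apply/funext => w; rewrite /N /regularize indicE.
  have [rw|nrw] := pselect (regular_at w).
    by rewrite asboolT// mxE mem_set// mul1r /rlim ltxx.
  by rewrite asboolF// memNset// mxE mul0r.
move=> B mB; case: FF_usual => rc _; apply: rc; first by rewrite in_itv/= t0.
move=> s /=; rewrite in_itv/= => /andP[ts sT].
have sT' : s \in `[0, T] by rewrite in_itv/= sT (le_trans t0)// ltW.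
have st0 : 0 < s - t by rewrite subr_gt0.
have [k0 hk0] := inv_pow2_lt T_ge0 st0.
suff : measurable_wrt (FF s) (fun w => N t w ord0 i) by apply.
apply: (@measurable_wrt_cvg _ _ _ _ (sFF sT') (fun k => h t i (k + k0)%N)).
  move=> k; apply: hm => //.
  have := hk0 (k + k0)%N (leq_addl _ _).
  by have /andP[_] := after_itv (k + k0)%N t0 tT1; lra.
by move=> w; have := @h_cvg t i w t0 tT1; rewrite -(cvg_shiftn k0).
Qed.

Local Open Scope ereal_scope.

(** At the dyadic times after [t] the integral of [X] over an event known at [t] is
that of [X_T]. Let these times decrease to [t], with [dsup T X] as dominating
function, which is integrable by Doob's inequality. *)
Lemma regularize_cond_exp t i : t \in `[0%R, T] ->
  is_cond_exp P (FF t) (fun w => X T w ord0 i) (fun w => N t w ord0 i).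
Proof.
move=> tT; have aN := regularize_adapted tT i.
have mN := measurable_wrt_fun (FFm tT) aN.
move: (tT); rewrite in_itv/= => /andP[t0].
rewrite le_eqVlt => /predU1P[tE|tT1].
  have NX : ae_eq P setT (fun w => (X T w ord0 i)%:E) (fun w => (N t w ord0 i)%:E).
    by apply: filterS regularize_end => w NX _; rewrite tE NX.
  have iN : P.-integrable setT (fun w => (N t w ord0 i)%:E).
    apply: eq_ae_integrable (iX i itvT); first exact/measurable_EFinP.
    by apply: filterS NX => w + ; move=> /(_ I).
  split => // A FA; have mA := FFm tT FA.
  apply/esym; apply: ae_eq_integral => //.
  - by apply: measurable_funTS; apply/measurable_EFinP; exact: mX.
  - by apply: measurable_funTS; apply/measurable_EFinP.
  - by apply: filterS NX => w + _; exact.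
have mh k : measurable_fun setT (h t i k).
  apply: measurable_funM; last exact: mX.
  by apply: measurable_indic; exact: (FFm itv0 (FF_regular itv0)).
have DC A : measurable A -> P.-integrable A (fun w => (N t w ord0 i)%:E) /\
    \int[P]_(w in A) (h t i k w)%:E @[k --> \oo] --> \int[P]_(w in A) (N t w ord0 i)%:E.
  move=> mA.
  have [] // := @dominated_convergence _ _ _ P A mA (fun k w => (h t i k w)%:E)
    (fun w => (N t w ord0 i)%:E) (dsup T X).
  - by move=> k; apply: measurable_funTS; exact/measurable_EFinP.
  - by apply: measurable_funTS; exact/measurable_EFinP.
  - apply: nearW => w _; apply: cvg_EFin; first exact: nearW.
    exact: h_cvg.
  - exact: integrableS idsup.
  - apply: filterS regular_ae => w rw k _; rewrite abse_EFin.
    have := h_dsup t i k w; rewrite -lee_fin => /le_trans; apply.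
    rewrite indicE mem_set// mul1r fineK// ge0_fin_numE ?dsup_ge0//; exact: rw.1.
split => //; first exact: (DC _ measurableT).1.
move=> A FA; have mA := FFm tT FA.
have [_] := DC A mA => /cvg_unique; apply => //.
apply: cvg_near_cst; apply: nearW => k.
have q0 : (t <= after T t k)%R by have /andP[/ltW] := after_itv k t0 tT1.
have FqA : FF (after T t k) A by exact: FFS FA.
transitivity (\int[P]_(w in A) (X (after T t k) w ord0 i)%:E).
  apply: ae_eq_integral => //.
  - by apply: measurable_funTS; exact/measurable_EFinP.
  - by apply: measurable_funTS; apply/measurable_EFinP; exact: mX.
  - apply: filterS regular_ae => w rw _; rewrite /h indicE mem_set// mul1r//.
case: X_mart => _ _ /(_ (after T t k) T i (after_itvT _ _) itvT).
have qT : (after T t k <= T)%R by have := after_itvT t k; rewrite in_itv/= => /andP[].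
by move=> /(_ qT)[_ _ /(_ _ FqA)].
Qed.

Lemma regularize_martingale : martingale P T FF N.
Proof.
split; first exact: regularize_adapted.
  by move=> t i tT; case: (regularize_cond_exp i tT).
move=> s t i sT tT st.
have [Gs is_ Es] := regularize_cond_exp i sT.
have [_ _ Et] := regularize_cond_exp i tT.
split; [exact: Gs|exact: is_|move=> A FA].
rewrite (Es A FA) (Et A)//; exact: (FFS sT tT st FA).
Qed.

End regularization.

(** * The spaces of RCLL processes *)

Section processes.
Context (R : realType) (d : measure_display) (Omega : measurableType d).
Context (P : probability Omega R) (T : R) (FF : R -> set (set Omega)) (n : nat).
Hypothesis T_ge0 : 0 <= T.
Hypothesis FF_filtration : is_filtration T FF.
Implicit Types X Y Z : process R Omega n.

Let sFF t : t \in `[0, T] -> sigma_algebra setT (FF t).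
Proof. by case: FF_filtration => + _ _; apply. Qed.
Let FFm t : t \in `[0, T] -> FF t `<=` measurable.
Proof. by case: FF_filtration => _ + _; apply. Qed.
Let FFS s t : s \in `[0, T] -> t \in `[0, T] -> s <= t -> FF s `<=` FF t.
Proof. by case: FF_filtration => _ _; apply. Qed.

Lemma itv0T : 0 \in `[0, T]. Proof. by rewrite in_itv/= T_ge0 lexx. Qed.
Lemma itvTT : T \in `[0, T]. Proof. by rewrite in_itv/= T_ge0 lexx. Qed.

Lemma sup_norm_ge Y t w : t \in `[0, T] -> ((enorm (Y t w))%:E <= sup_norm T Y w)%E.
Proof. by move=> tT; apply: ereal_sup_ubound; exists t. Qed.

Lemma sup_norm_le Y w c : (forall t, t \in `[0, T] -> ((enorm (Y t w))%:E <= c)%E) ->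
  (sup_norm T Y w <= c)%E.
Proof. by move=> h; apply: ge_ereal_sup => _ [t tT <-]; exact: h. Qed.

Lemma sup_norm_ge0 Y w : (0 <= sup_norm T Y w)%E.
Proof.
by apply: le_trans (sup_norm_ge Y w itv0T); rewrite lee_fin enorm_ge0.
Qed.

(** By right-continuity dyadic times suffice; in particular the supremum over
[0, T] is measurable. *)
Lemma sup_norm_dsup Y w : rcll T Y -> sup_norm T Y w = dsup T Y w.
Proof.
move=> rY; apply/eqP; rewrite eq_le; apply/andP; split; last first.
  by apply: dsup_le => m i; apply: sup_norm_ge; exact: dya_itv.
apply: sup_norm_le => t; rewrite in_itv/= => /andP[t0].
rewrite le_eqVlt => /predU1P[->|tT].
  by have := dsup_ge T Y w 0 (2 ^ 0)%N; rewrite dya_end.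
have rt : Y s w @[s --> t^'+] --> Y t w by apply: (rY w).1; rewrite in_itv/= t0.
have c1 : Y (after T t m) w @[m --> \oo] --> Y t w.
  apply: (cvg_comp _ _ _ rt) => A HA.
  by apply: (after_cvg T_ge0 t0 tT); apply: filterS HA => q h _.
have c2 : (enorm (Y (after T t m) w))%:E @[m --> \oo] --> (enorm (Y t w))%:E.
  apply: cvg_EFin; first exact: nearW.
  exact: (cvg_comp _ _ c1 (@continuous_enorm R n (Y t w))).
apply: (cvge_to_le c2); apply: nearW => m.
have [k [j ->]] := dyadic_after T t m; exact: dsup_ge.
Qed.

Definition cadlag Y := rcll T Y /\ adapted T FF Y.

Lemma adapted_measurable Y t i : adapted T FF Y -> t \in `[0, T] ->
  measurable_fun setT (fun w => Y t w ord0 i).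
Proof. by move=> aY tT; exact: measurable_wrt_fun (FFm tT) (aY t tT i). Qed.

Lemma measurable_sup_norm Y : cadlag Y -> measurable_fun setT (sup_norm T Y).
Proof.
move=> [rY aY]; rewrite (_ : sup_norm T Y = dsup T Y); last first.
  by apply/funext => w; exact: sup_norm_dsup.
by apply: measurable_dsup => // t i; exact: adapted_measurable.
Qed.

Lemma cadlagB X Y : cadlag X -> cadlag Y -> cadlag (fun t w => X t w - Y t w).
Proof.
move=> [rX aX] [rY aY]; split.
  move=> w; split=> t tT.
    by apply: cvgB; [exact: (rX w).1|exact: (rY w).1].
  by apply: is_cvgB; [exact: (rX w).2|exact: (rY w).2].
move=> t tT i; rewrite (_ : (fun _ => _) = fun w => X t w ord0 i - Y t w ord0 i).
  by apply: measurable_wrtB; [exact: sFF|exact: aX|exact: aY].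
by apply/funext => w; rewrite !mxE.
Qed.

Lemma cadlag_cst (Z : Omega -> 'rV[R]_n) : vmeasurable_wrt (FF 0) Z ->
  cadlag (fun _ w => Z w).
Proof.
move=> mZ; split; first by move=> w; split=> t _; [exact: cvg_cst|exact: is_cvg_cst].
move=> t tT i; apply: measurable_wrtS (mZ i); apply: FFS => //; first exact: itv0T.
by move: tT; rewrite in_itv/= => /andP[].
Qed.

Lemma cadlag0 X : cadlag X -> cadlag (fun _ w => X 0 w).
Proof. by move=> [_ aX]; apply: cadlag_cst; exact/aX/itv0T. Qed.

Variable p : \bar R.
Hypothesis p_gt1 : (1 < p)%E.

Local Notation norm := (Sp_norm P T p).

Lemma Sp_cadlag Y : Sp P T FF p Y -> cadlag Y. Proof. by case. Qed.

Lemma Sp_norm_ge0 Y : (0 <= norm Y)%E. Proof. exact: Lnorm_ge0. Qed.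

Lemma Sp_norm_leD X Y Z : cadlag X -> cadlag Y -> cadlag Z ->
  {ae P, forall w, forall t, t \in `[0, T] ->
    enorm (Z t w) <= enorm (X t w) + enorm (Y t w)} ->
  (norm Z <= norm X + norm Y)%E.
Proof.
move=> cX cY cZ h.
have mX := measurable_sup_norm cX; have mY := measurable_sup_norm cY.
have mZ := measurable_sup_norm cZ.
apply: (@le_trans _ _ (Lnorm P p (sup_norm T X \+ sup_norm T Y)%E)); last first.
  exact: (LnormD_nonneg P p_gt1 mX mY (sup_norm_ge0 X) (sup_norm_ge0 Y)).
apply: (Lnorm_le_ae p_gt1) => //; first exact: emeasurable_funD.
- exact: sup_norm_ge0.
- by move=> w; rewrite adde_ge0// sup_norm_ge0.
- apply: filterS h => w hw; apply: sup_norm_le => t tT.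
  apply: (@le_trans _ _ ((enorm (X t w))%:E + (enorm (Y t w))%:E)%E).
    by rewrite -EFinD lee_fin hw.
  by rewrite leeD// sup_norm_ge.
Qed.

Lemma Sp_norm_le X Z : cadlag X -> cadlag Z ->
  {ae P, forall w, forall t, t \in `[0, T] -> enorm (Z t w) <= enorm (X t w)} ->
  (norm Z <= norm X)%E.
Proof.
move=> cX cZ h; apply: (Lnorm_le_ae p_gt1).
- exact: measurable_sup_norm.
- exact: measurable_sup_norm.
- exact: sup_norm_ge0.
- exact: sup_norm_ge0.
apply: filterS h => w hw; apply: sup_norm_le => t tT.
by apply: le_trans (sup_norm_ge X w tT); rewrite lee_fin hw.
Qed.

Lemma SpB X Y : Sp P T FF p X -> Sp P T FF p Y ->
  Sp P T FF p (fun t w => X t w - Y t w).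
Proof.
move=> sX sY; have cX := Sp_cadlag sX; have cY := Sp_cadlag sY.
have [? ?] := cadlagB cX cY; split => //.
apply: (@le_lt_trans _ _ (norm X + norm Y)%E).
  by apply: Sp_norm_leD => //; apply: nearW => w t _; exact: enormB.
by case: sX => _ _ ?; case: sY => _ _ ?; rewrite lte_add_pinfty.
Qed.

Lemma Sp_initial X : Sp P T FF p X -> Sp P T FF p (fun _ w => X 0 w).
Proof.
move=> sX; have cX := Sp_cadlag sX; have c0 := cadlag0 cX.
have [? ?] := c0; split => //.
case: (sX) => _ _; apply: le_lt_trans; apply: Lnorm_le_ae => //.
- exact: measurable_sup_norm.
- exact: measurable_sup_norm.
- exact: sup_norm_ge0.
- exact: sup_norm_ge0.
- by apply: nearW => w; apply: sup_norm_le => t _; exact: sup_norm_ge itv0T.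
Qed.

Lemma Sp_norm_triangle X Y Z : cadlag X -> cadlag Y -> cadlag Z ->
  (norm (psub X Z) <= norm (psub X Y) + norm (psub Y Z))%E.
Proof.
move=> cX cY cZ; apply: Sp_norm_leD; [exact: cadlagB..|].
apply: nearW => w t _; rewrite /psub.
by rewrite (_ : X t w - Z t w = (X t w - Y t w) + (Y t w - Z t w)) ?enormD// addrA subrK.
Qed.

Lemma Sp_norm_sym X Y : norm (psub X Y) = norm (psub Y X).
Proof.
congr Lnorm; apply/funext => w; congr ereal_sup.
by apply/seteqP; split => _ [t tT <-]; exists t => //; rewrite enorm_distC.
Qed.

Lemma Sp_norm_eq0 X Y : cadlag X -> cadlag Y -> norm (psub X Y) = 0%E ->
  indist P T X Y.
Proof.
move=> cX cY /(Lnorm_eq0_ae p_gt1).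
move=> /(_ (measurable_sup_norm (cadlagB cX cY)) (sup_norm_ge0 _)).
apply: filterS => w h t tT; apply/eqP; rewrite -subr_eq0; apply/eqP.
apply: enorm_eq0; apply/le_anti; rewrite enorm_ge0 andbT.
by have := sup_norm_ge (psub X Y) w tT; rewrite h lee_fin.
Qed.

Lemma Sp_indist_trans X Y Z : indist P T X Y -> indist P T Y Z -> indist P T X Z.
Proof. by apply: filterS2 => w h1 h2 t tT; rewrite h1// h2. Qed.

Lemma Sp_indist_sym X Y : indist P T X Y -> indist P T Y X.
Proof. by apply: filterS => w h t tT; rewrite h. Qed.

End processes.

Section completeness.
Context (R : realType) (d : measure_display) (Omega : measurableType d).
Context (P : probability Omega R) (T : R) (FF : R -> set (set Omega)) (n : nat).
Hypothesis T_ge0 : 0 <= T.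
Hypothesis FF_filtration : is_filtration T FF.
Hypothesis FF_usual : usual_conditions P T FF.
Variable p : \bar R.
Hypothesis p_gt1 : (1 < p)%E.
Variable Y : nat -> process R Omega n.
Hypothesis SpY : forall m, Sp P T FF p (Y m).
Local Open Scope ereal_scope.

Let D m w := sup_norm T (psub (Y m.+1) (Y m)) w.

Hypothesis summable : \sum_(0 <= m <oo) Sp_norm P T p (psub (Y m.+1) (Y m)) < +oo.

Let cY m : cadlag T FF (Y m). Proof. exact: Sp_cadlag (SpY m). Qed.
Let cD m : cadlag T FF (psub (Y m.+1) (Y m)). Proof. exact: cadlagB. Qed.
Let mD m : measurable_fun setT (D m). Proof. exact: measurable_sup_norm (cD m). Qed.
Let D0 m w : 0 <= D m w. Proof. exact: sup_norm_ge0. Qed.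

(** A bound, uniform in time, for the distance between [Y m] and the later terms
of the sequence. *)
Definition Sp_tail m w := \sum_(m <= j <oo) D j w.

Lemma Lnorm_Sp_tail m : Lnorm P p (Sp_tail m) <=
  \sum_(m <= j <oo) Sp_norm P T p (psub (Y j.+1) (Y j)).
Proof.
rewrite -nneseries_addn; last by move=> j; exact: Sp_norm_ge0.
rewrite (_ : Sp_tail m = fun w => \sum_(0 <= j <oo) D (j + m)%N w).
  by apply: Lnorm_series => // j w; exact: D0.
by apply/funext => w; rewrite /Sp_tail -nneseries_addn// => j; exact: D0.
Qed.

Lemma measurable_Sp_tail m : measurable_fun setT (Sp_tail m).
Proof.
apply: (emeasurable_fun_cvg (fun k w => \sum_(m <= j < k) D j w)).
  by move=> k; exact: emeasurable_sum.
by move=> w _; apply: is_cvg_nneseries => j _ _; exact: D0.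
Qed.

Lemma Sp_tail_ge0 m w : 0 <= Sp_tail m w.
Proof. by apply: nneseries_ge0 => j _ _; exact: D0. Qed.

Let A := [set w | Sp_tail 0 w < +oo].

Let A_ae : {ae P, forall w, A w}.
Proof.
have S0 := le_lt_trans (Lnorm_Sp_tail 0) summable.
exact: (Lnorm_lty_ae p_gt1 (measurable_Sp_tail 0) (Sp_tail_ge0 0) S0).
Qed.

Let FA t : t \in `[0%R, T] -> FF t A.
Proof.
move=> tT; have sFt : sigma_algebra setT (FF t) by case: FF_filtration => + _ _; apply.
have : FF t (~` A).
  case: FF_filtration => _ _ /(_ 0%R t (itv0T T_ge0) tT).
  have t0 : (0 <= t)%R by move: tT; rewrite in_itv/= => /andP[].
  by move=> /(_ t0); apply; case: FF_usual => _; apply; exact: A_ae.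
rewrite -(measurable_g_measurableTypeE sFt) => /measurableC.
by rewrite setCK.
Qed.

Let tail_cvg w : A w -> Sp_tail m w @[m --> \oo] --> 0.
Proof. by move=> Aw; apply: nneseries_tail_cvg => // j _; exact: D0. Qed.

Lemma Sp_tail_dist m k t w : t \in `[0%R, T] -> (m <= k)%N ->
  (enorm (Y k t w - Y m t w))%:E <= Sp_tail m w.
Proof.
move=> tT mk; apply: (@le_trans _ _ (\sum_(m <= j < k) D j w)); last first.
  by apply: nneseries_lim_ge => j _ _; exact: D0.
elim: k mk => [|k IH].
  by rewrite leqn0 => /eqP ->; rewrite subrr enorm0 big_nil.
rewrite leq_eqVlt => /predU1P[->|]; first by rewrite subrr enorm0 big_geq.
rewrite ltnS => mk; rewrite big_nat_recr//=.
rewrite (_ : Y k.+1 t w - Y m t w = (Y k t w - Y m t w) + (Y k.+1 t w - Y k t w))%R; last first.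
  by rewrite [RHS]addrC addrA subrK.
apply: (@le_trans _ _ ((enorm (Y k t w - Y m t w))%:E + (enorm (Y k.+1 t w - Y k t w))%:E)).
  by rewrite -EFinD lee_fin enormD.
by apply: leeD; [exact: IH|exact: (sup_norm_ge (psub (Y k.+1) (Y k)))].
Qed.

Definition Sp_limit : process R Omega n := fun t w =>
  if `[< A w >] then (\row_i lim (Y m t w ord0 i @[m --> \oo]))%R else 0%R.

Let tail_fine m w : A w -> Sp_tail m w \is a fin_num.
Proof.
move=> Aw; rewrite ge0_fin_numE ?Sp_tail_ge0//; apply: le_lt_trans Aw.
rewrite /Sp_tail (@nneseries_split _ (D ^~ w) 0 m); last by move=> j _; exact: D0.
by rewrite add0n leeDr// sume_ge0.
Qed.

Let tail_small w : A w -> forall e : R, (0 < e)%R ->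
  exists m0, forall m, (m0 <= m)%N -> Sp_tail m w <= e%:E.
Proof.
move=> Aw e e0; have /fine_cvgP[_ /cvgrPdist_le /(_ _ e0)[m0 _ h]] := tail_cvg Aw.
exists m0 => m m0m; have := h m m0m; rewrite /= sub0r normrN.
by rewrite -lee_fin => h'; rewrite -(fineK (tail_fine m Aw)) (le_trans _ h')// lee_fin ler_norm.
Qed.

Lemma Sp_limit_cvg w t : A w -> t \in `[0%R, T] -> Y m t w @[m --> \oo] --> Sp_limit t w.
Proof.
move=> Aw tT; rewrite /Sp_limit asboolT//; apply: cvg_rV => i; rewrite mxE.
apply: cauchy_cvg; apply: cauchy_exP => e e0.
have e2 : (0 < e / 2)%R by rewrite divr_gt0.
have [m0 hm0] := tail_small Aw e2; exists (Y m0 t w ord0 i).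
exists m0 => // m /= m0m; rewrite /ball/= distrC.
have h1 := Sp_tail_dist w tT m0m.
have := le_trans h1 (hm0 m0 (leqnn _)); rewrite lee_fin => h2.
have := enorm_coord (Y m t w - Y m0 t w) i; rewrite !mxE => h3.
by rewrite (le_lt_trans (le_trans h3 h2))//; lra.
Qed.

Lemma Sp_limit_dist w m t : A w -> t \in `[0%R, T] ->
  (enorm (Sp_limit t w - Y m t w))%:E <= Sp_tail m w.
Proof.
move=> Aw tT.
have c1 : (enorm (Y k t w - Y m t w))%:E @[k --> \oo] --> (enorm (Sp_limit t w - Y m t w))%:E.
  apply: cvg_EFin; first exact: nearW.
  apply: (cvg_comp (fun k => Y k t w - Y m t w)%R (@enorm R n)
    (G := nbhs (Sp_limit t w - Y m t w)%R)).
    by apply: cvgB; [exact: Sp_limit_cvg|exact: cvg_cst].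
  exact: continuous_enorm.
apply: (cvge_to_le c1); exists m => // k /= mk; exact: Sp_tail_dist.
Qed.

Let coord_dist w m t i : A w -> t \in `[0%R, T] ->
  (`|Y m t w ord0 i - Sp_limit t w ord0 i|)%:E <= Sp_tail m w.
Proof.
move=> Aw tT; apply: le_trans (Sp_limit_dist m Aw tT); rewrite lee_fin distrC.
by have := enorm_coord (Sp_limit t w - Y m t w) i; rewrite !mxE.
Qed.

(** On the event where the first tail is finite, convergence is uniform in time. *)
Lemma Sp_limit_rcll : rcll T Sp_limit.
Proof.
move=> w; have [Aw|nAw] := pselect (A w); last first.
  rewrite /Sp_limit; under eq_fun do rewrite asboolF//.
  split => t _; first by rewrite asboolF//; exact: cvg_cst.
  exact: is_cvg_cst.
split => t; rewrite in_itv/= => /andP[t0 tT].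
  apply: cvg_rV => i; apply/cvgrPdist_le => e e0.
  have e3 : (0 < e / 3)%R by rewrite divr_gt0.
  have [m0 /(_ m0 (leqnn _)) hm0] := tail_small Aw e3.
  have Yt : Y m0 s w ord0 i @[s --> t^'+] --> Y m0 t w ord0 i.
    by apply: cvg_rV_coord; case: (cY m0) => /(_ w)[+ _] _; apply; rewrite in_itv/= t0.
  have /cvgrPdist_le /(_ _ e3) near1 := Yt.
  near=> s.
  have sT : s \in `[0%R, T].
    rewrite in_itv/=; apply/andP; split; apply: ltW.
      by apply: (le_lt_trans t0); near: s; exact: nbhs_right_gt.
    by near: s; exact: nbhs_right_lt.
  have tT' : t \in `[0%R, T] by rewrite in_itv/= t0 ltW.
  have h1 : (`|Y m0 t w ord0 i - Y m0 s w ord0 i| <= e / 3)%R by near: s.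
  have h2 := le_trans (coord_dist m0 i Aw sT) hm0.
  have h3 := le_trans (coord_dist m0 i Aw tT') hm0.
  rewrite !lee_fin in h2 h3; move: h1 h2 h3; rewrite !ler_norml; lra.
apply: is_cvg_rV => i; apply: cvg_approx => e e0.
have [m0 /(_ m0 (leqnn _)) hm0] := tail_small Aw e0.
exists (fun s => Y m0 s w ord0 i).
  have : cvg (Y m0 s w @[s --> t^'-]).
    by case: (cY m0) => /(_ w)[_ +] _; apply; rewrite in_itv/= t0.
  by move=> /cvg_ex[l hl]; apply/cvg_ex; exists (l ord0 i); exact: cvg_rV_coord.
near=> s; have sT : s \in `[0%R, T].
  rewrite in_itv/=; apply/andP; split; apply: ltW.
    by near: s; exact: nbhs_left_gt.
  by apply: (@lt_le_trans _ _ t) => //; near: s; exact: nbhs_left_lt.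
by rewrite -lee_fin (le_trans (coord_dist m0 i Aw sT)).
Unshelve. all: by end_near. Qed.

Lemma Sp_limit_adapted : adapted T FF Sp_limit.
Proof.
move=> t tT i; have sFt : sigma_algebra setT (FF t) by case: FF_filtration => + _ _; apply.
apply: (@measurable_wrt_cvg _ _ _ _ sFt (fun m w => \1_A w * Y m t w ord0 i)%R).
  move=> m; apply: measurable_wrtM => //; first exact: measurable_wrt_indic (FA tT).
  by case: (cY m) => _; apply.
move=> w; have [Aw|nAw] := pselect (A w).
  under eq_fun do rewrite indicE mem_set// mul1r.
  by apply: cvg_rV_coord; exact: Sp_limit_cvg.
under eq_fun do rewrite indicE memNset// mul0r.
by rewrite /Sp_limit asboolF// mxE; exact: cvg_cst.
Qed.

Lemma Sp_limit_norm m : Sp_norm P T p (psub Sp_limit (Y m)) <=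
  \sum_(m <= j <oo) Sp_norm P T p (psub (Y j.+1) (Y j)).
Proof.
apply: le_trans (Lnorm_Sp_tail m); apply: (Lnorm_le_ae p_gt1) => //.
- apply: (measurable_sup_norm (FF := FF)) => //; apply: cadlagB => //.
  by split; [exact: Sp_limit_rcll|exact: Sp_limit_adapted].
- exact: measurable_Sp_tail.
- by move=> w; exact: sup_norm_ge0.
- by move=> w; exact: Sp_tail_ge0.
- by apply: filterS A_ae => w Aw; apply: sup_norm_le => t tT; exact: Sp_limit_dist.
Qed.

Lemma Sp_limit_Sp : Sp P T FF p Sp_limit.
Proof.
have cL : cadlag T FF Sp_limit by split; [exact: Sp_limit_rcll|exact: Sp_limit_adapted].
split; [exact: cL.1|exact: cL.2|].
apply: (@le_lt_trans _ _ (Sp_norm P T p (psub Sp_limit (Y 0%N)) + Sp_norm P T p (Y 0%N))).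
  apply: (Sp_norm_leD (FF := FF)) => //; first exact: cadlagB.
  apply: nearW => w t _; rewrite /psub.
  by have := enormD (Sp_limit t w - Y 0%N t w) (Y 0%N t w); rewrite subrK.
rewrite lte_add_pinfty//; first exact: le_lt_trans (Sp_limit_norm 0) summable.
by case: (SpY 0).
Qed.

Lemma Sp_limit_ae : {ae P, forall w, forall t, t \in `[0%R, T] ->
  Y m t w @[m --> \oo] --> Sp_limit t w}.
Proof. by apply: filterS A_ae => w Aw t tT; exact: Sp_limit_cvg. Qed.

End completeness.

(** * Martingales with finite maximal norm *)

Section martingales.
Context (R : realType) (d : measure_display) (Omega : measurableType d).
Context (P : probability Omega R) (T : R) (FF : R -> set (set Omega)) (n : nat).
Hypothesis T_ge0 : 0 <= T.
Hypothesis FF_filtration : is_filtration T FF.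
Implicit Types X Y N G : process R Omega n.

Let sFF t : t \in `[0, T] -> sigma_algebra setT (FF t).
Proof. by case: FF_filtration => + _ _; apply. Qed.
Let FFm t : t \in `[0, T] -> FF t `<=` measurable.
Proof. by case: FF_filtration => _ + _; apply. Qed.
Let FFS s t : s \in `[0, T] -> t \in `[0, T] -> s <= t -> FF s `<=` FF t.
Proof. by case: FF_filtration => _ _; apply. Qed.

Lemma is_cond_expB (A : set (set Omega)) (X X' m m' : Omega -> R) :
  sigma_algebra setT A -> A `<=` measurable ->
  P.-integrable setT (EFin \o X) -> P.-integrable setT (EFin \o X') ->
  is_cond_exp P A X m -> is_cond_exp P A X' m' ->
  is_cond_exp P A (fun w => X w - X' w) (fun w => m w - m' w).
Proof.
move=> sA Am iX iX' [Gm im Em] [Gm' im' Em']; split.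
- exact: measurable_wrtB.
- exact: (integrableB measurableT im im').
- move=> B AB; have mB := Am _ AB.
  have sub (f g : Omega -> R) : P.-integrable setT (EFin \o f) ->
      P.-integrable setT (EFin \o g) -> (\int[P]_(w in B) (f w - g w)%:E =
      \int[P]_(w in B) (f w)%:E - \int[P]_(w in B) (g w)%:E)%E.
    move=> fi gi; under eq_integral do rewrite EFinB.
    rewrite integralB//; [exact: (integrableS measurableT mB (@subsetT _ B) fi)|].
    exact: (integrableS measurableT mB (@subsetT _ B) gi).
  by rewrite !sub// Em// Em'.
Qed.

Lemma martingaleB X Y : martingale P T FF X -> martingale P T FF Y ->
  martingale P T FF (fun t w => X t w - Y t w).
Proof.
move=> [aX iX cX] [aY iY cY].
have coordB t i : (fun w => (X t w - Y t w) ord0 i) = (fun w => X t w ord0 i - Y t w ord0 i).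
  by apply/funext => w; rewrite !mxE.
split.
- by move=> t tT i; rewrite coordB; apply: measurable_wrtB; [exact: sFF|exact: aX|exact: aY].
- move=> t i tT.
  have := integrableB measurableT (iX t i tT) (iY t i tT).
  by apply: eq_integrable => // w _; rewrite !mxE EFinB.
- move=> s t i sT tT st; rewrite !coordB.
  by apply: is_cond_expB; [exact: sFF|exact: FFm|exact: iX|exact: iY|exact: cX|exact: cY].
Qed.

Lemma martingale_cst (Z : Omega -> 'rV[R]_n) : vmeasurable_wrt (FF 0) Z ->
  (forall i, P.-integrable setT (fun w => (Z w ord0 i)%:E)) ->
  martingale P T FF (fun _ w => Z w).
Proof.
move=> mZ iZ.
have aZ : adapted T FF (fun _ w => Z w).
  by have [] := cadlag_cst T_ge0 FF_filtration mZ.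
split; [exact: aZ|by move=> t i _; exact: iZ|move=> s t i sT tT st].
by split; [exact: aZ|exact: iZ|].
Qed.

Lemma martingale_initialB X : martingale P T FF X ->
  martingale P T FF (fun t w => X 0 w - X t w).
Proof.
move=> mX; have [aX iX _] := mX; apply: martingaleB => //.
by apply: martingale_cst => [|i]; [exact/aX/itv0T|exact/iX/itv0T].
Qed.

Variable p : \bar R.
Hypothesis p_gt1 : (1 < p)%E.

Lemma vLnorm_Sp_norm Y t : cadlag T FF Y -> t \in `[0, T] ->
  (vLnorm P p (Y t) <= Sp_norm P T p Y)%E.
Proof.
move=> cY tT; apply: (Lnorm_le_ae p_gt1).
- apply/measurable_EFinP/measurable_enorm => i.
  by apply: (adapted_measurable FF_filtration) => //; exact: cY.2.
- exact: (measurable_sup_norm T_ge0 FF_filtration cY).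
- by move=> w; rewrite lee_fin enorm_ge0.
- exact: sup_norm_ge0.
- by apply: nearW => w; exact: sup_norm_ge.
Qed.

Lemma doob_Sp N : rcll T N -> martingale P T FF N ->
  (Sp_norm P T p N <= (doob_cst p)%:E * vLnorm P p (N T))%E.
Proof.
move=> rN mN; rewrite /Sp_norm (_ : sup_norm T N = dsup T N).
  exact: (doob T_ge0 FF_filtration mN p_gt1).
by apply/funext => w; exact: sup_norm_dsup.
Qed.

Lemma vLnorm_ae (V V' : Omega -> 'rV[R]_n) :
  (forall i, measurable_fun setT (fun w => V w ord0 i)) ->
  (forall i, measurable_fun setT (fun w => V' w ord0 i)) ->
  {ae P, forall w, V w = V' w} -> vLnorm P p V = vLnorm P p V'.
Proof.
move=> mV mV' h; apply/eqP; rewrite eq_le; apply/andP; split.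
  apply: (Lnorm_le_ae p_gt1); try exact/measurable_EFinP/measurable_enorm;
    try by move=> w; rewrite lee_fin enorm_ge0.
  by apply: filterS h => w ->.
apply: (Lnorm_le_ae p_gt1); try exact/measurable_EFinP/measurable_enorm;
  try by move=> w; rewrite lee_fin enorm_ge0.
by apply: filterS h => w ->.
Qed.

Lemma vLnormD (V V' : Omega -> 'rV[R]_n) :
  (forall i, measurable_fun setT (fun w => V w ord0 i)) ->
  (forall i, measurable_fun setT (fun w => V' w ord0 i)) ->
  (vLnorm P p (fun w => V w + V' w)%R <= vLnorm P p V + vLnorm P p V')%E.
Proof.
move=> mV mV'.
have m1 := measurable_enorm mV; have m2 := measurable_enorm mV'.
have m3 : measurable_fun setT (fun w => enorm (V w + V' w)).
  apply: measurable_enorm => i; rewrite (_ : (fun _ => _) = fun w => V w ord0 i + V' w ord0 i).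
    exact: measurable_funD.
  by apply/funext => w; rewrite mxE.
apply: le_trans (LnormD_nonneg P p_gt1 _ _ _ _); try exact/measurable_EFinP;
  try by move=> w; rewrite lee_fin enorm_ge0.
apply: (Lnorm_le_ae p_gt1); try exact/measurable_EFinP;
  try by move=> w; rewrite lee_fin enorm_ge0.
- by apply: emeasurable_funD; exact/measurable_EFinP.
- by move=> w; rewrite /= -EFinD lee_fin addr_ge0 ?enorm_ge0.
- by apply: nearW => w; rewrite /= -EFinD lee_fin enormD.
Qed.

Lemma vLnorm_integrable (V : Omega -> 'rV[R]_n) i :
  (forall i, measurable_fun setT (fun w => V w ord0 i)) ->
  (vLnorm P p V < +oo)%E -> P.-integrable setT (fun w => (V w ord0 i)%:E).
Proof.
move=> mV Voo.
have iV : P.-integrable setT (EFin \o (fun w => enorm (V w))).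
  apply: (Lnorm_integrable p_gt1) => //.
    exact/measurable_EFinP/measurable_enorm.
  by move=> w; rewrite lee_fin enorm_ge0.
apply: (le_integrable_real (mV i) iV) => w.
by rewrite [leRHS]ger0_norm ?enorm_ge0// enorm_coord.
Qed.

Hypothesis FF_usual : usual_conditions P T FF.

(** At each time before [T] choose a version of the conditional expectation of
[V], at time [T] take [V] itself, and regularize the resulting martingale. *)
Lemma rcll_martingale_exists (V : Omega -> 'rV[R]_n) : Lp_wrt P p (FF T) V ->
  exists N, [/\ Sp P T FF p N, martingale P T FF N & {ae P, forall w, N T w = V w}].
Proof.
move=> [FV Voo].
have TT := itvTT T_ge0.
have mV i : measurable_fun setT (fun w => V w ord0 i).
  by have := measurable_wrt_fun (FFm TT) (FV i).
have iV i : P.-integrable setT (fun w => (V w ord0 i)%:E) by exact: vLnorm_integrable.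
have : forall ti : R * 'I_n, exists Z : Omega -> R, ti.1 \in `[0, T] ->
    is_cond_exp P (FF ti.1) (fun w => V w ord0 ti.2) Z /\
    (ti.1 = T -> Z = fun w => V w ord0 ti.2).
  move=> [t i] /=; have [tT|nT] := boolP (t \in `[0, T]); last by exists (fun=> 0).
  have [->|tnT] := eqVneq t T.
    by exists (fun w => V w ord0 i) => _; split; [split; [exact: FV|exact: iV|by []]|by []].
  have [Z hZ] := cond_exp_exists (sFF tT) (FFm tT) (iV i).
  by exists Z => _; split => // tE; rewrite tE eqxx in tnT.
move=> /choice[Z hZ].
pose X : process R Omega n := fun t w => \row_i Z (t, i) w.
have XE t i : (fun w => X t w ord0 i) = Z (t, i) by apply/funext => w; rewrite mxE.
have XT : X T = V.
  by apply/funext => w; apply/rowP => i; rewrite mxE ((hZ (T, i) TT).2 erefl).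
have mX : martingale P T FF X.
  split.
  - by move=> t tT i; rewrite XE; have [[]] := hZ (t, i) tT.
  - move=> t i tT; have [[_ + _] _] := hZ (t, i) tT.
    by apply: eq_integrable => // w _; rewrite mxE.
  - move=> s t i sT tT st; rewrite !XE.
    have [[a1 a2 a3] _] := hZ (s, i) sT; have [[b1 b2 b3] _] := hZ (t, i) tT.
    split; [exact: a1|exact: a2|move=> A FA].
    by rewrite (a3 A FA) (b3 A (FFS sT tT st FA)).
have XToo : (vLnorm P p (X T) < +oo)%E by rewrite XT.
pose N := regularize T X.
have mN : martingale P T FF N by exact: regularize_martingale p_gt1 mX XToo.
have rN : rcll T N by exact: regularize_rcll.
have NT : {ae P, forall w, N T w = V w}.
  by rewrite -XT; exact: regularize_end p_gt1 mX XToo.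
exists N; split => //; split => //; first by case: mN.
apply: (le_lt_trans (doob_Sp rN mN)).
rewrite (vLnorm_ae _ _ NT)//; last first.
  by move=> i; apply: (adapted_measurable FF_filtration) => //; case: mN.
rewrite lte_mul_pinfty// lee_fin; case: (p) p_gt1 => //= r; rewrite lte_fin => r1.
by rewrite divr_ge0//; lra.
Qed.

End martingales.

Section estimates.
Context (R : realType) (d : measure_display) (Omega : measurableType d).
Context (P : probability Omega R) (T : R) (FF : R -> set (set Omega)) (n : nat).
Hypothesis T_ge0 : 0 <= T.
Hypothesis FF_filtration : is_filtration T FF.
Implicit Types A B N G : process R Omega n.

Let sFF t : t \in `[0, T] -> sigma_algebra setT (FF t).
Proof. by case: FF_filtration => + _ _; apply. Qed.
Let FFm t : t \in `[0, T] -> FF t `<=` measurable.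
Proof. by case: FF_filtration => _ + _; apply. Qed.

Lemma vLnorm2_sqr (V : Omega -> 'rV[R]_n) :
  ((vLnorm P 2%:E V) `^ 2 = \int[P]_w (enorm (V w) ^+ 2)%:E)%E.
Proof.
rewrite poweR_Lnorm; last by rewrite pnatr_eq0.
apply: eq_integral => w _.
by rewrite gee0_abs ?lee_fin ?enorm_ge0// poweR_EFin powR_mulrn ?enorm_ge0.
Qed.

(** Pointwise, [|N_0 - N_T|^2 <= |N_T|^2 + 2 N_0.(N_0 - N_T)], and the last term has
mean zero since [N_0] is measurable at time 0. *)
Lemma martingale_L2_increment N : martingale P T FF N ->
  (vLnorm P 2%:E (N 0%R) < +oo)%E -> (vLnorm P 2%:E (N T) < +oo)%E ->
  (vLnorm P 2%:E (fun w => N 0%R w - N T w)%R <= vLnorm P 2%:E (N T))%E.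
Proof.
move=> mN N0oo NToo; have [aN iN cN] := mN.
have O := itv0T T_ge0; have TT := itvTT T_ge0.
have mNt t i : t \in `[0, T] -> measurable_fun setT (fun w => N t w ord0 i).
  by move=> tT; exact: (adapted_measurable FF_filtration i aN tT).
have isq t : t \in `[0, T] -> (vLnorm P 2%:E (N t) < +oo)%E ->
    P.-integrable setT (EFin \o (fun w => enorm (N t w) ^+ 2)).
  move=> tT Noo; apply/integrableP; split.
    apply/measurable_EFinP/measurable_funX/measurable_enorm => i; exact: mNt.
  rewrite (eq_integral (fun w => (enorm (N t w) ^+ 2)%:E)).
    by rewrite -vLnorm2_sqr poweR_lty.
  by move=> w _; rewrite /= ger0_norm// sqr_ge0.
have i0 := isq 0 O N0oo; have iT := isq T TT NToo.
have iprod t i : t \in `[0, T] -> (vLnorm P 2%:E (N t) < +oo)%E ->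
    P.-integrable setT (EFin \o (fun w => N 0 w ord0 i * N t w ord0 i)).
  move=> tT Noo; have iS := integrableD measurableT i0 (isq t tT Noo).
  apply: (le_integrable_real (g := fun w => enorm (N 0 w) ^+ 2 + enorm (N t w) ^+ 2)) => //.
    by apply: measurable_funM; exact: mNt.
  move=> w; rewrite normrM [leRHS]ger0_norm ?addr_ge0 ?sqr_ge0//.
  apply: (@le_trans _ _ (enorm (N 0 w) * enorm (N t w))).
    by apply: ler_pM => //; exact: enorm_coord.
  have := sqr_ge0 (enorm (N 0 w) - enorm (N t w)).
  have := sqr_ge0 (enorm (N 0 w) + enorm (N t w)); lra.
rewrite Lnorm_lee ?Lnorm_ge0//; last by move=> w; rewrite lee_fin enorm_ge0.
rewrite vLnorm2_sqr.
under eq_integral do rewrite poweR_EFin powR_mulrn ?enorm_ge0//.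
pose e i w : R := N 0 w ord0 i * N 0 w ord0 i - N 0 w ord0 i * N T w ord0 i.
have ie i : P.-integrable setT (EFin \o e i).
  exact: (integrableB measurableT (iprod 0 i O N0oo) (iprod T i TT NToo)).
have e0 i : (\int[P]_w (e i w)%:E = 0)%E.
  rewrite /e; under eq_integral do rewrite EFinB.
  rewrite integralB//; [|exact: iprod..].
  have T0 : 0 <= T by [].
  rewrite (cond_exp_pullout (sFF O) (FFm O) (iN T i TT) (cN 0 T i O TT T0) (aN 0 O i)
    (iprod T i TT NToo) (iprod 0 i O N0oo)).
  by apply: subee; apply: integrable_fin_num => //; exact: iprod.
apply: (@le_trans _ _ (\int[P]_w ((enorm (N T w) ^+ 2)%:E + \sum_(i < n) (2%:E * (e i w)%:E)))%E).
  apply: ge0_le_integral => //.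
  - by move=> w _; rewrite lee_fin sqr_ge0.
  - apply/measurable_EFinP/measurable_funX/measurable_enorm => i.
    rewrite (_ : (fun _ => _) = fun w => N 0 w ord0 i - N T w ord0 i).
      by apply: measurable_funB; exact: mNt.
    by apply/funext => w; rewrite !mxE.
  - apply: emeasurable_funD; first exact: measurable_int iT.
    apply: emeasurable_sum => i; apply: measurable_funeM; exact: measurable_int (ie i).
  - move=> w _; under eq_bigr do rewrite -EFinM.
    rewrite sumEFin -EFinD lee_fin !enorm_sqr -big_split/=; apply: ler_sum => i _.
    rewrite !mxE /e; have := sqr_ge0 (N 0 w ord0 i); nra.
have iS : P.-integrable setT (fun w => \sum_(i < n) (2%:E * (e i w)%:E))%E.
  by apply: integrable_sum => // i _; exact: (integrableZl measurableT 2 (ie i)).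
rewrite integralD//.
rewrite integral_sum//; last by move=> i; exact: (integrableZl measurableT 2 (ie i)).
rewrite big1 ?adde0// => i _.
by rewrite integralZl//; [rewrite e0 mule0|exact: ie].
Qed.

Variable p : \bar R.
Hypothesis p_gt1 : (1 < p)%E.

Lemma cp_gt0 : 0 < cp p.
Proof.
apply: (exponent_cases p_gt1) => [r -> r1|->]; rewrite /cp; last lra.
by case: ifP => _; [lra|rewrite divr_gt0//; lra].
Qed.

Lemma cp_lt1 : cp p < 1.
Proof.
apply: (exponent_cases p_gt1) => [r -> r1|->]; rewrite /cp; last lra.
by case: ifP => _; [lra|rewrite ltr_pdivrMr; lra].
Qed.

Lemma doob_cst_ge0 : 0 <= doob_cst p.
Proof.
move: p_gt1; case: p => [r||]//=; rewrite lte_fin => r1.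
by rewrite divr_ge0//; lra.
Qed.

Local Notation norm := (Sp_norm P T p).

(** The constants add up to [1 + 3 q = 1 / c_p], and to [1 + 2 + 2 = 5] for
[p = 2]; see the opening comment. *)
Lemma picard_estimate N G A B : Sp P T FF p N -> martingale P T FF N ->
  Sp P T FF p G -> {ae P, forall w, N T w = G T w} ->
  cadlag T FF A -> cadlag T FF B ->
  indist P T A (psub N G) -> indist P T B (fun t w => N 0 w - N t w) ->
  (norm A + norm B <= ((cp p)^-1)%:E * norm G)%E.
Proof.
move=> SN mN SG NG cA cB hA hB.
have cN := Sp_cadlag SN; have cG := Sp_cadlag SG; have TT := itvTT T_ge0.
have cN0 := cadlag0 T_ge0 FF_filtration cN.
have S0 := Sp_initial T_ge0 FF_filtration p_gt1 SN.
have NTG : (vLnorm P p (N T) <= norm G)%E.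
  have -> : vLnorm P p (N T) = vLnorm P p (G T).
    apply: (vLnorm_ae p_gt1) => // i; apply: (adapted_measurable FF_filtration) => //.
      exact: cN.2.
    exact: cG.2.
  exact: (vLnorm_Sp_norm P T_ge0 FF_filtration p_gt1 cG TT).
have q0 := doob_cst_ge0.
have NqG : (norm N <= (doob_cst p)%:E * norm G)%E.
  apply: le_trans (doob_Sp T_ge0 FF_filtration p_gt1 cN.1 mN) _.
  by apply: lee_wpmul2l; rewrite ?lee_fin.
have leA : (norm A <= norm N + norm G)%E.
  apply: (Sp_norm_leD T_ge0 FF_filtration p_gt1) => //.
  by apply: filterS hA => w h t tT; rewrite h// enormB.
have leB : (norm B <= norm N + norm N)%E.
  apply: (@le_trans _ _ (norm (fun _ w => N 0%R w) + norm N)%E).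
    apply: (Sp_norm_leD T_ge0 FF_filtration p_gt1) => //.
    by apply: filterS hB => w h t tT; rewrite h// enormB.
  rewrite leeD2r//; apply: (Lnorm_le_ae p_gt1);
    try exact: (measurable_sup_norm T_ge0 FF_filtration); try exact: sup_norm_ge0.
  by apply: nearW => w; apply: sup_norm_le => t _; exact: sup_norm_ge (itv0T T_ge0).
have leB2 : p = 2%:E -> (norm B <= 2%:E * norm G)%E.
  move=> p2; have cB' := cadlagB FF_filtration cN0 cN.
  apply: (@le_trans _ _ (norm (fun t w => N 0 w - N t w))).
    apply: (Sp_norm_le T_ge0 FF_filtration p_gt1) => //.
    by apply: filterS hB => w h t tT; rewrite h.
  have mB := martingale_initialB T_ge0 FF_filtration mN.
  apply: le_trans (doob_Sp T_ge0 FF_filtration p_gt1 cB'.1 mB) _.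
  have -> : doob_cst p = 2 by rewrite p2 /= (_ : 2 - 1 = 1 :> R) ?divr1//; lra.
  apply: lee_wpmul2l; first by rewrite lee_fin.
  apply: le_trans NTG; rewrite p2; apply: martingale_L2_increment => //; rewrite -p2.
    apply: le_lt_trans (vLnorm_Sp_norm P T_ge0 FF_filtration p_gt1 cN (itv0T T_ge0)) _.
    by case: SN.
  apply: le_lt_trans (vLnorm_Sp_norm P T_ge0 FF_filtration p_gt1 cN TT) _.
  by case: SN.
have gfin : norm G \is a fin_num.
  by rewrite ge0_fin_numE ?Sp_norm_ge0//; case: SG.
have nfin : norm N \is a fin_num.
  by rewrite ge0_fin_numE ?Sp_norm_ge0//; case: SN.
have afin : norm A \is a fin_num.
  rewrite ge0_fin_numE ?Sp_norm_ge0//; apply: le_lt_trans leA _.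
  by rewrite lte_add_pinfty// -ge0_fin_numE ?Sp_norm_ge0.
have bfin : norm B \is a fin_num.
  rewrite ge0_fin_numE ?Sp_norm_ge0//; apply: le_lt_trans leB _.
  by rewrite lte_add_pinfty// -ge0_fin_numE ?Sp_norm_ge0.
have g0 := Sp_norm_ge0 P T p G.
move: gfin nfin afin bfin g0 NqG leA leB leB2.
case: (norm G) => // g _; case: (norm N) => // m _; case: (norm A) => // a _.
case: (norm B) => // b _; rewrite -!EFinM -!EFinD !lee_fin => g0 mg ag bm b2.
move: p_gt1 mg b2 q0; rewrite /cp /doob_cst; case: p => [r||]//= r1 mg b2 q0; last first.
  by rewrite div1r invrK; lra.
rewrite lte_fin in r1; case: ifPn => [/eqP r2|r2].
  have {}b2 := b2 (congr1 EFin r2).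
  by move: mg; rewrite r2 div1r invrK (_ : 2 - 1 = 1 :> R) ?divr1; lra.
rewrite invf_div.
have -> : (4 * r - 1) / (r - 1) = 1 + 3 * (r / (r - 1)).
  by field; rewrite subr_eq0 gt_eqF.
set q := r / (r - 1) in mg q0 *; nra.
Qed.

End estimates.

(** * Picard iteration *)

Section limit_martingale.
Context (R : realType) (d : measure_display) (Omega : measurableType d).
Context (P : probability Omega R) (T : R) (FF : R -> set (set Omega)) (n : nat).
Hypothesis T_ge0 : 0 <= T.
Hypothesis FF_filtration : is_filtration T FF.
Hypothesis FF_usual : usual_conditions P T FF.
Variable p : \bar R.
Hypothesis p_gt1 : (1 < p)%E.
Variable M : nat -> process R Omega n.
Hypothesis SpM : forall m, Sp P T FF p (M m).
Hypothesis M_mart : forall m, martingale P T FF (M m).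
Hypothesis summable :
  (\sum_(0 <= m <oo) Sp_norm P T p (psub (M m.+1) (M m)) < +oo)%E.

(** Pass to the limit in the integrals over a fixed event; the whole sequence is
dominated by the maximum of its first term plus the first tail. *)
Lemma Sp_limit_martingale : martingale P T FF (Sp_limit T M).
Proof.
have SL := Sp_limit_Sp T_ge0 FF_filtration FF_usual p_gt1 SpM summable.
have [_ aL Loo] := SL; have cL := Sp_cadlag SL.
have FFm t : t \in `[0, T] -> FF t `<=` measurable by case: FF_filtration => _ + _; apply.
pose D m := psub (M m) (Sp_limit T M).
have cD m : cadlag T FF (D m) by apply: cadlagB => //; exact: Sp_cadlag (SpM m).
have iN (Y : process R Omega n) : Sp P T FF p Y -> P.-integrable setT (sup_norm T Y).
  move=> SY; have cY := Sp_cadlag SY; apply: (Lnorm_integrable p_gt1).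
  - exact: (measurable_sup_norm T_ge0 FF_filtration cY).
  - exact: sup_norm_ge0.
  - by case: SY.
have iY (Y : process R Omega n) t i : Sp P T FF p Y -> t \in `[0, T] ->
    P.-integrable setT (fun w => (Y t w ord0 i)%:E).
  move=> SY tT; have cY := Sp_cadlag SY; apply: (le_integrable measurableT _ _ (iN Y SY)).
    apply/measurable_EFinP; exact: (adapted_measurable FF_filtration _ cY.2 tT).
  move=> w _; rewrite [leRHS]gee0_abs ?sup_norm_ge0//.
  by apply: le_trans (sup_norm_ge Y w tT); rewrite lee_fin enorm_coord.
pose g := fun w => (sup_norm T (M 0%N) w + Sp_tail T M 0 w)%E.
have ig : P.-integrable setT g.
  apply: integrableD => //; first exact: iN.
  apply: (Lnorm_integrable p_gt1).
  - exact: (measurable_Sp_tail T_ge0 FF_filtration SpM).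
  - by move=> w; exact: Sp_tail_ge0.
  - exact: le_lt_trans (Lnorm_Sp_tail T_ge0 FF_filtration p_gt1 SpM 0) summable.
have lim A t i : measurable A -> t \in `[0, T] ->
    (\int[P]_(w in A) (M m t w ord0 i)%:E @[m --> \oo] -->
     \int[P]_(w in A) (Sp_limit T M t w ord0 i)%:E)%E.
  move=> mA tT.
  have [] // := @dominated_convergence _ _ _ P A mA (fun m w => (M m t w ord0 i)%:E)
    (fun w => (Sp_limit T M t w ord0 i)%:E) g.
  - move=> m; apply: measurable_funTS; apply/measurable_EFinP.
    by apply: (adapted_measurable FF_filtration _ _ tT); case: (Sp_cadlag (SpM m)).
  - apply: measurable_funTS; apply/measurable_EFinP.
    exact: (adapted_measurable FF_filtration _ aL tT).
  - have := Sp_limit_ae T_ge0 FF_filtration p_gt1 SpM summable.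
    apply: filterS => w h _; apply: cvg_EFin; first exact: nearW.
    by apply: cvg_rV_coord; exact: h.
  - exact: (integrableS measurableT mA (@subsetT _ _) ig).
  - apply: nearW => w m _; rewrite abse_EFin.
    apply: (@le_trans _ _ ((enorm (M 0%N t w))%:E + (enorm (M m t w - M 0%N t w))%:E)%E).
      rewrite -EFinD lee_fin (le_trans (enorm_coord _ _))//.
      by have := enormD (M 0%N t w) (M m t w - M 0%N t w); rewrite addrC subrK.
    by apply: leeD; [exact: sup_norm_ge|exact: Sp_tail_dist].
split => //; first by move=> t i tT; exact: iY.
move=> s t i sT tT st; split; [exact: aL|exact: iY|move=> A FA].
have mA := FFm _ sT _ FA.
apply: (cvg_unique _ (lim A s i mA sT)) => //.
have -> : (fun m => \int[P]_(w in A) (M m s w ord0 i)%:E)%E =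
    (fun m => \int[P]_(w in A) (M m t w ord0 i)%:E)%E.
  apply/funext => m; have [_ _ /(_ s t i sT tT st)[_ _ h]] := M_mart m.
  exact: h.
exact: lim.
Qed.

End limit_martingale.

Lemma contraction_eq0 (R : realType) (c : R) (y : \bar R) :
  (0 <= y)%E -> y \is a fin_num -> c < 1 -> (y <= c%:E * y)%E -> y = 0%E.
Proof.
case: y => // y; rewrite lee_fin => y0 _ c1; rewrite -EFinM lee_fin => h.
congr EFin; nra.
Qed.

Section picard.
Context (R : realType) (d : measure_display) (Omega : measurableType d).
Context (P : probability Omega R) (T : R) (FF : R -> set (set Omega)) (n : nat).
Context (p : \bar R) (xi : Omega -> 'rV[R]_n).
Variable F : process R Omega n -> process R Omega n -> process R Omega n.
Hypothesis T_ge0 : 0 <= T.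
Hypothesis FF_filtration : is_filtration T FF.
Hypothesis FF_usual : usual_conditions P T FF.
Hypothesis p_gt1 : (1 < p)%E.
Hypothesis xi_Lp : Lp_wrt P p (FF T) xi.
Hypothesis F_map : is_Sp_map P T FF p F.
Variables (k : nat) (C : R).
Hypothesis k_gt0 : (1 <= k)%N.
Hypothesis C_ge0 : 0 <= C.
Hypothesis C_lt : C < cp p.
Hypothesis F_lip : forall Y Y' M M' : process R Omega n,
  Sp P T FF p Y -> Sp P T FF p Y' -> Mp0 P T FF p M -> Mp0 P T FF p M' ->
  (Sp_norm P T p (psub (iterF F k Y M) (iterF F k Y' M')) <=
   C%:E * (Sp_norm P T p (psub Y Y') + Sp_norm P T p (psub M M')))%E.

Local Notation proc := (process R Omega n).
Local Notation norm := (Sp_norm P T p).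
Implicit Types x y : proc * proc.

Lemma Sp_norm_refl (X : proc) : norm (psub X X) = 0%E.
Proof.
rewrite /Sp_norm (_ : sup_norm _ _ = cst 0%E).
  by rewrite Lnorm0// gt_eqF// (lt_trans _ p_gt1)// lte01.
apply/funext => w; apply/eqP; rewrite eq_le sup_norm_ge0// andbT.
by apply: sup_norm_le => t _; rewrite /psub subrr enorm0.
Qed.

Let SpF Y M : Sp P T FF p Y -> Mp0 P T FF p M -> Sp0 P T FF p (F Y M).
Proof. by move: F_map => [h _]; exact: h. Qed.

Let F_indist Y Y' M : Sp P T FF p Y -> Sp P T FF p Y' -> Mp0 P T FF p M ->
  indist P T Y Y' -> indist P T (F Y M) (F Y' M).
Proof.
by move: F_map => [_ h] SY SY' SM YY'; apply: h => //; apply: nearW.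
Qed.

Lemma Sp_iterY Y M j : Sp P T FF p Y -> Mp0 P T FF p M -> Sp P T FF p (iterY F Y M j).
Proof.
move=> SY SM; elim: j => [//|j IH] /=.
apply: SpB => //; last by case: SM => [[]].
apply: SpB => //; first exact: Sp_initial.
by case: (SpF IH SM).
Qed.

Definition space x := Sp P T FF p x.1 /\ Mp0 P T FF p x.2.

Let Fk x := iterF F k x.1 x.2.

Lemma Sp0_Fk x : space x -> Sp0 P T FF p (Fk x).
Proof. by move=> [S1 S2]; apply: SpF => //; exact: Sp_iterY. Qed.

Definition dist x y : \bar R := (norm (psub x.1 y.1) + norm (psub x.2 y.2))%E.

(** The Picard map as a relation, up to indistinguishability: the martingale [N] is
only determined up to a null set, and solutions of the equation are then
related to themselves. *)
Definition picard x x' := exists N : proc,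
  [/\ Sp P T FF p N /\ martingale P T FF N,
      {ae P, forall w, N T w = xi w + Fk x T w},
      indist P T x'.1 (psub N (Fk x)) &
      indist P T x'.2 (fun t w => N 0 w - N t w)].

Let space_cadlag x : space x -> cadlag T FF x.1 /\ cadlag T FF x.2.
Proof.
by move=> [S1 [[S2 _] _]]; split; [exact: Sp_cadlag S1|exact: Sp_cadlag S2].
Qed.

Lemma dist_triangle x y z : space x -> space y -> space z ->
  (dist x z <= dist x y + dist y z)%E.
Proof.
move=> /space_cadlag[x1 x2] /space_cadlag[y1 y2] /space_cadlag[z1 z2].
rewrite /dist addeACA; apply: leeD;
  exact: (Sp_norm_triangle P T_ge0 FF_filtration p_gt1).
Qed.

Lemma dist_sym x y : dist x y = dist y x.
Proof. by rewrite /dist Sp_norm_sym; congr (_ + _)%E; exact: Sp_norm_sym. Qed.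

Lemma dist_ge0 x y : (0 <= dist x y)%E.
Proof. by rewrite adde_ge0// Sp_norm_ge0. Qed.

Lemma dist_fin x y : space x -> space y -> dist x y \is a fin_num.
Proof.
move=> [x1 [[x2 _] _]] [y1 [[y2 _] _]]; rewrite ge0_fin_numE ?dist_ge0//.
rewrite lte_add_pinfty//.
  by have [] := SpB T_ge0 FF_filtration p_gt1 x1 y1.
by have [] := SpB T_ge0 FF_filtration p_gt1 x2 y2.
Qed.

Lemma dist_eq0 x y : space x -> space y -> dist x y = 0%E ->
  indist P T x.1 y.1 /\ indist P T x.2 y.2.
Proof.
move=> /space_cadlag[x1 x2] /space_cadlag[y1 y2] /eqP.
rewrite padde_eq0 ?Sp_norm_ge0// => /andP[/eqP h1 /eqP h2].
by split; apply: (Sp_norm_eq0 T_ge0 FF_filtration p_gt1) => //.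
Qed.

Definition kappa := C / cp p.

Lemma kappa_ge0 : 0 <= kappa.
Proof. by rewrite divr_ge0// ltW// cp_gt0. Qed.

Lemma kappa_lt1 : kappa < 1.
Proof. by rewrite ltr_pdivrMr ?mul1r// cp_gt0. Qed.

Lemma picard_contraction x y x' y' : space x -> space y -> space x' -> space y' ->
  picard x x' -> picard y y' -> (dist x' y' <= kappa%:E * dist x y)%E.
Proof.
move=> sx sy sx' sy' [N [[SN mN] NT hA hB]] [N' [[SN' mN'] N'T hA' hB']].
have [Gx _] := Sp0_Fk sx; have [Gy _] := Sp0_Fk sy.
have [cx1 cx2] := space_cadlag sx'; have [cy1 cy2] := space_cadlag sy'.
apply: (@le_trans _ _ (((cp p)^-1)%:E * norm (psub (Fk x) (Fk y)))%E).
  apply: (@picard_estimate _ _ _ P T FF n T_ge0 FF_filtration p p_gt1 (psub N N')).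
  - exact: SpB.
  - exact: martingaleB.
  - exact: SpB.
  - by apply: filterS2 NT N'T => w h1 h2; rewrite /psub h1 h2 opprD addrACA subrr add0r.
  - exact: cadlagB.
  - exact: cadlagB.
  - apply: filterS2 hA hA' => w h1 h2 t tT.
    by rewrite /psub h1// h2// /psub; apply/rowP => i; rewrite !mxE; ring.
  - apply: filterS2 hB hB' => w h1 h2 t tT.
    by rewrite /psub h1// h2//; apply/rowP => i; rewrite !mxE; ring.
apply: (@le_trans _ _ (((cp p)^-1)%:E * (C%:E * dist x y))%E).
  apply: lee_wpmul2l; first by rewrite lee_fin invr_ge0 ltW// cp_gt0.
  by case: sx => ? ?; case: sy => ? ?; exact: F_lip.
by rewrite muleA -EFinM mulrC.
Qed.

Lemma picard_exists x : space x -> exists x', space x' /\ picard x x'.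
Proof.
move=> sx; have [SG G0] := Sp0_Fk sx; have cG := Sp_cadlag SG.
have TT := itvTT T_ge0.
have sFT : sigma_algebra setT (FF T) by case: FF_filtration => + _ _; apply.
have FTm : FF T `<=` measurable by case: FF_filtration => _ + _; apply.
have [N [SN mN NT]] : exists N : proc, [/\ Sp P T FF p N, martingale P T FF N &
    {ae P, forall w, N T w = xi w + Fk x T w}].
  apply: rcll_martingale_exists => //.
  have [Fxi xioo] := xi_Lp; split.
    move=> i; rewrite (_ : (fun _ => _) = fun w => xi w ord0 i + Fk x T w ord0 i).
      by apply: measurable_wrtD => //; exact: cG.2.
    by apply/funext => w; rewrite mxE.
  apply: (@le_lt_trans _ _ (vLnorm P p xi + vLnorm P p (Fk x T))%E).
    apply: vLnormD => // i; last exact: (adapted_measurable FF_filtration _ cG.2 TT).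
    exact: measurable_wrt_fun FTm (Fxi i).
  rewrite lte_add_pinfty//.
  apply: le_lt_trans (vLnorm_Sp_norm P T_ge0 FF_filtration p_gt1 cG TT) _.
  by case: SG.
exists (psub N (Fk x), fun t w => N 0 w - N t w); split; last first.
  by exists N; split => //; apply: nearW.
split => /=; first exact: SpB.
split; last exact: martingale_initialB.
split; first by apply: SpB => //; exact: Sp_initial.
by apply: nearW => w; rewrite subrr.
Qed.

(** The iterates from 0 have geometrically decreasing increments, so they converge
in [S^p] to some [L]; by contraction the image of [L] is also their limit. *)
Lemma picard_fixed_point : exists x, space x /\ picard x x.
Proof.
have [Phi hPhi] : exists Phi : proc * proc -> proc * proc,
    forall x, space x -> space (Phi x) /\ picard x (Phi x).
  have : forall x, exists x', space x -> space x' /\ picard x x'.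
    move=> x; have [sx|nsx] := pselect (space x).
      by have [x' ?] := picard_exists sx; exists x'.
    by exists x.
  by move=> /choice[Phi ?]; exists Phi.
have s0 : space ((fun _ _ => 0), (fun _ _ => 0)).
  have O := itv0T T_ge0.
  have mz t : t \in `[0, T] -> vmeasurable_wrt (FF t) (fun=> 0 : 'rV[R]_n).
    move=> tT i; rewrite (_ : (fun _ => _) = cst 0).
      by apply: measurable_wrt_cst; case: FF_filtration => + _ _; apply.
    by apply/funext => w; rewrite mxE.
  have c0 : cadlag T FF (fun (_ : R) (_ : Omega) => 0 : 'rV[R]_n).
    by apply: cadlag_cst => //; exact: mz.
  have S0 : Sp P T FF p (fun (_ : R) (_ : Omega) => 0 : 'rV[R]_n).
    split; [exact: c0.1|exact: c0.2|].
    rewrite /Sp_norm (_ : sup_norm _ _ = cst 0%E).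
      by rewrite Lnorm0// gt_eqF// (lt_trans _ p_gt1)// lte01.
    apply/funext => w; apply/eqP; rewrite eq_le sup_norm_ge0// andbT.
    by apply: sup_norm_le => t _; rewrite enorm0.
  split => //; split; first by split => //; exact: nearW.
  apply: martingale_cst => //; first exact: mz.
  move=> i; rewrite (_ : (fun _ => _) = cst 0%E); first exact: integrable0.
  by apply/funext => w; rewrite mxE.
pose S m := iter m Phi ((fun _ _ => 0), (fun _ _ => 0)).
have sS m : space (S m) by elim: m => [//|m IH]; exact: (hPhi _ IH).1.
have pS m : picard (S m) (S m.+1) by exact: (hPhi _ (sS m)).2.
have [k0 k1] := (kappa_ge0, kappa_lt1).
have decay m : (dist (S m.+1) (S m) <= (kappa ^+ m)%:E * dist (S 1%N) (S 0%N))%E.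
  elim: m => [|m IH]; first by rewrite expr0 mul1e.
  apply: le_trans (picard_contraction (sS _) (sS _) (sS _) (sS _) (pS _) (pS _)) _.
  rewrite exprS (EFinM kappa) -[leRHS]muleA.
  by apply: lee_wpmul2l; rewrite ?lee_fin.
have geom j : \sum_(0 <= m < j) kappa ^+ m <= (1 - kappa)^-1.
  suff : \sum_(0 <= m < j) kappa ^+ m * (1 - kappa) = 1 - kappa ^+ j.
    rewrite -mulr_suml => h; rewrite -[leRHS]mul1r ler_pdivlMr ?subr_gt0// h.
    by rewrite gerBl exprn_ge0.
  elim: j => [|j IH]; first by rewrite big_nil expr0 subrr.
  by rewrite big_nat_recr//= IH exprS; ring.
have summ : (\sum_(0 <= m <oo) dist (S m.+1) (S m) < +oo)%E.
  apply: (@le_lt_trans _ _ ((1 - kappa)^-1%:E * dist (S 1%N) (S 0%N))%E); last first.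
    rewrite lte_mul_pinfty//; first by rewrite lee_fin invr_ge0 subr_ge0 ltW.
    by rewrite -ge0_fin_numE ?dist_ge0// dist_fin.
  apply: lime_le; first by apply: is_cvg_nneseries => m _ _; exact: dist_ge0.
  apply: nearW => j.
  apply: (@le_trans _ _ (\sum_(0 <= m < j) ((kappa ^+ m)%:E * dist (S 1%N) (S 0%N)))%E).
    by apply: lee_sum => m _; exact: decay.
  rewrite -ge0_sume_distrl; last by move=> m _; rewrite lee_fin exprn_ge0.
  by apply: lee_wpmul2r; [exact: dist_ge0|rewrite sumEFin lee_fin].
pose Y m := (S m).1; pose M m := (S m).2.
have SpY m : Sp P T FF p (Y m) by case: (sS m).
have SpM m : Sp P T FF p (M m) by case: (sS m) => _ [[]].
have sumY : (\sum_(0 <= m <oo) norm (psub (Y m.+1) (Y m)) < +oo)%E.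
  apply: le_lt_trans summ; apply: lee_nneseries => [m _ _|m _]; first exact: Sp_norm_ge0.
  by rewrite /dist leeDl// Sp_norm_ge0.
have sumM : (\sum_(0 <= m <oo) norm (psub (M m.+1) (M m)) < +oo)%E.
  apply: le_lt_trans summ; apply: lee_nneseries => [m _ _|m _]; first exact: Sp_norm_ge0.
  by rewrite /dist leeDr// Sp_norm_ge0.
pose L := (Sp_limit T Y, Sp_limit T M).
have sL : space L.
  split; first exact: Sp_limit_Sp sumY.
  split; last by apply: Sp_limit_martingale sumM => // m; case: (sS m) => _ [].
  split; first exact: Sp_limit_Sp sumM.
  have h1 := Sp_limit_ae T_ge0 FF_filtration p_gt1 SpM sumM.
  have h2 : {ae P, forall w m, M m 0 w = 0}.
    by apply/ae_foralln => m; case: (sS m) => _ [[_]].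
  apply: filterS2 h1 h2 => w /(_ 0 (itv0T T_ge0)) c Mw.
  have c0 : M m 0 w @[m --> \oo] --> (0 : 'rV[R]_n).
    by apply: cvg_near_cst; apply: nearW => m; exact: Mw.
  exact: (cvg_unique _ c c0).
have [sL' pL'] := hPhi L sL.
pose e m : \bar R := (\sum_(m <= j <oo) norm (psub (Y j.+1) (Y j)) +
  \sum_(m <= j <oo) norm (psub (M j.+1) (M j)))%E.
have dL m : (dist L (S m) <= e m)%E.
  apply: leeD.
    exact: (Sp_limit_norm T_ge0 FF_filtration FF_usual p_gt1 SpY sumY).
  exact: (Sp_limit_norm T_ge0 FF_filtration FF_usual p_gt1 SpM sumM).
have e_cvg : e m @[m --> \oo] --> 0%E.
  rewrite -[0%E in X in _ --> X]adde0; apply: cvgeD => //.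
    by apply: nneseries_tail_cvg => // m _; exact: Sp_norm_ge0.
  by apply: nneseries_tail_cvg => // m _; exact: Sp_norm_ge0.
have bound m : (dist (Phi L) L <= e m + e m.+1)%E.
  apply: le_trans (dist_triangle sL' (sS m.+1) sL) _.
  apply: leeD; last by rewrite dist_sym.
  apply: le_trans (picard_contraction sL (sS m) sL' (sS m.+1) pL' (pS m)) _.
  apply: le_trans (dL m); rewrite -[leRHS]mul1e; apply: lee_wpmul2r; first exact: dist_ge0.
  by rewrite lee_fin ltW.
have d0 : dist (Phi L) L = 0%E.
  apply/eqP; rewrite eq_le dist_ge0 andbT.
  have : (e m + e m.+1)%E @[m --> \oo] --> 0%E.
    rewrite -[0%E in X in _ --> X]adde0; apply: cvgeD => //.
    by rewrite (cvg_shiftS e).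
  by move=> /cvge_to_ge; apply; exact: nearW.
have [i1 i2] := dist_eq0 sL' sL d0.
exists L; split => //; have [N [? ? h1 h2]] := pL'; exists N; split => //.
  exact: Sp_indist_trans (Sp_indist_sym i1) h1.
exact: Sp_indist_trans (Sp_indist_sym i2) h2.
Qed.

Let F0 Y M : Sp P T FF p Y -> Mp0 P T FF p M -> {ae P, forall w, F Y M 0 w = 0}.
Proof. by move=> SY SM; case: (SpF SY SM). Qed.

Lemma iterY_fixed Y M j : Sp P T FF p Y -> Mp0 P T FF p M ->
  indist P T (iterY F Y M 1) Y -> indist P T (iterY F Y M j) Y.
Proof.
move=> SY SM h1; elim: j => [|j IH]; first by apply: nearW.
have hF := F_indist (Sp_iterY j SY SM) SY SM IH.
by apply: filterS2 h1 hF => w /= e1 e2 t tT; rewrite e2// e1.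
Qed.

(** One step of the recursion can be absorbed in its starting point, because the
step does not change the value at time 0. *)
Lemma iterY_shift Y M j : Sp P T FF p Y -> Mp0 P T FF p M ->
  indist P T (iterY F (iterY F Y M 1) M j) (iterY F Y M j.+1).
Proof.
move=> SY SM; have SZ := Sp_iterY 1 SY SM; elim: j => [|j IH]; first by apply: nearW.
have hF := F_indist (Sp_iterY j SZ SM) (Sp_iterY j.+1 SY SM) SM IH.
have M0 : {ae P, forall w, M 0 w = 0} by case: SM => [[]].
apply: filterS3 hF (F0 SY SM) M0 => w h1 h2 h3 t tT.
have h1' := h1 t tT.
rewrite /= in h1' *.
by rewrite h1' h2 h3 !subr0.
Qed.

(** See the opening comment: with [Z = Y^(2, M)], the identity
[Y - Z = F^(k)(Z, M) - F^(k)(Y, M)] forces [Y = Z]. *)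
Lemma fixed_point_solution x : space x -> picard x x ->
  BSE_solution P T FF p F xi x.1 x.2.
Proof.
case: x => Y M sx; have [/= SY SM] := sx; have [[SpM M0] mM] := SM.
move=> [N [_ NT hY hM]]; rewrite /= in hY hM.
have [SG G0] := Sp0_Fk sx; set G := Fk (Y, M) in NT hY SG G0.
pose Z := iterY F Y M 1; have SZ : Sp P T FF p Z by exact: Sp_iterY.
have cY := Sp_cadlag SY; have cZ := Sp_cadlag SZ.
have O := itv0T T_ge0.
(* Y is its own (k+1)-st iterate *)
have hYk : indist P T (iterY F Y M k) Y.
  rewrite -(prednK k_gt0); apply: filterS3 hY hM G0 => w h1 h2 h3 t tT /=.
  rewrite (h1 t tT) (h1 0 O) (h2 t tT) /psub h3 -/(iterF F k Y M) -/(Fk (Y, M)) -/G.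
  by apply/rowP => i; rewrite !mxE; ring.
have hZk : indist P T (iterF F k Z M) (F Y M).
  apply: F_indist => //; first exact: Sp_iterY.
  apply: Sp_indist_trans hYk.
  by have := iterY_shift k.-1 SY SM; rewrite prednK.
have M_G : {ae P, forall w, forall t, t \in `[0, T] ->
    Y t w - Z t w = F Y M t w - G t w}.
  apply: filterS3 hY hM G0 => w h1 h2 h3 t tT.
  rewrite /Z /= (h1 t tT) (h1 0 O) (h2 t tT) /psub h3.
  by apply/rowP => i; rewrite !mxE; ring.
have hYZ : indist P T Y Z.
  have SFZ : Sp P T FF p (iterF F k Z M) by have [] := @Sp0_Fk (Z, M) (conj SZ SM).
  have lip := F_lip SY SZ SM SM.
  apply: (Sp_norm_eq0 T_ge0 FF_filtration p_gt1) => //.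
  have yfin : norm (psub Y Z) \is a fin_num.
    rewrite ge0_fin_numE ?Sp_norm_ge0//.
    by have [] := SpB T_ge0 FF_filtration p_gt1 SY SZ.
  apply: (@contraction_eq0 _ C) => //; [exact: Sp_norm_ge0|exact: lt_trans C_lt (cp_lt1 p_gt1)|].
  rewrite Sp_norm_refl adde0 in lip; apply: le_trans lip.
  apply: (Sp_norm_le T_ge0 FF_filtration p_gt1).
  - exact: cadlagB (Sp_cadlag SG) (Sp_cadlag SFZ).
  - exact: cadlagB.
  - apply: filterS2 M_G hZk => w e1 e2 t tT.
    by rewrite /psub (e1 t tT) (e2 t tT) enorm_distC.
split => //; apply: filterS3 (filterI hY hM) (filterI hYZ M_G) (filterI NT G0).
move=> w [h1 h2] [h3 h4] [h5 h6] t tT; have TT := itvTT T_ge0.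
have e1 := h3 t tT; have e2 := h4 T TT; have e3 := h3 T TT.
have e4 := h1 0 O; have e5 := h2 T TT; have e6 := h1 T TT.
rewrite /Z /= in e1; rewrite /psub h6 in e4; rewrite /psub in e6.
rewrite -e3 subrr in e2.
apply/rowP => i.
have c1 := congr1 (fun v : 'rV[R]_n => v ord0 i) e1.
have c2 := congr1 (fun v : 'rV[R]_n => v ord0 i) e2.
have c4 := congr1 (fun v : 'rV[R]_n => v ord0 i) e4.
have c5 := congr1 (fun v : 'rV[R]_n => v ord0 i) e5.
have c7 := congr1 (fun v : 'rV[R]_n => v ord0 i) h5.
move: c1 c2 c4 c5 c7; rewrite !mxE /G; lra.
Qed.

(** The martingale is [N = Y_0 - M]. *)
Lemma solution_picard Y M : BSE_solution P T FF p F xi Y M ->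
  space (Y, M) /\ picard (Y, M) (Y, M).
Proof.
move=> [SY SM eqn]; split => //; have [[SpM M0] mM] := SM.
have O := itv0T T_ge0; have TT := itvTT T_ge0; have cY := Sp_cadlag SY.
have h0 := F0 SY SM.
have fix1 : indist P T (iterY F Y M 1) Y.
  apply: filterS3 eqn h0 M0 => w h1 h2 h3 t tT /=.
  have e1 := h1 t tT; have := h1 0 O; rewrite -e1 h2 h3 !addr0 => ->.
  by apply/rowP => i; rewrite !mxE; ring.
have hG : indist P T (Fk (Y, M)) (F Y M).
  by apply: F_indist => //; [exact: Sp_iterY|exact: iterY_fixed].
exists (fun t w => Y 0 w - M t w); split.
- split; first by apply: SpB => //; exact: Sp_initial.
  apply: martingaleB => //; apply: martingale_cst => //; first exact: (cY.2 0 O).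
  move=> i; apply: (vLnorm_integrable p_gt1).
    by move=> j; exact: (adapted_measurable FF_filtration _ cY.2 O).
  apply: le_lt_trans (vLnorm_Sp_norm P T_ge0 FF_filtration p_gt1 cY O) _.
  by case: SY.
- apply: filterS3 (filterI eqn hG) h0 M0 => w [h1 h4] h2 h3.
  have := h1 0 O; rewrite h2 h3 !addr0 => ->.
  by rewrite (h4 T TT) addrK.
- apply: filterS3 (filterI fix1 hG) h0 M0 => w [h1 h4] h2 h3 t tT /=.
  rewrite -(h1 t tT) /= /psub (h4 t tT).
  by apply/rowP => i; rewrite !mxE; ring.
- apply: filterS M0 => w h3 t tT /=; rewrite h3.
  by apply/rowP => i; rewrite !mxE; ring.
Qed.

Lemma BSE_existence_uniqueness : exists Y M : proc,
  BSE_solution P T FF p F xi Y M /\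
  (forall Y' M' : proc, BSE_solution P T FF p F xi Y' M' ->
    indist P T Y' Y /\ indist P T M' M).
Proof.
have [x [sx px]] := picard_fixed_point.
exists x.1, x.2; split; first exact: fixed_point_solution.
move=> Y' M' /solution_picard[s' p'].
apply: (dist_eq0 s' sx); apply: (@contraction_eq0 _ kappa).
- exact: dist_ge0.
- exact: dist_fin.
- exact: kappa_lt1.
- exact: picard_contraction.
Qed.

End picard.

Theorem theorem3p1 (R : realType) (d : measure_display)
    (Omega : measurableType d) (P : probability Omega R)
    (T : R) (FF : R -> set (set Omega)) (n : nat) (p : \bar R)
    (xi : Omega -> 'rV[R]_n)
    (F : process R Omega n -> process R Omega n -> process R Omega n)
    (T_ge0 : 0 <= T) (n_gt0 : (0 < n)%N)
    (FF_filtration : is_filtration T FF)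
    (FF_usual : usual_conditions P T FF)
    (p_gt1 : (1 < p)%E)
    (xi_Lp : Lp_wrt P p (FF T) xi)
    (F_map : is_Sp_map P T FF p F) :
  (exists (k : nat) (C : R),
    [/\ (1 <= k)%N, C < cp p &
      forall Y Y' M M' : process R Omega n,
        Sp P T FF p Y -> Sp P T FF p Y' ->
        Mp0 P T FF p M -> Mp0 P T FF p M' ->
        (Sp_norm P T p (psub (iterF F k Y M) (iterF F k Y' M')) <=
         C%:E * (Sp_norm P T p (psub Y Y') + Sp_norm P T p (psub M M')))%E]) ->
  exists Y M : process R Omega n,
    BSE_solution P T FF p F xi Y M /\
    (forall Y' M' : process R Omega n,
      BSE_solution P T FF p F xi Y' M' ->
      indist P T Y' Y /\ indist P T M' M).
Proof.
move=> [k [C [k_gt0 C_lt lip]]].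
apply: (@BSE_existence_uniqueness _ _ _ P T FF n p xi F T_ge0 FF_filtration FF_usual
  p_gt1 xi_Lp F_map k (Num.max C 0)) => //.
- by rewrite le_max lexx orbT.
- by rewrite gt_max C_lt cp_gt0.
move=> Y Y' M M' SY SY' SM SM'; apply: (le_trans (lip Y Y' M M' SY SY' SM SM')).
apply: lee_wpmul2r; first by rewrite adde_ge0// Sp_norm_ge0.
by rewrite lee_fin le_max lexx.
Qed.
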